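(* Let $A\in\{\mathbb{C},\mathbb{H},\mathbb{O}\}$, let $\Omega\subseteq A$ be a circular set, let $f\in\mathcal{S}(\Omega)$ and suppose that $\Omega':=\Omega\setminus V(N(f))\neq\emptyset$. For all $x\in\Omega'\cap(\mathbb{R}\cup V(f'_s))$ it holds $f^{-\bullet}(x)=f(x)^{-1}=f(y)^{-1}$ for each $y\in\mathbb{S}_x$. If $\Omega'':=\Omega'\setminus(\mathbb{R}\cup V(f'_s))\neq\emptyset$, then for all $x\in\Omega''$ $$f^{-\bullet}(x)=f(T_f(x))^{-1},\qquad (\ast)$$ where $$T_f(x):=\big(f^c(x)^{-1}\big((xf^c(x))f'_s(x)\big)\big)f'_s(x)^{-1}.\qquad(\ast\ast)$$ $T_f$ is a bijective self-map of $\Omega''$. For all $y\in\Omega''$, the restriction $(T_f)_{|\mathbb{S}_y}$ is a conformal transformation of the sphere $\mathbb{S}_y$. If $f_{|\Omega''}\in\mathcal{S}^0(\Omega'')$, then $T_f$ is a homeomorphism. If $\Omega'$ is open and $f_{|\Omega'}\in\mathcal{S}^\omega(\Omega')$ (a class that contains $\mathcal{SR}(\Omega')$), then $f'_s$ extends to $\Omega'$ in real analytic fashion. Denote the zero set of the extension by $V$ and set $\widehat\Omega:=\Omega'\setminus V$. Then formula $(\ast\ast)$ (with $f'_s$ denoting the extension) defines a real analytic diffeomorphism $T_f$ of $\widehat\Omega$ onto itself, fulfilling equality $(\ast)$ for all $x\in\widehat\Omega$. Finally, in all cases described, $T_{f^{-\bullet}}$ is the inverse map to $T_f$.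
   Context: $A$ is one of the real $*$-algebras $\mathbb{C},\mathbb{H},\mathbb{O}$ (complex numbers, quaternions, octonions) with standard conjugation $x\mapsto x^c$ and Euclidean topology and differential structure; $\operatorname{im}(x)=(x-x^c)/2$; $\mathbb{S}=\{w\in A: w^2=-1\}$; every $x\in A$ can be written $x=\alpha+\beta J$ with $\alpha,\beta\in\mathbb{R}$, $J\in\mathbb{S}$, and then $\mathbb{S}_x=\{\alpha+\beta I: I\in\mathbb{S}\}$. For nonempty $D\subseteq\mathbb{C}$ invariant under complex conjugation, $\Omega_D=\{\alpha+\beta J:\alpha,\beta\in\mathbb{R},\,J\in\mathbb{S},\,\alpha+i\beta\in D\}$; sets of this form are called circular. Let $\Omega=\Omega_D$. A function $f:\Omega\to A$ is a slice function if there are $F_1,F_2:D\to A$ with $F_1(\bar z)=F_1(z)$, $F_2(\bar z)=-F_2(z)$ and $f(\alpha+\beta J)=F_1(\alpha+i\beta)+JF_2(\alpha+i\beta)$ for all $\alpha+i\beta\in D$, $J\in\mathbb{S}$ ($F_1,F_2$ are determined by $f$). $\mathcal{S}(\Omega)$ is the set of slice functions; $\mathcal{S}^0(\Omega)$ is the subset where $F_1,F_2$ are continuous; for $D$ open, $\mathcal{S}^\omega(\Omega)$ is the subset where $F_1,F_2$ are real analytic, and $\mathcal{SR}(\Omega)$ (slice regular functions) is the subset where $F_1,F_2$ are $C^1$ with $\partial F_1/\partial\alpha=\partial F_2/\partial\beta$, $\partial F_1/\partial\beta=-\partial F_2/\partial\alpha$. If $f,g$ correspond to $(F_1,F_2),(G_1,G_2)$,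 the slice product $f\cdot g$ corresponds to $(F_1G_1-F_2G_2,\;F_1G_2+F_2G_1)$ and the slice conjugate $f^c$ corresponds to $(F_1^c,F_2^c)$. The normal function is $N(f)=f\cdot f^c$. $V(h)$ denotes the zero set of $h$ in its domain. The reciprocal $f^{-\bullet}\in\mathcal{S}(\Omega')$ is the multiplicative inverse of $f_{|\Omega'}$ with respect to the slice product; it exists and equals $f^{-\bullet}(x)=(N(f)(x))^{-1}f^c(x)$. The spherical derivative $f'_s:\Omega\setminus\mathbb{R}\to A$ is $f'_s(x)=\frac12\operatorname{im}(x)^{-1}(f(x)-f(x^c))$, so $V(f'_s)\subseteq\Omega\setminus\mathbb{R}$. $T_{f^{-\bullet}}$ is defined by the same formula with $f^{-\bullet}$ in place of $f$. ''Conformal'' means angle-preserving, not necessarily orientation-preserving (a vacuous condition beyond bijectivity when $A=\mathbb{C}$, where $\mathbb{S}_y$ is a pair of points). *)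

(* Defs.v *)
From HB Require Import structures.
From mathcomp Require Import all_boot all_order all_algebra.
From mathcomp Require Import all_classical all_reals all_analysis.

Set Implicit Arguments.
Unset Strict Implicit.
Unset Printing Implicit Defensive.

Import Order.TTheory GRing.Theory Num.Theory numFieldNormedType.Exports.

Local Open Scope classical_set_scope.
Local Open Scope ring_scope.

(* Cayley-Dickson algebras of dimension 2 ^ n: CD R 1, CD R 2 and CD R 3 are
   the complex numbers, the quaternions and the octonions.  The norm of the
   product normed module is a sup norm, which induces the Euclidean topology. *)
Fixpoint CD (R : realType) (n : nat) : normedModType R :=
  match n with
  | 0 => R^o
  | m.+1 => (CD R m * CD R m)%type
  end.

Section CayleyDickson.
Context {R : realType}.

Fixpoint cdone (n : nat) : CD R n :=
  match n with
  | 0 => (1 : R)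
  | m.+1 => (cdone m, 0)
  end.

Fixpoint cdre (n : nat) : CD R n -> R :=
  match n with
  | 0 => fun x => x
  | m.+1 => fun x => cdre x.1
  end.

Fixpoint cdconj (n : nat) : CD R n -> CD R n :=
  match n with
  | 0 => fun x => x
  | m.+1 => fun x => (cdconj x.1, - x.2)
  end.

Fixpoint cdmul (n : nat) : CD R n -> CD R n -> CD R n :=
  match n with
  | 0 => fun x y => (x : R) * (y : R)
  | m.+1 => fun x y =>
      (cdmul x.1 y.1 - cdmul (cdconj y.2) x.2,
       cdmul y.2 x.1 + cdmul x.2 (cdconj y.1))
  end.

Fixpoint cdcoords (n : nat) : CD R n -> seq R :=
  match n with
  | 0 => fun x => [:: (x : R)]
  | m.+1 => fun x => cdcoords x.1 ++ cdcoords x.2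
  end.

End CayleyDickson.

Notation "x ** y" := (cdmul x y) (at level 40, left associativity) : ring_scope.

Section Algebra.
Context {R : realType} {n : nat}.
Notation A := (CD R n).

(* The Euclidean scalar product. *)
Definition cddot (x y : A) : R := cdre (x ** cdconj y).

(* With the convention cdinv 0 = 0. *)
Definition cdinv (x : A) : A := (cddot x x)^-1 *: cdconj x.

Definition cdim (x : A) : A := 2^-1 *: (x - cdconj x).

Definition cdreal : set A := [set x | exists a : R, x = a *: cdone n].

Definition imunits : set A := [set w | w ** w = - cdone n].

(* z = (alpha, beta) stands for alpha + i beta, and is sent to alpha + beta J. *)
Definition slice_point (z : CD R 1) (J : A) : A :=
  (z.1 : R) *: cdone n + (z.2 : R) *: J.

Definition sphere (x : A) : set A :=
  [set y | exists z J I, [/\ imunits J, imunits I,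
                             x = slice_point z J & y = slice_point z I]].

Definition zeros (U : set A) (h : A -> A) : set A := [set x | U x /\ h x = 0].

Definition Omega (D : set (CD R 1)) : set A :=
  [set x | exists z J, [/\ D z, imunits J & x = slice_point z J]].

Definition circular (Om : set A) : Prop :=
  exists D : set (CD R 1),
    [/\ D !=set0, (forall z, D z -> D (cdconj z)) & Om = Omega D].

(* The inverse of Omega: if D is invariant under conjugation, then
   plane (Omega D) = D. *)
Definition plane (Om : set A) : set (CD R 1) :=
  [set z | exists2 J, imunits J & Om (slice_point z J)].

End Algebra.

Section Analytic.
Context {R : realType}.

(* The sum of E over all multi-indices of total degree k. *)
Definition sum_degree (d k : nat) (W : nmodType)
    (E : {ffun 'I_d -> nat} -> W) : W :=
  \sum_(a : {ffun 'I_d -> 'I_k.+1} | (\sum_i a i == k)%N)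
     E [ffun i => nat_of_ord (a i)].

Definition real_analytic_at (m n : nat) (f : CD R m -> CD R n) (a : CD R m) :
    Prop :=
  exists (c : {ffun 'I_(2 ^ m) -> nat} -> CD R n) (r : R),
    [/\ 0 < r,
        cvgn (series (fun k => sum_degree k (fun e => `|c e| * r ^+ k))) &
        \forall h \near 0,
          series (fun k => sum_degree k
            (fun e => (\prod_(i < 2 ^ m) (cdcoords h)`_i ^+ e i) *: c e)) @ \oo
          --> f (a + h)].

Definition real_analytic (m n : nat) (U : set (CD R m)) (f : CD R m -> CD R n) :
    Prop :=
  open U /\ forall a, U a -> real_analytic_at f a.

Definition inverse_on (m n : nat) (U : set (CD R m)) (V : set (CD R n))
    (f : CD R m -> CD R n) (g : CD R n -> CD R m) : Prop :=
  [/\ forall x, U x -> V (f x), forall y, V y -> U (g y),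
      forall x, U x -> g (f x) = x & forall y, V y -> f (g y) = y].

Definition homeomorphism (m n : nat) (U : set (CD R m)) (V : set (CD R n))
    (f : CD R m -> CD R n) : Prop :=
  exists g, [/\ inverse_on U V f g,
                {within U, continuous f} & {within V, continuous g}].

Definition analytic_diffeomorphism (m n : nat)
    (U : set (CD R m)) (V : set (CD R n)) (f : CD R m -> CD R n) : Prop :=
  exists g, [/\ inverse_on U V f g, real_analytic U f & real_analytic V g].

Definition angle (n : nat) (u v : CD R n) : R :=
  acos (cddot u v / (Num.sqrt (cddot u u) * Num.sqrt (cddot v v))).

(* gamma is a curve in M with gamma(0) = p and gamma'(0) = u. *)
Definition curve_at (n : nat) (M : set (CD R n)) (p u : CD R n)
    (gamma : R -> CD R n) : Prop :=
  [/\ forall t, M (gamma t), gamma 0 = p & is_derive (0 : R) 1 gamma u].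

Definition conformal (n : nat) (M : set (CD R n)) (f : CD R n -> CD R n) :
    Prop :=
  set_bij M M f /\
  forall p u1 u2 gamma1 gamma2, u1 != 0 -> u2 != 0 ->
    curve_at M p u1 gamma1 -> curve_at M p u2 gamma2 ->
    exists v1 v2 : CD R n,
      [/\ v1 != 0, v2 != 0,
          is_derive (0 : R) 1 (f \o gamma1) v1,
          is_derive (0 : R) 1 (f \o gamma2) v2 &
          angle v1 v2 = angle u1 u2].

Definition dalpha (n : nat) (F : CD R 1 -> CD R n) : CD R 1 -> CD R n :=
  'D_((1, 0) : CD R 1) F.

Definition dbeta (n : nat) (F : CD R 1 -> CD R n) : CD R 1 -> CD R n :=
  'D_((0, 1) : CD R 1) F.

Definition C1 (n : nat) (D : set (CD R 1)) (F : CD R 1 -> CD R n) : Prop :=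
  forall z, D z ->
    [/\ derivable F z ((1, 0) : CD R 1), derivable F z ((0, 1) : CD R 1),
        {for z, continuous (dalpha F)} & {for z, continuous (dbeta F)}].

End Analytic.

Section Slice.
Context {R : realType} {n : nat}.
Notation A := (CD R n).
Notation stemT := ((CD R 1 -> A) * (CD R 1 -> A))%type.

Definition is_stem (Om : set A) (f : A -> A) (F : stemT) : Prop :=
  forall z, plane Om z ->
    [/\ F.1 (cdconj z) = F.1 z, F.2 (cdconj z) = - F.2 z &
        forall J, imunits J -> f (slice_point z J) = F.1 z + J ** F.2 z].

Definition slice (Om : set A) (f : A -> A) : Prop :=
  circular Om /\ exists F, is_stem Om f F.

Definition slice_continuous (Om : set A) (f : A -> A) : Prop :=
  circular Om /\ exists F, [/\ is_stem Om f F,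
    {within plane Om, continuous F.1} & {within plane Om, continuous F.2}].

Definition slice_analytic (Om : set A) (f : A -> A) : Prop :=
  circular Om /\ exists F, [/\ is_stem Om f F,
    real_analytic (plane Om) F.1 & real_analytic (plane Om) F.2].

Definition slice_regular (Om : set A) (f : A -> A) : Prop :=
  [/\ circular Om, open (plane Om) & exists F,
    [/\ is_stem Om f F, C1 (plane Om) F.1, C1 (plane Om) F.2 &
        forall z, plane Om z ->
          dalpha F.1 z = dbeta F.2 z /\ dbeta F.1 z = - dalpha F.2 z]].

Definition stem (Om : set A) (f : A -> A) : stemT := get (is_stem Om f).

(* The slice function on Om induced by F, extended by 0 outside of Om. *)
Definition slice_induced (Om : set A) (F : stemT) (x : A) : A :=
  xget 0 [set y | exists z J, [/\ plane Om z, imunits J,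
                                  x = slice_point z J & y = F.1 z + J ** F.2 z]].

Definition slice_mul (Om : set A) (f g : A -> A) : A -> A :=
  let F := stem Om f in let G := stem Om g in
  slice_induced Om (fun z => F.1 z ** G.1 z - F.2 z ** G.2 z,
              fun z => F.1 z ** G.2 z + F.2 z ** G.1 z).

Definition slice_conj (Om : set A) (f : A -> A) : A -> A :=
  let F := stem Om f in
  slice_induced Om (fun z => cdconj (F.1 z), fun z => cdconj (F.2 z)).

Definition slice_normal (Om : set A) (f : A -> A) : A -> A :=
  slice_mul Om f (slice_conj Om f).

(* The inverse of f for the slice product; it is unique on Om. *)
Definition reciprocal (Om : set A) (f : A -> A) : A -> A :=
  get [set g | slice Om g /\ forall x, Om x ->
                 slice_mul Om f g x = cdone n /\ slice_mul Om g f x = cdone n].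

Definition spherical_derivative (f : A -> A) (x : A) : A :=
  2^-1 *: (cdinv (cdim x) ** (f x - f (cdconj x))).

Definition zeros_sd (Om : set A) (f : A -> A) : set A :=
  zeros (Om `\` cdreal) (spherical_derivative f).

Definition analytic_extension (Om : set A) (f E : A -> A) : Prop :=
  real_analytic Om E /\
  forall x, Om x -> ~ cdreal x -> E x = spherical_derivative f x.

(* The map T_f, with fs in the role of the spherical derivative of f. *)
Definition Tmap (Om : set A) (f fs : A -> A) (x : A) : A :=
  let fc := slice_conj Om f in
  (cdinv (fc x) ** ((x ** fc x) ** fs x)) ** cdinv (fs x).

End Slice.

(* Main.v *)
(* Write a slice function as f (alpha + beta J) = a + J b with (a, b) the value
   at alpha + i beta of its stem.  In dimension at most 8 the norm of the algebra
   is multiplicative, (a, b) is invertible in the complexification as soon as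
   normsq (a, b) <> 0, and the inverse is explicit.  For fixed p, q <> 0 the map
   x |-> (p^-1 ((x p) q)) q^-1 is linear, fixes 1 and permutes the imaginary
   units, so T_f preserves every sphere; with p = f^c (x) and q proportional to b
   it sends J to the unit I for which a + I b is the inverse of the value of the
   reciprocal at J.  The reciprocal has the inverse stem, so exchanging both
   functions inverts T_f.  On a sphere, T_f is thus an affine similarity, an
   inversion, and an affine similarity.
   For analytic stems, a power series in (alpha, beta) splits into its even and
   odd parts in beta; as beta^2 is a quadratic form in x, both F.1 and
   F.2 / beta become power series in x.  Regular stems are analytic by the Cauchy
   integral formula, whose integrals are replaced by averages over the roots of
   unity: on circles shrinking to the point, the average of F times a truncated
   Cauchy kernel hardly changes, and the coefficients of the expansion are limits
   of averages along an ultrafilter. *)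
Require Import Defs.
From mathcomp Require Import all_boot all_order all_algebra.
From mathcomp Require Import all_classical all_reals all_analysis.
From mathcomp Require Import ring lra complex.

Set Implicit Arguments.
Unset Strict Implicit.
Unset Printing Implicit Defensive.

Import Order.TTheory GRing.Theory Num.Theory numFieldNormedType.Exports.

Local Open Scope classical_set_scope.
Local Open Scope ring_scope.

(** * Cayley-Dickson algebras *)

Section CayleyDicksonAlgebra.
Context {R : realType}.

(** The octonions shape the algebra: no identity may rest on associativity. What survives is that
    the real part is a trace in every dimension ([cdreC], [cdreA]) and that the alternative law
    [cdmul_conjK] holds up to dimension 8. The rest is obtained by polarising that law and comparing
    scalar products. The predicate [twistable] isolates what the argument uses of a function and of
    its spherical derivative [E], essentially [F.2 z = z.2 *: E]. One proof then serves the
    spherical derivative, its analytic extension (where [z.2] may vanish) and the reciprocal.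
    Multi-indices would make products and compositions of power series combinatorial. Germs are
    therefore sequences of homogeneous polynomials with a bound on their size, and multi-indices
    return only for the comparison with [real_analytic_at]. Shrinking the radius brings every
    geometric ratio down to 1/2 or 1/4, which keeps all estimates explicit. The ultrafilter makes
    boundedness of the averages sufficient: their convergence as the number of roots grows need not
    be established. *)

Lemma cdpairD m (x y : CD R m.+1) : x + y = (x.1 + y.1, x.2 + y.2).
Proof. by []. Qed.

Lemma cdpairN m (x : CD R m.+1) : - x = (- x.1, - x.2).
Proof. by []. Qed.

Lemma cdpairZ m (a : R) (x : CD R m.+1) : a *: x = (a *: x.1, a *: x.2).
Proof. by []. Qed.

Lemma cdreD n (x y : CD R n) : cdre (x + y) = cdre x + cdre y.
Proof. by elim: n x y => [//|m IH] [x1 x2] [y1 y2]; rewrite cdpairD /= IH. Qed.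

Lemma cdreZ n (a : R) (x : CD R n) : cdre (a *: x) = a * cdre x.
Proof. by elim: n x => [//|m IH] [x1 x2]; rewrite cdpairZ /= IH. Qed.

Lemma cdreN n (x : CD R n) : cdre (- x) = - cdre x.
Proof. by rewrite -scaleN1r cdreZ mulN1r. Qed.

Lemma cdreB n (x y : CD R n) : cdre (x - y) = cdre x - cdre y.
Proof. by rewrite cdreD cdreN. Qed.

Lemma cdre0 n : cdre (0 : CD R n) = 0.
Proof. by rewrite -(scale0r (0 : CD R n)) cdreZ mul0r. Qed.

Lemma cdre1 n : cdre (cdone n : CD R n) = 1.
Proof. by elim: n. Qed.

Lemma cdconjD n (x y : CD R n) : cdconj (x + y) = cdconj x + cdconj y.
Proof.
elim: n x y => [//|m IH] [x1 x2] [y1 y2].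
by rewrite !cdpairD /= IH opprD.
Qed.

Lemma cdconjZ n (a : R) (x : CD R n) : cdconj (a *: x) = a *: cdconj x.
Proof.
elim: n x => [//|m IH] [x1 x2].
by rewrite !cdpairZ /= IH scalerN.
Qed.

Lemma cdconjN n (x : CD R n) : cdconj (- x) = - cdconj x.
Proof. by rewrite -scaleN1r cdconjZ scaleN1r. Qed.

Lemma cdconjB n (x y : CD R n) : cdconj (x - y) = cdconj x - cdconj y.
Proof. by rewrite cdconjD cdconjN. Qed.

Lemma cdconj0 n : cdconj (0 : CD R n) = 0.
Proof. by rewrite -(scale0r (0 : CD R n)) cdconjZ !scale0r. Qed.

Lemma cdconj1 n : cdconj (cdone n : CD R n) = cdone n.
Proof. by elim: n => [//|m IH] /=; rewrite IH oppr0. Qed.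

Lemma cdconjK n : involutive (@cdconj R n).
Proof. by elim: n => [//|m IH] [x1 x2] /=; rewrite IH opprK. Qed.

Lemma cdre_conj n (x : CD R n) : cdre (cdconj x) = cdre x.
Proof. by elim: n x => [//|m IH] [x1 x2] /=. Qed.

Lemma cdmul_pair m (x y : CD R m.+1) :
  x ** y = (x.1 ** y.1 - cdconj y.2 ** x.2, y.2 ** x.1 + x.2 ** cdconj y.1).
Proof. by []. Qed.

Lemma cdmulD n (x y z : CD R n) :
  (x + y) ** z = x ** z + y ** z /\ z ** (x + y) = z ** x + z ** y.
Proof.
elim: n x y z => [|m IH].
  by move=> x y z; split; [exact: (@mulrDl R) | exact: (@mulrDr R)].
have Dl (x y z : CD R m) : (x + y) ** z = x ** z + y ** z by have [] := IH x y z.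
have Dr (x y z : CD R m) : z ** (x + y) = z ** x + z ** y by have [] := IH x y z.
move=> [x1 x2] [y1 y2] [z1 z2]; rewrite !cdmul_pair !cdpairD /=.
rewrite !cdconjD !(Dl, Dr) !opprD.
by split; congr (_, _); rewrite addrACA.
Qed.

Lemma cdmulDl n (x y z : CD R n) : (x + y) ** z = x ** z + y ** z.
Proof. by have [] := cdmulD x y z. Qed.

Lemma cdmulDr n (x y z : CD R n) : x ** (y + z) = x ** y + x ** z.
Proof. by have [] := cdmulD y z x. Qed.

Lemma cdmulZ n (a : R) (x y : CD R n) :
  (a *: x) ** y = a *: (x ** y) /\ x ** (a *: y) = a *: (x ** y).
Proof.
elim: n x y => [|m IH].
  by move=> x y; split; [exact/esym/(@mulrA R) | exact: (@mulrCA R)].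
have Zl (x y : CD R m) : (a *: x) ** y = a *: (x ** y) by have [] := IH x y.
have Zr (x y : CD R m) : x ** (a *: y) = a *: (x ** y) by have [] := IH x y.
move=> [x1 x2] [y1 y2]; rewrite !cdmul_pair !cdpairZ /=.
by rewrite !cdconjZ !(Zl, Zr) -scalerBr -scalerDr.
Qed.

Lemma cdmulZl n (a : R) (x y : CD R n) : (a *: x) ** y = a *: (x ** y).
Proof. by have [] := cdmulZ a x y. Qed.

Lemma cdmulZr n (a : R) (x y : CD R n) : x ** (a *: y) = a *: (x ** y).
Proof. by have [] := cdmulZ a x y. Qed.

Lemma cdmulNl n (x y : CD R n) : (- x) ** y = - (x ** y).
Proof. by rewrite -scaleN1r cdmulZl scaleN1r. Qed.

Lemma cdmulNr n (x y : CD R n) : x ** (- y) = - (x ** y).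
Proof. by rewrite -scaleN1r cdmulZr scaleN1r. Qed.

Lemma cdmulBl n (x y z : CD R n) : (x - y) ** z = x ** z - y ** z.
Proof. by rewrite cdmulDl cdmulNl. Qed.

Lemma cdmulBr n (x y z : CD R n) : x ** (y - z) = x ** y - x ** z.
Proof. by rewrite cdmulDr cdmulNr. Qed.

Lemma cdmul0l n (x : CD R n) : 0 ** x = 0.
Proof. by rewrite -(scale0r (0 : CD R n)) cdmulZl !scale0r. Qed.

Lemma cdmul0r n (x : CD R n) : x ** 0 = 0.
Proof. by rewrite -(scale0r (0 : CD R n)) cdmulZr !scale0r. Qed.

Lemma cdmul1l n (x : CD R n) : cdone n ** x = x.
Proof.
elim: n x => [x|m IH [x1 x2]]; first exact: (@mul1r R).
rewrite cdmul_pair /= IH cdmul0r cdmul0l subr0 addr0.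
suff -> : x2 ** cdone m = x2 by [].
apply: (can_inj (@cdconjK m)).
elim: m x2 {IH x1} => [x|m IH [x1 x2]]; first exact: (@mulr1 R).
rewrite cdmul_pair /= cdconj0 cdmul0l cdmul0l subr0 add0r cdconj1.
by rewrite IH -[in LHS](cdconjK (x2 ** _)) IH cdconjK.
Qed.

Lemma cdmul1r n (x : CD R n) : x ** cdone n = x.
Proof.
elim: n x => [x|m IH [x1 x2]]; first exact: (@mulr1 R).
by rewrite cdmul_pair /= cdconj0 !cdmul0l cdconj1 !IH subr0 add0r.
Qed.

Lemma cdconjM n (x y : CD R n) : cdconj (x ** y) = cdconj y ** cdconj x.
Proof.
elim: n x y => [x y|m IH [x1 x2] [y1 y2]]; first exact: (@mulrC R).
rewrite !cdmul_pair /= cdconjB cdconjN !IH !cdconjK !cdmulNl !cdmulNr opprK.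
by rewrite opprD [- (y2 ** _) - _]addrC.
Qed.

Lemma cdreC n (x y : CD R n) : cdre (x ** y) = cdre (y ** x).
Proof.
elim: n x y => [x y|m IH [x1 x2] [y1 y2]]; first exact: (@mulrC R).
rewrite !cdmul_pair /= !cdreB IH; congr (_ - _).
by rewrite -cdre_conj cdconjM cdconjK.
Qed.

(** The product loses associativity at dimension 8, but its real part never does. With [cdreC] this
    makes the real part a trace, from which the adjoint rules for [cddot] follow in all
    dimensions. *)
Lemma cdreA n (x y z : CD R n) : cdre ((x ** y) ** z) = cdre (x ** (y ** z)).
Proof.
elim: n x y z => [x y z|m IH [x1 x2] [y1 y2] [z1 z2]].
  exact/esym/(@mulrA R).
(* Cyclicity of the trace, available one dimension below; it matches the remaining triple
   products. *)
have rot (a b c : CD R m) : cdre (a ** (b ** c)) = cdre (c ** (a ** b)).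
  by rewrite -IH cdreC.
rewrite !cdmul_pair /= !cdreB !cdmulBl !cdmulBr !cdmulDr !cdconjD !cdmulDl.
rewrite !cdconjM !cdconjK !cdreB !cdreD !IH.
by rewrite (rot (cdconj y2)) (rot (cdconj z2) y2) (rot (cdconj z2) x2); ring.
Qed.

Lemma cddotC n (x y : CD R n) : cddot x y = cddot y x.
Proof. by rewrite /cddot -cdre_conj cdconjM cdconjK. Qed.

Lemma cddotDl n (x y z : CD R n) : cddot (x + y) z = cddot x z + cddot y z.
Proof. by rewrite /cddot cdmulDl cdreD. Qed.

Lemma cddotDr n (x y z : CD R n) : cddot x (y + z) = cddot x y + cddot x z.
Proof. by rewrite cddotC cddotDl !(cddotC x). Qed.

Lemma cddotZl n (a : R) (x y : CD R n) : cddot (a *: x) y = a * cddot x y.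
Proof. by rewrite /cddot cdmulZl cdreZ. Qed.

Lemma cddotZr n (a : R) (x y : CD R n) : cddot x (a *: y) = a * cddot x y.
Proof. by rewrite cddotC cddotZl cddotC. Qed.

Lemma cddotNl n (x y : CD R n) : cddot (- x) y = - cddot x y.
Proof. by rewrite -scaleN1r cddotZl mulN1r. Qed.

Lemma cddotNr n (x y : CD R n) : cddot x (- y) = - cddot x y.
Proof. by rewrite -scaleN1r cddotZr mulN1r. Qed.

Lemma cddotBl n (x y z : CD R n) : cddot (x - y) z = cddot x z - cddot y z.
Proof. by rewrite cddotDl cddotNl. Qed.

Lemma cddotBr n (x y z : CD R n) : cddot x (y - z) = cddot x y - cddot x z.
Proof. by rewrite cddotDr cddotNr. Qed.

Lemma cddot0l n (x : CD R n) : cddot 0 x = 0.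
Proof. by rewrite /cddot cdmul0l cdre0. Qed.

Lemma cddot0r n (x : CD R n) : cddot x 0 = 0.
Proof. by rewrite cddotC cddot0l. Qed.

Lemma cddot1r n (x : CD R n) : cddot x (cdone n) = cdre x.
Proof. by rewrite /cddot cdconj1 cdmul1r. Qed.

Lemma cddot_conj n (x y : CD R n) : cddot (cdconj x) (cdconj y) = cddot x y.
Proof. by rewrite /cddot cdconjK cdreC -cdre_conj cdconjM cdconjK. Qed.

Lemma cddot_pair m (x y : CD R m.+1) :
  cddot x y = cddot x.1 y.1 + cddot x.2 y.2.
Proof.
rewrite /cddot cdmul_pair /= cdconjN cdmulNl opprK cdreD.
by rewrite (cdreC (cdconj _)).
Qed.

Lemma cddot_ge0 n (x : CD R n) : 0 <= cddot x x.
Proof.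
elim: n x => [x|m IH x]; first exact: (@sqr_ge0 R x).
by rewrite (cddot_pair x x) addr_ge0.
Qed.

Lemma cddot_eq0 n (x : CD R n) : (cddot x x == 0) = (x == 0).
Proof.
elim: n x => [x|m IH [x1 x2]]; first by rewrite [LHS](@mulf_eq0 R x x) orbb.
by rewrite (cddot_pair (x1, x2) (x1, x2)) paddr_eq0 ?cddot_ge0 //= !IH.
Qed.

Lemma cddot_gt0 n (x : CD R n) : (0 < cddot x x) = (x != 0).
Proof. by rewrite lt_def cddot_ge0 andbT cddot_eq0. Qed.

(** The adjoint of a left multiplication is the left multiplication by the conjugate. The trace
    property alone gives it, in every dimension. *)
Lemma cddot_mull n (x y z : CD R n) : cddot (x ** y) z = cddot y (cdconj x ** z).
Proof. by rewrite /cddot cdconjM cdconjK cdreA cdreC cdreA. Qed.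

Lemma cddot_mulr n (x y z : CD R n) : cddot (x ** y) z = cddot x (z ** cdconj y).
Proof. by rewrite /cddot cdconjM cdconjK cdreA. Qed.

Lemma cdconjE n (x : CD R n) : cdconj x = (2 * cdre x) *: cdone n - x.
Proof.
elim: n x => [x|m IH [x1 x2]] /=.
  by rewrite /GRing.scale /=; lra.
by rewrite cdpairZ cdpairN cdpairD /= IH scaler0 add0r.
Qed.

Lemma cdmulC n (x y : CD R n) : (n <= 1)%N -> x ** y = y ** x.
Proof.
have C0 (a b : CD R 0) : a ** b = b ** a by exact: (@mulrC R).
case: n x y => [|[|//]] x y _; first exact: C0.
case: x y => [a b] [c d]; rewrite !(cdmul_pair (m := 0)) /=.
by congr (_, _); [congr (_ - _) | rewrite addrC; congr (_ + _)]; exact: (@mulrC R).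
Qed.

Lemma cdmulA n (x y z : CD R n) : (n <= 2)%N -> x ** (y ** z) = (x ** y) ** z.
Proof.
elim: n x y z => [x y z _|m IH [a b] [c d] [e f] m2]; first exact: (@mulrA R).
(* The bound on the doubled algebra leaves [m <= 1]: doubling keeps associativity when the algebra
   that is doubled is commutative. *)
have C (u v : CD R m) : u ** v = v ** u by exact: cdmulC.
have A (u v w : CD R m) : u ** (v ** w) = (u ** v) ** w by apply: IH; exact: ltnW.
have CA (u v w : CD R m) : u ** (v ** w) = v ** (u ** w).
  by rewrite A (C u) -A.
rewrite !cdmul_pair /= !(cdconjD, cdconjN, cdconjM, cdconjK).
rewrite !(cdmulDl, cdmulDr, cdmulNl, cdmulNr) !opprD -!A; congr (_, _).
  rewrite (CA a (cdconj f)) (C a d) (CA (cdconj c)) (C (cdconj c)) (CA e) (C e b).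
  by rewrite -!addrA; congr (_ + _); rewrite [RHS]addrC -addrA.
rewrite (C c a) (C (cdconj e) a) (C (cdconj e)) (CA b (cdconj d)) (C b f).
rewrite (CA (cdconj d)) (C (cdconj d)) -!addrA; congr (_ + _).
by rewrite addrA addrC.
Qed.

Lemma cdmul_conj n (x : CD R n) : x ** cdconj x = cddot x x *: cdone n.
Proof.
elim: n x => [x|m IH [a b]]; first exact/esym/(@mulr1 R).
rewrite (cddot_pair (a, b) (a, b)) cdmul_pair cdpairZ /= cdconjN cdmulNl opprK.
rewrite cdmulNl cdconjK addNr scaler0 IH scalerDl; congr (_ + _, _).
by rewrite -{2}(cdconjK b) IH cddot_conj.
Qed.

Lemma cdconj_mul n (x : CD R n) : cdconj x ** x = cddot x x *: cdone n.
Proof. by rewrite -{2}(cdconjK x) cdmul_conj cddot_conj. Qed.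

(** The left alternative law. It survives one doubling more than associativity, because the halves
    of an octonion are quaternions. Every later use of [n <= 3] goes back to this identity. *)
Lemma cdmul_conjK n (x y : CD R n) : (n <= 3)%N ->
  cdconj x ** (x ** y) = cddot x x *: y.
Proof.
have lt2 m (u v : CD R m) : (m <= 2)%N -> cdconj u ** (u ** v) = cddot u u *: v.
  by move=> m2; rewrite cdmulA// cdconj_mul cdmulZl cdmul1l.
have gt2 m (u v : CD R m) : (m <= 2)%N -> (v ** u) ** cdconj u = cddot u u *: v.
  by move=> m2; rewrite -cdmulA// cdmul_conj cdmulZr cdmul1r.
case: n x y => [|m] x y n3; first exact: lt2.
have A (u v w : CD R m) : u ** (v ** w) = (u ** v) ** w by exact: cdmulA.
case: x y => [a b] [c d]; rewrite (cddot_pair (a, b) (a, b)) cdpairZ !cdmul_pair /=.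
rewrite !(cdconjD, cdconjN, cdconjM, cdconjK) !cdmulNr !cdmulNl opprK.
rewrite !(cdmulDl, cdmulDr, cdmulNr, cdmulNl) !lt2// gt2//; congr (_, _).
  rewrite -!addrA scalerDl; congr (_ + _).
  rewrite -(A c) cdconj_mul cdmulZr cdmul1r.
  by rewrite -A addKr.
rewrite opprD !opprK (A b (cdconj b)) cdmul_conj cdmulZl cdmul1l.
by rewrite -(A b) -addrA addNKr scalerDl.
Qed.

Lemma cdmulK_conj n (x y : CD R n) : (n <= 3)%N ->
  (y ** x) ** cdconj x = cddot x x *: y.
Proof.
move=> n3; apply: (can_inj (@cdconjK n)).
by rewrite !cdconjM cdmul_conjK// cddot_conj cdconjZ.
Qed.

(** Polarisation of [cdmul_conjK]: expand it at [x + y] and remove the two pure terms. *)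
Lemma cdmul_conjD n (x y z : CD R n) : (n <= 3)%N ->
  cdconj x ** (y ** z) + cdconj y ** (x ** z) = (2 * cddot x y) *: z.
Proof.
move=> n3.
have grp (p q r s : CD R n) : (p + q) + (r + s) - p - s = q + r.
  by rewrite (addrC p) (addrACA q) -[LHS]addrA -opprD addrK.
rewrite -(grp (cdconj x ** (x ** z)) _ _ (cdconj y ** (y ** z))).
rewrite -!cdmulDr -!cdmulDl -cdconjD !cdmul_conjK// -!scalerBl; congr (_ *: _).
by rewrite cddotDl !cddotDr (cddotC y x); ring.
Qed.

Lemma cdmulD_conj n (x y z : CD R n) : (n <= 3)%N ->
  (z ** y) ** cdconj x + (z ** x) ** cdconj y = (2 * cddot x y) *: z.
Proof.
move=> n3; apply: (can_inj (@cdconjK n)).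
by rewrite cdconjD !cdconjM (cdmul_conjD (cdconj x))// cddot_conj cdconjZ.
Qed.

Lemma cddot_mul n (x y : CD R n) : (n <= 3)%N ->
  cddot (x ** y) (x ** y) = cddot x x * cddot y y.
Proof. by move=> n3; rewrite cddot_mull cdmul_conjK// cddotZr. Qed.

Lemma cddot_mul2r n (x y z : CD R n) : (n <= 3)%N ->
  cddot (y ** x) (z ** x) = cddot x x * cddot y z.
Proof. by move=> n3; rewrite cddot_mulr cdmulK_conj// cddotZr. Qed.

Lemma cdinv0 n : cdinv (0 : CD R n) = 0.
Proof. by rewrite /cdinv cdconj0 scaler0. Qed.

Lemma cddot_inv n (x : CD R n) : cddot (cdinv x) (cdinv x) = (cddot x x)^-1.
Proof.
rewrite /cdinv cddotZl cddotZr cddot_conj.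
have [->|x0] := eqVneq (cddot x x) 0; first by rewrite invr0 mul0r.
by rewrite mulVf// mulr1.
Qed.

Lemma cdmulKV n (x y : CD R n) : (n <= 3)%N -> x != 0 ->
  cdinv x ** (x ** y) = y.
Proof.
move=> n3 x0; rewrite /cdinv cdmulZl cdmul_conjK// scalerA mulVf ?scale1r//.
by rewrite cddot_eq0.
Qed.

Lemma cdmulVK n (x y : CD R n) : (n <= 3)%N -> x != 0 ->
  x ** (cdinv x ** y) = y.
Proof.
move=> n3 x0; rewrite /cdinv cdmulZl cdmulZr.
have := cdmul_conjK (cdconj x) y n3; rewrite cdconjK => ->.
by rewrite cddot_conj scalerA mulVf ?scale1r// cddot_eq0.
Qed.

Lemma cdmulrK n (x y : CD R n) : (n <= 3)%N -> x != 0 ->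
  (y ** x) ** cdinv x = y.
Proof.
move=> n3 x0; rewrite /cdinv cdmulZr cdmulK_conj// scalerA mulVf ?scale1r//.
by rewrite cddot_eq0.
Qed.

Lemma cdmulrVK n (x y : CD R n) : (n <= 3)%N -> x != 0 ->
  (y ** cdinv x) ** x = y.
Proof.
move=> n3 x0; rewrite /cdinv cdmulZr cdmulZl.
have := cdmulK_conj (cdconj x) y n3; rewrite cdconjK => ->.
by rewrite cddot_conj scalerA mulVf ?scale1r// cddot_eq0.
Qed.

Lemma cdmulI n (x y z : CD R n) : (n <= 3)%N -> x != 0 -> x ** y = x ** z -> y = z.
Proof. by move=> n3 x0 e; rewrite -(cdmulKV y n3 x0) e cdmulKV. Qed.

Lemma cdmulIr n (x y z : CD R n) : (n <= 3)%N -> x != 0 -> y ** x = z ** x -> y = z.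
Proof. by move=> n3 x0 e; rewrite -(cdmulrK y n3 x0) e cdmulrK. Qed.

Lemma cdinvK n : involutive (@cdinv R n).
Proof.
move=> x; have [->|x0] := eqVneq x 0; first by rewrite !cdinv0.
rewrite {1}/cdinv cddot_inv invrK /cdinv cdconjZ cdconjK scalerA mulfV ?scale1r//.
by rewrite cddot_eq0.
Qed.

Lemma cdinvM n (x y : CD R n) : (n <= 3)%N -> cdinv (x ** y) = cdinv y ** cdinv x.
Proof.
move=> n3; rewrite /cdinv cddot_mul// invfM cdconjM cdmulZl cdmulZr scalerA.
by rewrite mulrC.
Qed.

Lemma cdinvZ n (a : R) (x : CD R n) : cdinv (a *: x) = a^-1 *: cdinv x.
Proof.
rewrite /cdinv cddotZl cddotZr cdconjZ !scalerA !invfM; congr (_ *: _).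
have [->|a0] := eqVneq a 0; first by rewrite invr0 !mul0r.
by rewrite mulrAC mulVf// mul1r.
Qed.

(** Every element is a root of a real quadratic polynomial. If [w] squares to minus one and has
    nonzero real part, that polynomial makes [w] a real multiple of one, whose square cannot be
    negative. *)
Lemma imunitsP n (w : CD R n) :
  imunits w <-> cdre w = 0 /\ cddot w w = 1.
Proof.
have E : w ** w = (2 * cdre w) *: w - cddot w w *: cdone n.
  have := cdmul_conj w; rewrite cdconjE cdmulBr cdmulZr cdmul1r => <-.
  by rewrite subKr.
rewrite /imunits /= E; split=> [|[-> ->]]; last by rewrite mulr0 scale0r sub0r scale1r.
move=> /eqP; rewrite -subr_eq0 opprK -addrA -[X in _ + (_ + X)]scale1r -scaleNr.
rewrite -scalerDl => /eqP e.
have re0 : cdre w = 0; last first.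
  split=> //; move: e; rewrite re0 mulr0 scale0r add0r => /(congr1 (@cdre R n)).
  by rewrite cdreZ cdre1 cdre0 mulr1 => /eqP; rewrite addrC subr_eq0 eq_sym => /eqP.
apply/eqP/negPn/negP => re0.
pose r := (2 * cdre w)^-1 * (cddot w w - 1).
have wE : w = r *: cdone n.
  have : (2 * cdre w)^-1 *: ((2 * cdre w) *: w) = r *: cdone n.
    rewrite /r -[RHS]scalerA; congr (_ *: _); apply/eqP.
    by move/eqP: e; rewrite addr_eq0 -scaleNr opprD opprK.
  by rewrite scalerA mulVf ?scale1r// mulf_neq0.
move: e; rewrite wE cddotZl cddotZr cddot1r cdreZ !cdre1 !mulr1 => /(congr1 (@cdre R n)).
rewrite cdreD !cdreZ cdre1 cdre0.
have := sqr_ge0 r; rewrite expr2; lra.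
Qed.

Lemma cddot_ext n (x y : CD R n) : (forall w, cddot x w = cddot y w) -> x = y.
Proof.
move=> e; apply/eqP; rewrite -subr_eq0 -cddot_eq0 cddotBl e.
by rewrite subrr.
Qed.

Definition cddotLE := (@cddotDl, @cddotNl, @cddotZl, @cddot0l).

End CayleyDicksonAlgebra.

(* Reduces a linear identity between vectors to a ring identity between scalar products. *)
Ltac vring_with tac :=
  apply: cddot_ext => ?; rewrite !cddotLE; tac.
Ltac vring := vring_with ltac:(ring).

(** * Stems and reciprocals *)

(* A pair (a, b) of elements of CD R n stands for a + i b in its complexification. *)
Section Complexification.
Context {R : realType} {n : nat}.
Notation A := (CD R n).
Implicit Types (a b c d p q x y J : A) (u v : A * A).

Definition cxmul u v : A * A :=
  (u.1 ** v.1 - u.2 ** v.2, u.1 ** v.2 + u.2 ** v.1).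

Definition cxconj u : A * A := (cdconj u.1, cdconj u.2).

(** [normre u + i normim u] is the norm of [u] in the complexification, a complex scalar by
    [cxmul_conj]; [normsq u] is the square of its modulus. *)
Definition normre u : R := cddot u.1 u.1 - cddot u.2 u.2.

Definition normim u : R := 2 * cddot u.1 u.2.

Definition normsq u : R := normre u ^+ 2 + normim u ^+ 2.

(** With N the complex norm of [u], this is the conjugate of [u] times the complex conjugate of N,
    divided by the squared modulus of N. *)
Definition cxinv u : A * A :=
  ((normsq u)^-1 *: (normre u *: cdconj u.1 + normim u *: cdconj u.2),
   (normsq u)^-1 *: (normre u *: cdconj u.2 - normim u *: cdconj u.1)).

Definition cxval u J : A := u.1 + J ** u.2.

Definition twist p q x : A := (cdinv p ** ((x ** p) ** q)) ** cdinv q.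

Lemma normsq_ge0 u : 0 <= normsq u.
Proof. by rewrite addr_ge0// sqr_ge0. Qed.

Lemma cxmul_conj u : cxmul u (cxconj u) = (normre u *: cdone n, normim u *: cdone n).
Proof.
rewrite /cxmul /= !cdmul_conj -scalerBl; congr (_, _).
have := cdmul_conj (u.1 + u.2); rewrite cdconjD !cdmulDl !cdmulDr !cdmul_conj.
rewrite cddotDl !cddotDr (cddotC u.2) => e; rewrite /normim.
apply: cddot_ext => w; have := congr1 (cddot^~ w) e; rewrite !cddotLE; lra.
Qed.

Hypothesis n3 : (n <= 3)%N.

(** The alternative law carried to the complexification: the pure terms use [cdmul_conjK], the mixed
    ones its polarisation. The right-hand side is [v] multiplied by the complex norm of [u]. *)
Lemma cxmul_conjK u v : cxmul (cxconj u) (cxmul u v) =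
  (normre u *: v.1 - normim u *: v.2, normre u *: v.2 + normim u *: v.1).
Proof.
rewrite /cxmul /normre /normim /= !(cdmulBr, cdmulDr) !cdmul_conjK//.
rewrite -(cdmul_conjD u.1 u.2 v.1)// -(cdmul_conjD u.1 u.2 v.2)//.
by congr (_, _); vring.
Qed.

(** Multiplying the equation on the left by the conjugate of [u] isolates [v] up to the complex
    norm, with no appeal to associativity. *)
Lemma cxinv_unique u v : normsq u != 0 -> cxmul u v = (cdone n, 0) -> v = cxinv u.
Proof.
move=> u0 e; have := cxmul_conjK u v; rewrite e /cxmul /= !cdmul1r !cdmul0r subr0 add0r.
move=> [e1 e2]; rewrite /cxinv e1 e2 !(scalerBr, scalerDr) !scalerA.
rewrite [RHS]surjective_pairing [LHS]surjective_pairing /=; congr (_, _).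
  by move: u0; rewrite /normsq => u0; vring_with ltac:(field; exact: u0).
by move: u0; rewrite /normsq => u0; vring_with ltac:(field; exact: u0).
Qed.

Lemma cxinvr u : normsq u != 0 -> cxmul u (cxinv u) = (cdone n, 0).
Proof.
move=> u0; have := cxmul_conj u; rewrite /cxmul /cxconj /= => -[e1 e2].
rewrite !(cdmulZr, cdmulDr, cdmulNr) -{1}scalerBr -scalerDr.
congr (_, _).
  transitivity ((normsq u)^-1 *: (normsq u *: cdone n)); last first.
    by rewrite scalerA mulVf// scale1r.
  rewrite /normsq; congr (_ *: _); apply: cddot_ext => w.
  move: (congr1 (cddot^~ w) e1) (congr1 (cddot^~ w) e2); rewrite !cddotLE => h1 h2.
  transitivity (normre u * (normre u * cddot (cdone n) w) +
                normim u * (normim u * cddot (cdone n) w)); last by ring.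
  by rewrite -h1 -h2; ring.
rewrite -[RHS](scaler0 _ (normsq u)^-1); congr (_ *: _); apply: cddot_ext => w.
move: (congr1 (cddot^~ w) e1) (congr1 (cddot^~ w) e2); rewrite !cddotLE => h1 h2.
transitivity (normre u * (normim u * cddot (cdone n) w) -
              normim u * (normre u * cddot (cdone n) w)); last by ring.
by rewrite -h1 -h2; ring.
Qed.

(** This lemma and the next say that the complex norm of the inverse is the inverse complex number.
    In both, the norm components replace two of the three scalar products, which leaves a rational
    identity in [normre u], [normim u] and [cddot u.2 u.2]. *)
Lemma normre_inv u : normsq u != 0 -> normre (cxinv u) = normre u / normsq u.
Proof.
move=> u0; rewrite {1}/normre /= !(cddotZl, cddotZr, cddotDl, cddotDr, cddotNl, cddotNr).
rewrite !cddot_conj (cddotC u.2 u.1).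
have -> : cddot u.1 u.2 = normim u / 2 by rewrite /normim mulrC mulKf// pnatr_eq0.
have -> : cddot u.1 u.1 = normre u + cddot u.2 u.2 by rewrite /normre subrK.
move: u0; rewrite /normsq => u0; field.
exact: u0.
Qed.

Lemma normim_inv u : normsq u != 0 -> normim (cxinv u) = - normim u / normsq u.
Proof.
move=> u0; rewrite {1}/normim /= !(cddotZl, cddotZr, cddotDl, cddotDr, cddotNl, cddotNr).
rewrite !cddot_conj (cddotC u.2 u.1).
have -> : cddot u.1 u.2 = normim u / 2 by rewrite /normim mulrC mulKf// pnatr_eq0.
have -> : cddot u.1 u.1 = normre u + cddot u.2 u.2 by rewrite /normre subrK.
move: u0; rewrite /normsq => u0; field.
exact: u0.
Qed.

Lemma normsq_inv u : normsq u != 0 -> normsq (cxinv u) = (normsq u)^-1.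
Proof.
move=> u0; rewrite {1}/normsq normre_inv// normim_inv//.
move: u0; rewrite /normsq => u0; field.
exact: u0.
Qed.

Lemma cxinvK u : normsq u != 0 -> cxinv (cxinv u) = u.
Proof.
move=> u0; rewrite [LHS]/cxinv normsq_inv// normre_inv// normim_inv//= !cdconjZ cdconjD cdconjB.
rewrite !cdconjZ !cdconjK [RHS]surjective_pairing; move: u0; rewrite /normsq => u0.
by congr (_, _); vring_with ltac:(field; exact: u0).
Qed.

Lemma cxinvl u : normsq u != 0 -> cxmul (cxinv u) u = (cdone n, 0).
Proof.
move=> u0; have := @cxinvr (cxinv u); rewrite cxinvK// => -> //.
by rewrite normsq_inv// invr_eq0.
Qed.

(** Inversion multiplies the size of the second component by a nonzero factor. So a function and its
    reciprocal have the same zeros of the spherical derivative, and their maps live on one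
    domain. *)
Lemma cddot_cxinv2 u : normsq u != 0 ->
  cddot (cxinv u).2 (cxinv u).2 = cddot u.2 u.2 / normsq u.
Proof.
move=> u0; rewrite /= !(cddotZl, cddotZr, cddotDl, cddotDr, cddotNl, cddotNr).
rewrite !cddot_conj (cddotC u.2 u.1).
have -> : cddot u.1 u.2 = normim u / 2 by rewrite /normim mulrC mulKf// pnatr_eq0.
have -> : cddot u.1 u.1 = normre u + cddot u.2 u.2 by rewrite /normre subrK.
move: u0; rewrite /normsq => u0; field.
exact: u0.
Qed.

Lemma imunits_re J : imunits J -> cdre J = 0.
Proof. by move=> /imunitsP[]. Qed.

Lemma imunits_sqr J : imunits J -> cddot J J = 1.
Proof. by move=> /imunitsP[]. Qed.

Lemma imunits_conj J : imunits J -> cdconj J = - J.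
Proof. by move=> /imunits_re e; rewrite cdconjE e mulr0 scale0r sub0r. Qed.

Lemma imunitsN J : imunits J -> imunits (- J).
Proof. by rewrite /imunits /= cdmulNl cdmulNr opprK. Qed.

Lemma imunits_mulK J p : imunits J -> J ** (J ** p) = - p.
Proof.
move=> JS; have := cdmul_conjK J p n3.
by rewrite imunits_conj// cdmulNl imunits_sqr// scale1r => /eqP; rewrite eqr_oppLR => /eqP.
Qed.

(** If [u.1 = - J u.2], the two components have equal length and are orthogonal, so both parts of
    the complex norm vanish. *)
Lemma cxval_eq0 u J : imunits J -> cxval u J = 0 -> normsq u = 0.
Proof.
move=> JS /eqP; rewrite addr_eq0 => /eqP e.
rewrite /normsq /normre /normim e !cddotNl cddotNr opprK cddot_mul// imunits_sqr//.
rewrite mul1r subrr cddot_mulr cdmul_conj cddotZr cddot1r imunits_re//.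
by rewrite mulr0 oppr0 mulr0 expr0n addr0.
Qed.

Lemma normsq_conj u : normsq (cxconj u) = normsq u.
Proof. by rewrite /normsq /normre /normim /= !cddot_conj. Qed.

Lemma cxval_norm_neq0 u J : imunits J -> normsq u != 0 ->
  normre u *: cdone n + normim u *: J != 0.
Proof.
move=> JS; rewrite -cddot_gt0 => u0.
rewrite cddotDl !cddotDr !cddotZl !cddotZr [cddot (cdone n) J]cddotC !cddot1r.
rewrite cdre1 imunits_re// imunits_sqr// !mulr0 addr0 add0r !mulr1 -!expr2.
by rewrite lt_def u0 normsq_ge0.
Qed.

(** The conjugate of [u] is its inverse times the complex norm. Evaluation at [J] sends [i] to [J],
    hence turns a complex scalar into a left multiplication. *)
Lemma cxval_conj u J : imunits J -> normsq u != 0 ->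
  cxval (cxconj u) J =
  (normre u *: cdone n + normim u *: J) ** cxval (cxinv u) J.
Proof.
move=> JS u0; have := cxmul_conjK u (cxinv u); rewrite cxinvr//.
move: (cxinv u) => v; rewrite {1}/cxmul /= !cdmul1r !cdmul0r subr0 add0r => -[e1 e2].
rewrite /cxval cdmulDl !cdmulZl cdmul1l (cdmulDr J) imunits_mulK//= e1 e2.
by rewrite !(cdmulDr J, cdmulNr J, cdmulZr _ J); vring.
Qed.

(** After left multiplication by [p], the claim reads [p u.1 + (J p) u.2 = normre u + normim u J],
    because the outer factors of the twist cancel against [p] and [q]. Only [u.2 = be *: q] is
    asked, with [be] allowed to vanish: this is what lets the formula pass through real points. *)
Lemma cxval_twist u J q (be : R) : imunits J -> normsq u != 0 -> q != 0 ->
    u.2 = be *: q ->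
  let p := cxval (cxconj u) J in
  cxval u (twist p q J) = cdinv (cxval (cxinv u) J).
Proof.
move=> JS u0 q0 bq /=; set p := cxval (cxconj u) J.
have p0 : p != 0.
  by apply/eqP => /(cxval_eq0 JS) /eqP; rewrite normsq_conj (negbTE u0).
have M0 := cxval_norm_neq0 JS u0.
have -> : cxval (cxinv u) J = cdinv (normre u *: cdone n + normim u *: J) ** p.
  by rewrite /p cxval_conj// cdmulKV.
rewrite cdinvM// cdinvK; apply: (cdmulI n3 p0); rewrite cdmulVK//.
rewrite /cxval bq cdmulZr /twist cdmulrVK// cdmulDr cdmulZr cdmulVK//.
rewrite -cdmulZr -bq /p /cxval /= !cdmulDr (imunits_mulK _ JS) !cdmulDl.
rewrite cdconj_mul.

(* The mixed terms [(J conj(u.2)) u.1 + (J conj(u.1)) u.2] add up to [normim u] times [J], although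
   neither can be reassociated. *)
have := cdmulD_conj (cdconj u.1) (cdconj u.2) J n3.
rewrite !cdconjK cddot_conj -/(normim u) => e.
rewrite cdmulNl cdconj_mul.
by rewrite -e /normre; vring.
Qed.

(** The norm is multiplicative, so the length is one. For the real part, adjoints move the outer
    factors across the scalar product with one, and [p] and [q] drop out as right similarities. *)
Lemma twist_imunits p q J : imunits J -> p != 0 -> q != 0 -> imunits (twist p q J).
Proof.
move=> JS p0 q0; apply/imunitsP; split.
  rewrite -cddot1r /twist cddot_mulr cdmul1l -[cdconj (cdinv q)]scale1r.
  rewrite /cdinv cdconjZ cdconjK scale1r cddotZr cdmulZl cddotZl.
  rewrite cddot_mull cdconjK cddot_mul2r// cddot_mulr cdmul_conj cddotZr cddot1r.
  by rewrite imunits_re// !mulr0.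
rewrite /twist !cddot_mul// !cddot_inv (imunits_sqr JS).
by field; rewrite !cddot_eq0 p0 q0.
Qed.

Lemma twistD p q x y : twist p q (x + y) = twist p q x + twist p q y.
Proof. by rewrite /twist !(cdmulDl, cdmulDr). Qed.

Lemma twistZ p q (r : R) x : twist p q (r *: x) = r *: twist p q x.
Proof. by rewrite /twist !(cdmulZl, cdmulZr). Qed.

Lemma twist1 p q : p != 0 -> q != 0 -> twist p q (cdone n) = cdone n.
Proof.
by move=> p0 q0; rewrite /twist cdmul1l cdmulKV// -{1}(cdmul1l q) cdmulrK.
Qed.

End Complexification.

(** * Coordinates alpha + beta J *)

Section SlicePoints.
Context {R : realType} {n : nat}.
Notation A := (CD R n).
Implicit Types (z w : CD R 1) (J I x y : A) (Om : set A).

Lemma cdre_slice z J : imunits J -> cdre (slice_point z J) = z.1.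
Proof.
move=> JS; rewrite /slice_point cdreD !cdreZ cdre1 imunits_re//.
by rewrite mulr0 mulr1 addr0.
Qed.

Lemma cdconj_slice z J : imunits J -> cdconj (slice_point z J) = slice_point z (- J).
Proof. by move=> JS; rewrite /slice_point cdconjD !cdconjZ cdconj1 imunits_conj. Qed.

Lemma slice_pointN z J : slice_point z (- J) = slice_point (cdconj z) J.
Proof. by rewrite /slice_point /= scalerN scaleNr. Qed.

Lemma cdim_slice z J : imunits J -> cdim (slice_point z J) = (z.2 : R) *: J.
Proof.
move=> JS; rewrite /cdim cdconj_slice// /slice_point.
rewrite scalerN opprD opprK addrACA subrr add0r -scalerDl scalerA.
by congr (_ *: _); field.
Qed.

(** The representative with [beta >= 0], which makes the choice canonical and continuous, also at
    real points. *)
Definition polar x : CD R 1 := (cdre x, Num.sqrt (cddot (cdim x) (cdim x))).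

Lemma cdre_cdim x : cdre (cdim x) = 0.
Proof. by rewrite /cdim cdreZ cdreB cdre_conj subrr mulr0. Qed.

Lemma cdreal_cdim x : cdreal x <-> cdim x = 0.
Proof.
split=> [[a ->]|/eqP]; first by rewrite /cdim cdconjZ cdconj1 subrr scaler0.
rewrite scaler_eq0 invr_eq0 pnatr_eq0 /= subr_eq0 cdconjE => /eqP e.
exists (cdre x); apply: cddot_ext => w.
have := congr1 (cddot^~ w) e; rewrite !cddotLE; lra.
Qed.

Lemma exists_imunit : (0 < n)%N -> exists J : A, imunits J.
Proof.
case: n => // m _; exists ((0, cdone m) : CD R m.+1); apply/imunitsP.
by rewrite (cddot_pair (0, cdone m) (0, cdone m)) /= cddot0l add0r cddot1r cdre1 cdre0.
Qed.

Lemma cd_polar x : (0 < n)%N -> exists2 J, imunits J & x = slice_point (polar x) J.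
Proof.
move=> n0; have E : x = cdre x *: cdone n + cdim x.
  rewrite /cdim cdconjE; apply: cddot_ext => w; rewrite !cddotLE; lra.
rewrite /slice_point /=; have := cdre_cdim x; move: (cdim x) E => i E ir.
have [i0|i0] := eqVneq i 0.
  have [J JS] := exists_imunit n0; exists J => //.
  by rewrite i0 cddot0l sqrtr0 scale0r {1}E i0.
have d0 : 0 < cddot i i by rewrite cddot_gt0.
have s0 : Num.sqrt (cddot i i) != 0 by rewrite gt_eqF// sqrtr_gt0.
have sE : Num.sqrt (cddot i i) ^+ 2 = cddot i i by rewrite sqr_sqrtr// ltW.
move: (Num.sqrt _) s0 sE => s s0 sE; exists (s^-1 *: i).
  apply/imunitsP; rewrite cdreZ ir mulr0 cddotZl cddotZr -sE; split=> //.
  by field.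
by rewrite scalerA mulfV// scale1r -E.
Qed.

Lemma cdreal_slice z J : imunits J -> cdreal (slice_point z J) <-> z.2 = 0 :> R.
Proof.
move=> JS; rewrite cdreal_cdim cdim_slice//; split=> [/eqP|->]; last by rewrite scale0r.
rewrite scaler_eq0 => /orP[/eqP//|/eqP J0].
by move: (imunits_sqr JS); rewrite J0 cddot0l => /eqP; rewrite eq_sym oner_eq0.
Qed.

(** The real part gives alpha, and the length of the imaginary part gives beta up to sign. *)
Lemma slice_point_inj z w J I : imunits J -> imunits I ->
  slice_point z J = slice_point w I ->
  (w = z /\ (z.2 = 0 :> R \/ I = J)) \/ (w = cdconj z /\ I = - J).
Proof.
move=> JS IS e.
have e1 : z.1 = w.1 by rewrite -(cdre_slice z JS) e cdre_slice.
have e2 : (z.2 : R) *: J = (w.2 : R) *: I.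
  by rewrite -(cdim_slice z JS) e cdim_slice.
have : (z.2 : R) ^+ 2 = (w.2 : R) ^+ 2.
  have : cddot ((z.2 : R) *: J) ((z.2 : R) *: J) = cddot ((w.2 : R) *: I) ((w.2 : R) *: I).
    by rewrite e2.
  by rewrite !cddotZl !cddotZr !imunits_sqr// !mulr1 -!expr2.
have [z0|z0] := eqVneq (z.2 : R) 0.
  rewrite z0 expr0n => /esym/eqP; rewrite sqrf_eq0 => /eqP w0; left; split; last by left.
  by rewrite [w]surjective_pairing [z]surjective_pairing e1 z0 w0.
move/eqP; rewrite eqf_sqr => /orP[/eqP e3|/eqP e3].
  left; split; first by rewrite [w]surjective_pairing [z]surjective_pairing e1 e3.
  by right; move: e2; rewrite -e3 => /(scalerI z0).
right; have e4 : w.2 = - (z.2 : R) by rewrite e3 opprK.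
split; first by rewrite [w]surjective_pairing e4 -e1.
by move: e2; rewrite e4 scaleNr -scalerN => /(scalerI z0) ->; rewrite opprK.
Qed.

End SlicePoints.

Section Stems.
Context {R : realType} {n : nat}.
Notation A := (CD R n).
Notation stemT := ((CD R 1 -> A) * (CD R 1 -> A))%type.
Implicit Types (z w : CD R 1) (J I x y : A) (Om : set A) (f g : A -> A) (F G : stemT).

Lemma plane_Omega (D : set (CD R 1)) z J : (forall z, D z -> D (cdconj z)) ->
  imunits J -> Omega D (slice_point z J) <-> D z.
Proof.
move=> Dc JS; split=> [[w [I [Dw IS e]]]|Dz]; last by exists z, J.
have [[<- _]//|[e1 _]] := slice_point_inj JS IS e.
by rewrite -[z]cdconjK -e1; exact: Dc.
Qed.

Lemma circularP Om z J : circular Om -> imunits J -> Om (slice_point z J) <-> plane Om z.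
Proof.
move=> [D [_ Dc ->]] JS; split=> [h|[I IS h]]; first by exists J.
by apply/(plane_Omega z Dc JS); apply/(plane_Omega z Dc IS).
Qed.

Lemma plane_conj Om z : circular Om -> plane Om z -> plane Om (cdconj z).
Proof.
move=> cO [J JS h]; exists (- J); first exact: imunitsN.
by rewrite slice_pointN cdconjK.
Qed.

Lemma circular_slice Om x : circular Om -> Om x ->
  exists z J, [/\ imunits J, plane Om z & x = slice_point z J].
Proof.
move=> cO Ox; have [D [_ Dc OD]] := cO.
have [z [J [Dz JS e]]] : Omega D x by rewrite -OD.
by exists z, J; split=> //; apply/(circularP z cO JS); rewrite -e.
Qed.

(** The parity half of [is_stem], free of any function: it is what makes [slice_induced] well
    defined. *)
Definition stem_sym Om F := forall z, plane Om z ->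
  F.1 (cdconj z) = F.1 z /\ F.2 (cdconj z) = - F.2 z.

Definition stemval F z : A * A := (F.1 z, F.2 z).

Hypothesis n3 : (n <= 3)%N.

Lemma is_stem_val Om f F z J : is_stem Om f F -> plane Om z -> imunits J ->
  f (slice_point z J) = cxval (stemval F z) J.
Proof. by move=> sf Oz JS; have [_ _ ->] := sf z Oz. Qed.

Lemma is_stem_sym Om f F : is_stem Om f F -> stem_sym Om F.
Proof. by move=> sf z /sf[]. Qed.

Lemma stem_real Om F z : stem_sym Om F -> plane Om z -> z.2 = 0 :> R -> F.2 z = 0.
Proof.
move=> sF /sF[_ h] z0; have zc : cdconj z = z.
  by case: z z0 {h} => a b /= ->; rewrite oppr0.
move: h; rewrite zc => /eqP; rewrite -addr_eq0 -mulr2n -scaler_nat.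
by rewrite scaler_eq0 pnatr_eq0 => /eqP.
Qed.

(** Half the sum and half the difference of the two values recover [u.1] and [J u.2]. *)
Lemma cxval_inj (u v : A * A) J : imunits J ->
  cxval u J = cxval v J -> cxval u (- J) = cxval v (- J) -> u = v.
Proof.
move=> JS; rewrite /cxval !cdmulNl => e1 e2.
have h (w : A) : cddot u.1 w = cddot v.1 w /\ cddot (J ** u.2) w = cddot (J ** v.2) w.
  move: (congr1 (cddot^~ w) e1) (congr1 (cddot^~ w) e2); rewrite !cddotLE.
  by move=> h1 h2; split; lra.
rewrite [u]surjective_pairing [v]surjective_pairing; congr (_, _).
  by apply: cddot_ext => w; have [] := h w.
have : J ** u.2 = J ** v.2 by apply: cddot_ext => w; have [] := h w.
by apply: cdmulI => //; rewrite -cddot_eq0 imunits_sqr// oner_eq0.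
Qed.

Lemma stem_unique Om f F G z : is_stem Om f F -> is_stem Om f G -> plane Om z ->
  stemval F z = stemval G z.
Proof.
move=> sF sG Oz; have [J JS _] := Oz; apply: (cxval_inj JS).
  by rewrite -(is_stem_val sF)// -(is_stem_val sG).
by have JN := imunitsN JS; rewrite -(is_stem_val sF)// -(is_stem_val sG).
Qed.

Lemma stemP Om f F : is_stem Om f F -> is_stem Om f (stem Om f).
Proof. by move=> sf; exact: (@getI _ _ (is_stem Om f)) sf || apply: getPex; exists F. Qed.

Lemma stem_val Om f F z : is_stem Om f F -> plane Om z ->
  stemval (stem Om f) z = stemval F z.
Proof. by move=> sf Oz; exact: (stem_unique (stemP sf) sf Oz). Qed.

(** Parity makes the value independent of the representation: (z, J) may be replaced by (conj z,
    -J), and at a real point every unit gives the same value since [F.2] vanishes there. *)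
Lemma slice_inducedE Om F z J : circular Om -> stem_sym Om F -> plane Om z -> imunits J ->
  slice_induced Om F (slice_point z J) = cxval (stemval F z) J.
Proof.
move=> cO sF Oz JS; apply: xget_subset1; first by exists z, J.
move=> a b [z1 [J1 [p1 S1 e1 e1']]] [z2 [J2 [p2 S2 e2 e2']]].
suff h w I : plane Om w -> imunits I -> slice_point z J = slice_point w I ->
    F.1 w + I ** F.2 w = F.1 z + J ** F.2 z by rewrite e1' e2' !h.
move=> Ow IS e; have [[-> [z0| ->]]|[-> ->]] := slice_point_inj JS IS e; last 2 first.
- by [].
- by have [-> ->] := sF z Oz; rewrite cdmulNl cdmulNr opprK.
by rewrite (stem_real sF Oz z0) !cdmul0r.
Qed.

Lemma is_stem_induced Om F : circular Om -> stem_sym Om F ->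
  is_stem Om (slice_induced Om F) F.
Proof.
move=> cO sF z Oz; have [h1 h2] := sF z Oz; split=> // J JS.
by rewrite slice_inducedE.
Qed.

Definition smul F G : stemT :=
  (fun z => F.1 z ** G.1 z - F.2 z ** G.2 z, fun z => F.1 z ** G.2 z + F.2 z ** G.1 z).

Lemma smul_sym Om F G : stem_sym Om F -> stem_sym Om G -> stem_sym Om (smul F G).
Proof.
move=> sF sG z Oz; have [f1 f2] := sF z Oz; have [g1 g2] := sG z Oz.
rewrite /smul /= f1 f2 g1 g2 !(cdmulNl, cdmulNr) opprK; split=> //.
by rewrite -opprD.
Qed.

Definition sconj F : stemT := (fun z => cdconj (F.1 z), fun z => cdconj (F.2 z)).

Lemma sconj_sym Om F : stem_sym Om F -> stem_sym Om (sconj F).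
Proof. by move=> sF z Oz; have [f1 f2] := sF z Oz; rewrite /= f1 f2 cdconjN. Qed.

Lemma is_stem_mul Om f g F G : circular Om -> is_stem Om f F -> is_stem Om g G ->
  is_stem Om (slice_mul Om f g) (smul F G).
Proof.
move=> cO sF sG z Oz; have sFG := smul_sym (is_stem_sym sF) (is_stem_sym sG).
have [h1 h2] := sFG z Oz; split=> // J JS; rewrite /slice_mul slice_inducedE//.
  have := stem_val sF Oz; have := stem_val sG Oz.
  by rewrite /cxval /stemval /= => -[-> ->] [-> ->].
by apply: smul_sym; apply: is_stem_sym; apply: stemP; [exact: sF|exact: sG].
Qed.

Lemma is_stem_conj Om f F : circular Om -> is_stem Om f F ->
  is_stem Om (slice_conj Om f) (sconj F).
Proof.
move=> cO sF z Oz; have [h1 h2] := sconj_sym (is_stem_sym sF) Oz.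
split=> // J JS; rewrite /slice_conj slice_inducedE//.
  by have := stem_val sF Oz; rewrite /cxval /stemval /= => -[-> ->].
by apply: (@sconj_sym _ (stem Om f)); apply: is_stem_sym; exact: stemP sF.
Qed.

Lemma slice_normalE Om f F z J : circular Om -> is_stem Om f F -> plane Om z ->
  imunits J -> slice_normal Om f (slice_point z J) =
    normre (stemval F z) *: cdone n + normim (stemval F z) *: J.
Proof.
move=> cO sF Oz JS.
rewrite /slice_normal (is_stem_val (is_stem_mul cO sF (is_stem_conj cO sF)) Oz JS).
have := cxmul_conj (stemval F z); rewrite /cxval /cxmul /= => -[-> ->].
by rewrite cdmulZr cdmul1r.
Qed.

(** The condition on the right does not mention [J], so the zero set of the normal function is a
    union of spheres and removing it keeps the domain circular. *)
Lemma slice_normal_eq0 Om f F z J : circular Om -> is_stem Om f F -> plane Om z ->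
  imunits J -> slice_normal Om f (slice_point z J) = 0 <-> normsq (stemval F z) = 0.
Proof.
move=> cO sF Oz JS; rewrite (slice_normalE cO sF Oz JS); split=> h.
  apply/eqP/negPn/negP => u0; move/eqP: h; apply/negP.
  exact: cxval_norm_neq0.
move/eqP: h; rewrite /normsq paddr_eq0 ?sqr_ge0// !sqrf_eq0 => /andP[/eqP -> /eqP ->].
by rewrite !scale0r addr0.
Qed.

Lemma is_stem_sub Om Om' f F : Om' `<=` Om -> is_stem Om f F -> is_stem Om' f F.
Proof. by move=> sub sf z [J JS /sub Oz]; apply: sf; exists J. Qed.

Lemma spherical_derivativeE Om f F z J : circular Om -> is_stem Om f F ->
  plane Om z -> imunits J -> z.2 != 0 :> R ->
  spherical_derivative f (slice_point z J) = (z.2 : R)^-1 *: F.2 z.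
Proof.
move=> cO sF Oz JS z0; rewrite /spherical_derivative cdim_slice// cdconj_slice//.
rewrite (is_stem_val sF Oz JS) (is_stem_val sF Oz (imunitsN JS)) /cxval /= cdmulNl.
have -> : F.1 z + J ** F.2 z - (F.1 z - J ** F.2 z) = (2 : R) *: (J ** F.2 z) by vring.
rewrite cdmulZr scalerA mulVf ?pnatr_eq0//.
rewrite scale1r cdinvZ cdmulZl /cdinv imunits_sqr// invr1 scale1r imunits_conj//.
by rewrite cdmulNl imunits_mulK// opprK.
Qed.

End Stems.

(** * The slice reciprocal, and T_f on a single sphere *)

Section Reciprocal.
Context {R : realType} {n : nat}.
Notation A := (CD R n).
Notation stemT := ((CD R 1 -> A) * (CD R 1 -> A))%type.
Implicit Types (z w : CD R 1) (J I x y : A) (Om U : set A) (f g E : A -> A) (F G : stemT).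
Hypothesis n3 : (n <= 3)%N.

Definition sinv F : stemT :=
  (fun z => (cxinv (stemval F z)).1, fun z => (cxinv (stemval F z)).2).

Lemma stemval_sinv F z : stemval (sinv F) z = cxinv (stemval F z).
Proof. by []. Qed.

Lemma normsq_stem_conj Om F z : stem_sym Om F -> plane Om z ->
  normsq (stemval F (cdconj z)) = normsq (stemval F z).
Proof.
move=> sF Oz; rewrite /normsq /normre /normim /=; have [-> ->] := sF z Oz.
by rewrite !cddotNl !cddotNr opprK mulrN sqrrN.
Qed.

Lemma sinv_sym Om F : stem_sym Om F -> stem_sym Om (sinv F).
Proof.
move=> sF z Oz; rewrite /sinv /= (normsq_stem_conj sF Oz) /normre /normim /=.
have [-> ->] := sF z Oz.
by rewrite !cddotNl !cddotNr opprK mulrN cdconjN; split; vring.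
Qed.

Lemma normal_domain Om f F z J : circular Om -> is_stem Om f F -> imunits J ->
  (Om `\` zeros Om (slice_normal Om f)) (slice_point z J) <->
  plane Om z /\ normsq (stemval F z) != 0.
Proof.
move=> cO sF JS; split=> [[Oz nz]|[Oz u0]].
  have {}Oz : plane Om z by apply/(circularP z cO JS).
  split=> //; apply/eqP => u0; apply: nz; split; first exact/(circularP z cO JS).
  exact/(slice_normal_eq0 n3 cO sF Oz JS).
split; first exact/(circularP z cO JS).
by move=> [_ /(slice_normal_eq0 n3 cO sF Oz JS)] /eqP; apply/negP.
Qed.

Lemma normal_domain_circular Om f F : (0 < n)%N -> circular Om -> is_stem Om f F ->
  Om `\` zeros Om (slice_normal Om f) !=set0 ->
  circular (Om `\` zeros Om (slice_normal Om f)).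
Proof.
move=> n0 cO sF [x Ox]; have sym := is_stem_sym sF.
exists [set z | plane Om z /\ normsq (stemval F z) != 0]; split.
- have [J JS xE] := cd_polar x n0; exists (polar x).
  by move: Ox; rewrite xE => /(normal_domain _ cO sF JS); rewrite -xE.
- move=> z [Oz u0]; split; first exact: plane_conj.
  by rewrite (normsq_stem_conj sym).
apply/seteqP; split=> y.
  have [J JS yE] := cd_polar y n0 => Oy; exists (polar y), J; split=> //.
  by move: Oy; rewrite {1}yE => /(normal_domain _ cO sF JS).
by move=> [z [J [h JS ->]]]; exact/(normal_domain z cO sF JS).
Qed.

Lemma is_stem_reciprocal Om f F : circular Om -> is_stem Om f F ->
  (forall z, plane Om z -> normsq (stemval F z) != 0) ->
  is_stem Om (reciprocal Om f) (sinv F).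
Proof.
move=> cO sF u0; have symG := sinv_sym (is_stem_sym sF).
have sG0 := is_stem_induced cO symG.
pose P := [set g | slice Om g /\ forall x, Om x ->
  slice_mul Om f g x = cdone n /\ slice_mul Om g f x = cdone n].
have [[_ [G sG]] Pg] : P (reciprocal Om f).
  apply: getPex; exists (slice_induced Om (sinv F)); split; first by split=> //; exists (sinv F).
  move=> x Ox; have [z [J [JS Oz ->]]] := circular_slice cO Ox.
  have := cxinvr (u0 z Oz); have := cxinvl (u0 z Oz).
  rewrite (is_stem_val (is_stem_mul n3 cO sF sG0) Oz JS).
  rewrite (is_stem_val (is_stem_mul n3 cO sG0 sF) Oz JS).
  by rewrite /cxmul /cxval /= => -[-> ->] [-> ->]; rewrite cdmul0r addr0.
(* Whatever inverse was chosen, its product with [f] is one at both [J] and [-J], hence in the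
   complexification, where right inverses are unique. *)
have GE z : plane Om z -> stemval G z = cxinv (stemval F z).
  move=> Oz; apply: (cxinv_unique n3 (u0 z Oz)).
  have [J JS OzJ] := Oz; apply: (cxval_inj n3 JS).
    have := is_stem_val (is_stem_mul n3 cO sF sG) Oz JS.
    have [-> _] := Pg _ OzJ; rewrite /cxval /= => <-.
    by rewrite cdmul0r addr0.
  have JN := imunitsN JS.
  have := is_stem_val (is_stem_mul n3 cO sF sG) Oz JN.
  have [-> _] : slice_mul Om f (reciprocal Om f) (slice_point z (- J)) = cdone n /\ True.
    by split=> //; apply: (Pg _ _).1; exact/(circularP z cO JN).
  rewrite /cxval /= => <-.
  by rewrite cdmul0r addr0.
move=> z Oz; have [s1 s2] := symG z Oz; split=> // J JS.
by rewrite (is_stem_val sG Oz JS) GE.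
Qed.

Lemma slice_conj_val Om f F z J : circular Om -> is_stem Om f F -> plane Om z ->
  imunits J -> slice_conj Om f (slice_point z J) = cxval (cxconj (stemval F z)) J.
Proof. by move=> cO sF Oz JS; rewrite (is_stem_val (is_stem_conj n3 cO sF) Oz JS). Qed.

Lemma Tmap_slice Om f F E z J : circular Om -> is_stem Om f F -> plane Om z ->
  imunits J -> normsq (stemval F z) != 0 -> E (slice_point z J) != 0 ->
  Tmap Om f E (slice_point z J) =
  slice_point z (twist (cxval (cxconj (stemval F z)) J) (E (slice_point z J)) J).
Proof.
move=> cO sF Oz JS u0 q0; rewrite /Tmap (slice_conj_val cO sF Oz JS) -/(twist _ _ _).
have p0 : cxval (cxconj (stemval F z)) J != 0.
  by apply/eqP => /(cxval_eq0 n3 JS) /eqP; rewrite normsq_conj (negbTE u0).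
by rewrite [X in twist _ _ X]/slice_point twistD !twistZ twist1.
Qed.

(* E plays the role of the spherical derivative of f. *)
Definition twistable Om f F E U :=
  [/\ circular Om, is_stem Om f F & forall z J, imunits J -> U (slice_point z J) ->
    [/\ plane Om z, normsq (stemval F z) != 0, E (slice_point z J) != 0,
        F.2 z = (z.2 : R) *: E (slice_point z J) &
        forall I, imunits I -> U (slice_point z I)]].

Lemma twistableP Om f F E U z J : twistable Om f F E U -> imunits J ->
  U (slice_point z J) ->
  exists I, [/\ imunits I, Tmap Om f E (slice_point z J) = slice_point z I,
    U (slice_point z I) & f (slice_point z I) = cdinv (cxval (cxinv (stemval F z)) J)].
Proof.
move=> [cO sF H] JS Ux; have [Oz u0 q0 bq UI] := H z J JS Ux.
have p0 : cxval (cxconj (stemval F z)) J != 0.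
  by apply/eqP => /(cxval_eq0 n3 JS) /eqP; rewrite normsq_conj (negbTE u0).
have IS := twist_imunits n3 JS p0 q0.
eexists; split; [exact: IS|exact: Tmap_slice|exact: UI|].
by rewrite (is_stem_val sF Oz IS) (cxval_twist n3 JS u0 q0 bq).
Qed.

(** Off the real axis [F.2 z] is nonzero and can be cancelled on the right; at a real point the
    sphere is a single point. *)
Lemma twistable_inj Om f F E U z J I : twistable Om f F E U -> imunits J -> imunits I ->
  U (slice_point z J) -> f (slice_point z J) = f (slice_point z I) ->
  slice_point z J = slice_point z I.
Proof.
move=> [cO sF H] JS IS Ux; have [Oz u0 q0 bq UI] := H z J JS Ux.
have [z0|z0] := eqVneq (z.2 : R) 0; first by rewrite /slice_point z0 !scale0r.
rewrite !(is_stem_val sF)// => /addrI /(cdmulIr n3) -> //=.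
by rewrite bq scaler_eq0 negb_or z0.
Qed.

(** From [g x = f(T x)^-1] and [f y = g(T' y)^-1] one gets [g (T' (T x)) = g x]. Both maps preserve
    spheres and [g] is injective on each of them, so [T' (T x) = x]. Exchanging the two functions
    gives the other composite. *)
Lemma twistable_inverse Om Om' f g F G E E' U : (0 < n)%N ->
  twistable Om f F E U -> twistable Om' g G E' U ->
  (forall z J, imunits J -> U (slice_point z J) -> stemval G z = cxinv (stemval F z)) ->
  (forall x, U x -> g x = cdinv (f (Tmap Om f E x))) /\
  inverse_on U U (Tmap Om f E) (Tmap Om' g E').
Proof.
move=> n0 tF tG GF.
have [[cO sF HF] [cO' sG HG]] := (tF, tG).
have gT x : U x -> g x = cdinv (f (Tmap Om f E x)).
  have [J JS ->] := cd_polar x n0 => Ux.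
  have [I [IS -> UI ->]] := twistableP tF JS Ux.
  have [Oz' _ _ _ _] := HG _ _ JS Ux.
  by rewrite cdinvK (is_stem_val sG Oz' JS) (GF _ _ JS Ux).
have fT x : U x -> f x = cdinv (g (Tmap Om' g E' x)).
  have [J JS ->] := cd_polar x n0 => Ux.
  have [I [IS -> UI ->]] := twistableP tG JS Ux.
  have [Oz u0 _ _ _] := HF _ _ JS Ux.
  by rewrite cdinvK (is_stem_val sF Oz JS) (GF _ _ JS Ux) (cxinvK u0).
split=> //; split.
- move=> x; have [J JS ->] := cd_polar x n0 => Ux.
  by have [I [_ -> ? _]] := twistableP tF JS Ux.
- move=> x; have [J JS ->] := cd_polar x n0 => Ux.
  by have [I [_ -> ? _]] := twistableP tG JS Ux.
- move=> x; have [J JS ->] := cd_polar x n0 => Ux; move: (gT _ Ux).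
  have [I [IS -> UI _]] := twistableP tF JS Ux; move: (fT _ UI).
  have [K [KS -> UK _]] := twistableP tG IS UI => fI gJ.
  by apply: (twistable_inj tG KS JS UK); rewrite gJ fI cdinvK.
- move=> x; have [J JS ->] := cd_polar x n0 => Ux; move: (fT _ Ux).
  have [I [IS -> UI _]] := twistableP tG JS Ux; move: (gT _ UI).
  have [K [KS -> UK _]] := twistableP tF IS UI => gI fJ.
  by apply: (twistable_inj tF KS JS UK); rewrite fJ gI cdinvK.
Qed.

End Reciprocal.

(** * Continuity and conformality *)

Section CayleyDicksonTopology.
Context {R : realType}.

Lemma cvg_near_eq {T} {F : set_system T} {FF : Filter F} (U : topologicalType)
    (f g : T -> U) (l : U) :
  (\forall x \near F, f x = g x) -> g @ F --> l -> f @ F --> l.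
Proof.
move=> fg gl; apply: cvg_trans gl; apply: near_eq_cvg.
by apply: filterS fg => x ->.
Qed.

Lemma cd_norm_pair m (x : CD R m.+1) : `|x| = Num.max `|x.1| `|x.2|.
Proof. exact: prod_normE. Qed.

Lemma cdconj_norm n (x : CD R n) : `|cdconj x| = `|x|.
Proof.
elim: n x => [//|m IH x].
by rewrite (cd_norm_pair x) (cd_norm_pair (cdconj x)) /= normrN IH.
Qed.

Lemma cdre_norm n (x : CD R n) : `|cdre x| <= `|x|.
Proof.
elim: n x => [//|m IH x].
by rewrite (cd_norm_pair x) /= le_max IH.
Qed.

(** The norm here is a maximum over coordinates, for which the product is only submultiplicative up
    to a constant: each doubling adds two products and costs a factor 2. *)
Lemma cdmul_norm n (x y : CD R n) : `|x ** y| <= 2 ^+ n * `|x| * `|y|.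
Proof.
elim: n x y => [x y|m IH x y]; first by rewrite expr0 mul1r normrM.
rewrite (cd_norm_pair (x ** y)) cdmul_pair /=.
have [x1 x2] : `|x.1| <= `|x| /\ `|x.2| <= `|x|.
  by rewrite !(cd_norm_pair x) !le_max !lexx orbT.
have [y1 y2] : `|y.1| <= `|y| /\ `|y.2| <= `|y|.
  by rewrite !(cd_norm_pair y) !le_max !lexx orbT.
have b (u v : CD R m) (p q : R) : `|u| <= p -> `|v| <= q -> `|u ** v| <= 2 ^+ m * (p * q).
  move=> up vq; apply: (le_trans (IH u v)); rewrite -mulrA ler_wpM2l ?exprn_ge0//.
  exact: ler_pM.
have E : 2 ^+ m.+1 * `|x| * `|y| = 2 ^+ m * (`|x| * `|y|) + 2 ^+ m * (`|x| * `|y|).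
  by rewrite exprS; ring.
rewrite ge_max E; apply/andP; split.
  apply: (le_trans (ler_normB _ _)); apply: lerD; first exact: b.
  by rewrite (mulrC `|x|); apply: b => //; rewrite cdconj_norm.
apply: (le_trans (ler_normD _ _)); apply: lerD.
  by rewrite (mulrC `|x|); exact: b.
by apply: b => //; rewrite cdconj_norm.
Qed.

Section Limits.
Context {T : Type} {F : set_system T} {FF : Filter F}.

Lemma cvg_cdpair m (f : T -> CD R m.+1) (a : CD R m.+1) :
  f @ F --> a <-> (fun t => (f t).1 : CD R m) @ F --> (a.1 : CD R m) /\
                  (fun t => (f t).2 : CD R m) @ F --> (a.2 : CD R m).
Proof.
split=> [h|[h1 h2]].
  split; first by apply: (cvg_comp _ _ h); exact: cvg_fst.
  by apply: (cvg_comp _ _ h); exact: cvg_snd.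
have -> : f = (fun t => ((f t).1, (f t).2)) by apply/funext => t; case: (f t).
by rewrite [a]surjective_pairing; exact: cvg_pair.
Qed.

Lemma cvg_cdconj n (f : T -> CD R n) a : f @ F --> a -> (fun t => cdconj (f t)) @ F --> cdconj a.
Proof.
elim: n f a => [//|m IH] f a /cvg_cdpair[h1 h2]; apply/cvg_cdpair; split => /=.
  exact: IH.
exact: cvgN.
Qed.

Lemma cvg_cdre n (f : T -> CD R n) a : f @ F --> a -> (fun t => cdre (f t)) @ F --> cdre a.
Proof. by elim: n f a => [//|m IH] f a /cvg_cdpair[h1 _]; exact: IH. Qed.

Lemma cvg_cdmul n (f g : T -> CD R n) a b : f @ F --> a -> g @ F --> b ->
  (fun t => f t ** g t) @ F --> a ** b.
Proof.
elim: n f g a b => [|m IH] f g a b; first exact: cvgM.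
move=> /cvg_cdpair[f1 f2] /cvg_cdpair[g1 g2]; apply/cvg_cdpair; split => /=.
  by apply: cvgB; apply: IH => //; exact: cvg_cdconj.
by apply: cvgD; apply: IH => //; exact: cvg_cdconj.
Qed.

Lemma cvg_cddot n (f g : T -> CD R n) a b : f @ F --> a -> g @ F --> b ->
  (fun t => cddot (f t) (g t)) @ F --> cddot a b.
Proof. by move=> fa gb; apply: cvg_cdre; apply: cvg_cdmul => //; exact: cvg_cdconj. Qed.

Lemma cvg_cdinv n (f : T -> CD R n) a : a != 0 -> f @ F --> a ->
  (fun t => cdinv (f t)) @ F --> cdinv a.
Proof.
move=> a0 fa; apply: cvgZ; last exact: cvg_cdconj.
by apply: cvgV; [rewrite cddot_eq0|exact: cvg_cddot].
Qed.

End Limits.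

(** The derivative at 0 as a plain difference quotient, on which algebra identities can be rewritten
    directly. *)
Definition has_deriv0 n (f : R -> CD R n) (df : CD R n) :=
  (fun h : R => h^-1 *: (f h - f 0)) @ 0^' --> df.

Lemma has_deriv0P n (f : R -> CD R n) df : is_derive (0 : R) 1 f df <-> has_deriv0 f df.
Proof.
rewrite /has_deriv0.
have E : (fun h : R => h^-1 *: (f h - f 0)) =
    (fun h : R => h^-1 *: ((f \o shift 0) (h *: (1 : R)) - f 0)).
  by apply/funext => h; rewrite /= addr0 /GRing.scale /= mulr1.
rewrite E; split=> [[d <-]|d]; first exact: d.
split; first by apply/cvg_ex; exists df.
by apply: cvg_lim d.
Qed.

Lemma has_deriv0_cvg n (f : R -> CD R n) df : has_deriv0 f df -> f @ 0^' --> f 0.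
Proof.
move=> d; have h0 : (fun h : R => h *: (h^-1 *: (f h - f 0))) @ 0^' --> (0 : R) *: df.
  by apply: cvgZ; [exact: nbhs_dnbhs|exact: d].
have h1 : (fun h : R => h *: (h^-1 *: (f h - f 0)) + f 0) @ 0^' --> (0 : R) *: df + f 0.
  by apply: cvgD; [exact: h0|exact: cvg_cst].
rewrite scale0r add0r in h1; refine (cvg_near_eq _ h1).
near=> h; rewrite scalerA mulfV ?scale1r ?subrK//.
by near: h; exact: nbhs_dnbhs_neq.
Unshelve. all: by end_near.
Qed.

Lemma has_deriv0_inv n (f : R -> CD R n) df : f 0 != 0 -> has_deriv0 f df ->
  has_deriv0 (fun t => cdinv (f t))
   ((cddot (f 0) (f 0))^-1 *: cdconj df -
    (2 * cddot (f 0) df / cddot (f 0) (f 0) ^+ 2) *: cdconj (f 0)).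
Proof.
move=> f0 ff; have fc := has_deriv0_cvg ff.
have d0 : cddot (f 0) (f 0) != 0 by rewrite cddot_eq0.
rewrite /has_deriv0.
(* An exact form of the quotient for conj(f)/|f|^2 in which [h^-1] only meets [f h - f 0], so the
   limit can be taken factor by factor. *)
have E : \forall h \near 0^', h^-1 *: (cdinv (f h) - cdinv (f 0)) =
   (cddot (f h) (f h))^-1 *: cdconj (h^-1 *: (f h - f 0)) -
   ((cddot (h^-1 *: (f h - f 0)) (f h) + cddot (f 0) (h^-1 *: (f h - f 0)))
     / (cddot (f h) (f h) * cddot (f 0) (f 0))) *: cdconj (f 0).
  near=> h.
  have h0 : h != 0 by near: h; exact: nbhs_dnbhs_neq.
  have h1 : cddot (f h) (f h) != 0.
    by near: h; apply: (cvgr_neq0 (cddot (f 0) (f 0))) => //; exact: cvg_cddot.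
  rewrite /cdinv !(cddotZl, cddotZr, cddotBl, cddotBr) cdconjZ cdconjB.
  rewrite (cddotC (f 0) (f h)); apply: cddot_ext => w; rewrite !cddotLE; field.
  by rewrite d0 h1 h0.
refine (cvg_near_eq E _).
have cff : (fun t => cddot (f t) (f t)) @ 0^' --> cddot (f 0) (f 0) by exact: cvg_cddot.
apply: cvgB.
  by apply: cvgZ; [exact: cvgV|exact: cvg_cdconj].
apply: cvgZ; last exact: cvg_cst.
rewrite mulrDl mul1r {1}(cddotC (f 0)).
apply: cvgM; first by apply: cvgD; apply: cvg_cddot => //; exact: cvg_cst.
apply: cvgV; first by rewrite expf_neq0.
by rewrite expr2; apply: cvgM => //; exact: cvg_cst.
Unshelve. all: by end_near.
Qed.

End CayleyDicksonTopology.

Lemma inverse_on_bij (R : realType) m n (U : set (CD R m)) (V : set (CD R n)) f g :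
  inverse_on U V f g -> set_bij U V f.
Proof.
move=> [UV VU gf fg]; split; first by [].
- by move=> x y /set_mem Ux /set_mem Uy /(congr1 g); rewrite !gf.
- by move=> y Vy; exists (g y); [exact: VU|exact: fg].
Qed.

(** * Conformality on spheres *)

Section Conformality.
Context {R : realType} {n : nat}.
Notation A := (CD R n).
Notation stemT := ((CD R 1 -> A) * (CD R 1 -> A))%type.
Implicit Types (z w : CD R 1) (J I x y : A) (Om U : set A) (f g E : A -> A) (F G : stemT).
Hypothesis n3 : (n <= 3)%N.

Lemma sphereP z J y : imunits J ->
  sphere (slice_point z J) y <-> exists2 I, imunits I & y = slice_point z I.
Proof.
move=> JS; split=> [[w [J' [I [J'S IS e ->]]]]|[I IS ->]]; last by exists z, J, I.
have [[-> _]|[-> _]] := slice_point_inj JS J'S e; first by exists I.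
by exists (- I); [exact: imunitsN|rewrite slice_pointN].
Qed.

Lemma angle_scale (la : R) (u1 u2 v1 v2 : A) : 0 < la ->
  cddot v1 v2 = la * cddot u1 u2 -> cddot v1 v1 = la * cddot u1 u1 ->
  cddot v2 v2 = la * cddot u2 u2 -> angle v1 v2 = angle u1 u2.
Proof.
move=> la0 e12 e1 e2; rewrite /angle e12 e1 e2 !sqrtrM ?ltW//.
rewrite mulrACA -expr2 sqr_sqrtr ?ltW// invfM mulrACA mulfV ?mul1r//.
by rewrite gt_eqF.
Qed.

(** [D] is the differential of the inversion at [w]: up to conjugation, the reflection that reverses
    [w], divided by |w|^2. Scalar products are thus divided by |w|^4. *)
Lemma cddot_inv_deriv (w h1 h2 : A) : w != 0 ->
  let D h := (cddot w w)^-1 *: cdconj h - (2 * cddot w h / cddot w w ^+ 2) *: cdconj w in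
  cddot (D h1) (D h2) = cddot h1 h2 / cddot w w ^+ 2.
Proof.
rewrite -cddot_eq0 => w0 D; rewrite /D !(cddotLE, cddotDr, cddotNr, cddotZr) !cddot_conj.
by rewrite (cddotC h1 w); field.
Qed.

(** T is not differentiated through its own formula. The relation [f (T x) = g(x)^-1] is solved for
    the unit of [T x], and on a sphere [g] is affine in the unit, so only the derivative of an
    inverse is needed. *)
Lemma Tmap_sphere_deriv Om f F E U z J (c : R -> A) du : twistable Om f F E U ->
    imunits J -> U (slice_point z J) -> z.2 != 0 :> R ->
    (forall t, sphere (slice_point z J) (c t)) -> has_deriv0 c du ->
  let v := cxinv (stemval F z) in
  let W := cxval v ((z.2 : R)^-1 *: cdim (c 0)) in
  let H := ((z.2 : R)^-1 *: du) ** v.2 in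
  W != 0 /\
  has_deriv0 (Tmap Om f E \o c)
    ((z.2 : R) *: (((cddot W W)^-1 *: cdconj H -
        (2 * cddot W H / cddot W W ^+ 2) *: cdconj W) ** cdinv (F.2 z))).
Proof.
move=> tF JS Ux z0 cS cD v W H; have [cO sF HF] := tF.
have [Oz u0 q0 bq UI] := HF z J JS Ux.
have b0 : F.2 z != 0 by rewrite bq scaler_eq0 negb_or z0.
(* On a fixed sphere the unit depends affinely on the point, so it inherits the derivative of the
   curve. *)
pose Jt t := (z.2 : R)^-1 *: (c t - (z.1 : R) *: cdone n).
have Jc t : exists2 I, imunits I & c t = slice_point z I.
  by have /(sphereP _ _ JS) := cS t.
have JtE t : imunits (Jt t) /\ c t = slice_point z (Jt t).
  have [I IS e] := Jc t; suff -> : Jt t = I by [].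
  by rewrite /Jt e /slice_point addrAC subrr add0r scalerA mulVf ?scale1r.
have W0E : W = cxval v (Jt 0).
  by have [JS0 e] := JtE 0; rewrite /W e cdim_slice// scalerA mulVf// scale1r.
have v0 : normsq v != 0 by rewrite normsq_inv// invr_eq0.
have W0 : W != 0.
  by rewrite W0E; apply/eqP => /(cxval_eq0 n3 (JtE 0).1)/eqP; rewrite (negbTE v0).
split=> //.
(* Here [f (T x) = F.1 z + I F.2 z] is solved for the unit [I] of [T x]; [F.2 z] is invertible
   because the sphere is not a point. *)
have TE : Tmap Om f E \o c = fun t => (z.1 : R) *: cdone n +
    (z.2 : R) *: ((cdinv (cxval v (Jt t)) - F.1 z) ** cdinv (F.2 z)).
  apply/funext => t /=; have [JtS ce] := JtE t; rewrite ce.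
  have [I [IS -> UI' fI]] := twistableP n3 tF JtS (UI _ JtS).
  rewrite -fI (is_stem_val sF Oz IS) /cxval /= addrAC subrr add0r.
  by rewrite cdmulrK.
have JtD : has_deriv0 Jt ((z.2 : R)^-1 *: du).
  rewrite /has_deriv0 /Jt.
  under eq_fun do rewrite -scalerBr opprB addrA subrK scalerA mulrC -scalerA.
  by apply: cvgZ; [exact: cvg_cst|exact: cD].
have WD : has_deriv0 (fun t => cxval v (Jt t)) H.
  rewrite /has_deriv0 /cxval.
  under eq_fun do rewrite opprD addrACA subrr add0r -cdmulBl -cdmulZl.
  by apply: cvg_cdmul; [exact: JtD|exact: cvg_cst].
have := has_deriv0_inv (f := fun t => cxval v (Jt t)) _ WD.
rewrite /= -W0E => /(_ W0) ID.
rewrite TE /has_deriv0.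
under eq_fun do rewrite opprD addrACA subrr add0r -scalerBr -cdmulBl opprB addrA subrK
  scalerA mulrC -scalerA -cdmulZl.
apply: cvgZ; first exact: cvg_cst.
apply: cvg_cdmul; last exact: cvg_cst.
exact: ID.
Qed.

Lemma conformal_Tmap Om Om' f g F G E E' U z J : (0 < n)%N ->
  twistable Om f F E U -> twistable Om' g G E' U ->
  (forall z J, imunits J -> U (slice_point z J) -> stemval G z = cxinv (stemval F z)) ->
  imunits J -> U (slice_point z J) -> z.2 != 0 :> R ->
  conformal (sphere (slice_point z J)) (Tmap Om f E).
Proof.
move=> n0 tF tG GF JS Ux z0; have [_ [UT UT' TK TK']] := twistable_inverse n3 n0 tF tG GF.
have [cO sF HF] := tF; have [Oz u0 q0 bq UI] := HF z J JS Ux.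
have b0 : F.2 z != 0 by rewrite bq scaler_eq0 negb_or z0.
split.
  apply: (@inverse_on_bij _ _ _ _ _ _ (Tmap Om' g E')); split.
  - move=> x /(sphereP _ _ JS)[I IS ->]; apply/(sphereP _ _ JS).
    by have [K [KS -> _ _]] := twistableP n3 tF IS (UI I IS); exists K.
  - move=> x /(sphereP _ _ JS)[I IS ->]; apply/(sphereP _ _ JS).
    by have [K [KS -> _ _]] := twistableP n3 tG IS (UI I IS); exists K.
  - by move=> x /(sphereP _ _ JS)[I IS ->]; apply: TK; exact: UI.
  - by move=> x /(sphereP _ _ JS)[I IS ->]; apply: TK'; exact: UI.
move=> p u1 u2 c1 c2 u10 u20 [c1S c1p /has_deriv0P c1D] [c2S c2p /has_deriv0P c2D].
have [W1 D1] := Tmap_sphere_deriv tF JS Ux z0 c1S c1D.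
have [W2 D2] := Tmap_sphere_deriv tF JS Ux z0 c2S c2D.
move: W1 D1 W2 D2; rewrite c1p c2p.
set v := cxinv _; set W := cxval v _; set v1 := (X in has_deriv0 _ X) => W0 D1 _.
set v2 := (X in has_deriv0 _ X) => D2.
have d0 : v.2 != 0.
  by rewrite -cddot_eq0 cddot_cxinv2// mulf_neq0 ?invr_eq0// cddot_eq0.
have WW0 : 0 < cddot W W by rewrite cddot_gt0.
(* Product of the squared dilations: right multiplication by [v.2], inversion at [W], right division
   by [F.2 z]. The two scalings by [z.2] cancel. *)
pose la := cddot v.2 v.2 / (cddot (F.2 z) (F.2 z) * cddot W W ^+ 2).
have la0 : 0 < la by rewrite divr_gt0 ?mulr_gt0 ?exprn_gt0 ?cddot_gt0.
have dot (a b : A) : cddot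
    ((z.2 : R) *: (((cddot W W)^-1 *: cdconj (((z.2 : R)^-1 *: a) ** v.2) -
        (2 * cddot W (((z.2 : R)^-1 *: a) ** v.2) / cddot W W ^+ 2) *: cdconj W)
        ** cdinv (F.2 z)))
    ((z.2 : R) *: (((cddot W W)^-1 *: cdconj (((z.2 : R)^-1 *: b) ** v.2) -
        (2 * cddot W (((z.2 : R)^-1 *: b) ** v.2) / cddot W W ^+ 2) *: cdconj W)
        ** cdinv (F.2 z))) = la * cddot a b.
  rewrite cddotZl cddotZr cddot_mul2r// cddot_inv_deriv// cddot_mul2r// cddot_inv.
  rewrite (cddotZl (z.2 : R)^-1) (cddotZr (z.2 : R)^-1) /la; field.
  by rewrite z0 cddot_eq0 W0 cddot_eq0 b0.
have nz (a b : A) : cddot b b = la * cddot a a -> a != 0 -> b != 0.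
  by move=> e a0; rewrite -cddot_gt0 e mulr_gt0// cddot_gt0.
exists v1, v2; split.
- by apply: nz u10; exact: dot.
- by apply: nz u20; exact: dot.
- exact/has_deriv0P.
- exact/has_deriv0P.
- by apply: (angle_scale la0); exact: dot.
Qed.

End Conformality.

(** * Continuity off the real axis *)

Section Continuity.
Context {R : realType} {n : nat}.
Notation A := (CD R n).
Notation stemT := ((CD R 1 -> A) * (CD R 1 -> A))%type.
Implicit Types (z w : CD R 1) (J I x y : A) (Om U : set A) (f g E : A -> A) (F G : stemT).
Hypothesis n3 : (n <= 3)%N.
Hypothesis n0 : (0 < n)%N.

Definition cddir x : A := ((polar x).2 : R)^-1 *: cdim x.

Lemma polar_neq0 x : ~ cdreal x -> (polar x).2 != 0 :> R.
Proof.
move=> xr; apply/eqP => e; apply: xr; have [J JS xE] := cd_polar x n0.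
by rewrite xE; apply/cdreal_slice.
Qed.

Lemma cddirP x : ~ cdreal x -> imunits (cddir x) /\ x = slice_point (polar x) (cddir x).
Proof.
move=> /polar_neq0 x0; have [J JS xE] := cd_polar x n0.
suff -> : cddir x = J by [].
by rewrite /cddir [cdim x](_ : _ = ((polar x).2 : R) *: J) ?scalerA ?mulVf ?scale1r//
  {1}xE cdim_slice.
Qed.

Lemma slice_conj_polar Om f F x : circular Om -> is_stem Om f F -> Om x -> ~ cdreal x ->
  slice_conj Om f x = cxval (cxconj (stemval F (polar x))) (cddir x).
Proof.
move=> cO sF Ox /cddirP[IS xE]; rewrite {1}xE (slice_conj_val n3 cO sF)//.
by apply/(circularP _ cO IS); rewrite -xE.
Qed.

Lemma spherical_derivative_polar Om f F x : circular Om -> is_stem Om f F -> Om x ->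
  ~ cdreal x -> spherical_derivative f x = ((polar x).2 : R)^-1 *: F.2 (polar x).
Proof.
move=> cO sF Ox xr; have [IS xE] := cddirP xr.
rewrite {1}xE (spherical_derivativeE n3 cO sF _ IS (polar_neq0 xr))//.
by apply/(circularP _ cO IS); rewrite -xE.
Qed.

Section Limits.
Context {T : Type} {Fl : set_system T} {FF : Filter Fl}.

Lemma cvg_cdim (h : T -> A) a : h @ Fl --> a -> (fun t => cdim (h t)) @ Fl --> cdim a.
Proof.
move=> ha; apply: cvgZ; first exact: cvg_cst.
by apply: cvgB => //; exact: cvg_cdconj.
Qed.

Lemma cvg_polar (h : T -> A) a : h @ Fl --> a -> (fun t => polar (h t)) @ Fl --> polar a.
Proof.
move=> ha; apply/cvg_cdpair; split; first exact: cvg_cdre.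
apply: (@cvg_comp _ _ _ (fun t => cddot (cdim (h t)) (cdim (h t))) (@Num.sqrt R) Fl
  (nbhs (cddot (cdim a) (cdim a)))); first by apply: cvg_cddot; exact: cvg_cdim.
exact: sqrt_continuous.
Qed.

Lemma cvg_twist (p q x : T -> A) a b c : a != 0 -> b != 0 -> p @ Fl --> a ->
  q @ Fl --> b -> x @ Fl --> c ->
  (fun t => twist (p t) (q t) (x t)) @ Fl --> twist a b c.
Proof.
move=> a0 b0 pa qb xc; apply: cvg_cdmul; last exact: cvg_cdinv.
by apply: cvg_cdmul; [exact: cvg_cdinv|do 2 apply: cvg_cdmul => //].
Qed.

End Limits.

Lemma cvg_within_eq (U : set A) x (h k : A -> A) : U x ->
  (forall y, U y -> h y = k y) -> k @ within U (nbhs x) --> k x ->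
  h @ within U (nbhs x) --> h x.
Proof.
move=> Ux hk; rewrite (hk x Ux) => kx; refine (cvg_near_eq _ kx).
by rewrite near_withinE; near=> y; exact: hk.
Unshelve. all: by end_near.
Qed.

Lemma Tmap_continuous Om f F U : circular Om -> is_stem Om f F -> U `<=` Om ->
  (forall x, U x -> ~ cdreal x) -> (forall x, U x -> plane U (polar x)) ->
  (forall z, plane U z -> normsq (stemval F z) != 0 /\ F.2 z != 0) ->
  {within plane U, continuous F.1} -> {within plane U, continuous F.2} ->
  {within U, continuous (Tmap Om f (spherical_derivative f))}.
Proof.
move=> cO sF UO Ur Up Unz /subspace_continuousP c1 /subspace_continuousP c2.
apply/subspace_continuousP => x Ux.
have FFx : Filter (within U (nbhs x)) by exact: within_filter.
(* The stem is continuous only relative to [plane U]; this sharper limit is what allows composing it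
   with [polar]. *)
have cp : polar @ within U (nbhs x) --> within (plane U) (nbhs (polar x)).
  move=> B; rewrite /within /= => hB.
  have H : nbhs x (fun y => plane U (polar y) -> B (polar y)).
    exact: (@cvg_polar _ (nbhs x) _ id x cvg_id _ hB).
  by apply: filterS H => y By Uy; apply: By; exact: Up.
have F1 : (fun y => F.1 (polar y)) @ within U (nbhs x) --> F.1 (polar x).
  by apply: (@cvg_comp _ _ _ polar F.1 _ (within (plane U) (nbhs (polar x)))) => //;
    apply: c1; exact: Up.
have F2 : (fun y => F.2 (polar y)) @ within U (nbhs x) --> F.2 (polar x).
  by apply: (@cvg_comp _ _ _ polar F.2 _ (within (plane U) (nbhs (polar x)))) => //;
    apply: c2; exact: Up.
have idx : (fun y : A => y) @ within U (nbhs x) --> x by exact: cvg_within.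
have pol2 : (fun y => ((polar y).2 : R)^-1) @ within U (nbhs x) --> ((polar x).2 : R)^-1.
  apply: cvgV; first by apply: polar_neq0; exact: Ur.
  by have [_ h] := proj1 (cvg_cdpair (m := 0) _ _) (cvg_polar idx).
have E (y : A) : U y -> Tmap Om f (spherical_derivative f) y =
    twist (cxval (cxconj (stemval F (polar y))) (cddir y))
       (((polar y).2 : R)^-1 *: F.2 (polar y)) y.
  move=> Uy; rewrite /Tmap -/(twist _ _ _) (slice_conj_polar cO sF)
    ?(spherical_derivative_polar cO sF)//;
  by [exact: UO|exact: Ur].
have [u0 b0] := Unz _ (Up _ Ux); have xr := Ur _ Ux.
apply: (cvg_within_eq Ux E); apply: cvg_twist => //.
- apply/eqP => /(cxval_eq0 n3 (cddirP xr).1)/eqP.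
  by rewrite normsq_conj (negbTE u0).
- by rewrite scaler_eq0 negb_or invr_eq0 polar_neq0.
- apply: cvgD; first exact: cvg_cdconj.
  apply: cvg_cdmul; last exact: cvg_cdconj.
  by apply: cvgZ => //; exact: cvg_cdim.
- by apply: cvgZ.
Qed.

Lemma sinv_continuous F (D : set (CD R 1)) : (forall z, D z -> normsq (stemval F z) != 0) ->
  {within D, continuous F.1} -> {within D, continuous F.2} ->
  {within D, continuous (sinv F).1} /\ {within D, continuous (sinv F).2}.
Proof.
move=> u0 /subspace_continuousP c1 /subspace_continuousP c2.
suff H z : D z -> (sinv F).1 @ within D (nbhs z) --> (sinv F).1 z /\
                  (sinv F).2 @ within D (nbhs z) --> (sinv F).2 z.
  by split; apply/subspace_continuousP => z /H[].
move=> Dz; have FFx : Filter (within D (nbhs z)) by exact: within_filter.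
have [f1 f2] := (c1 z Dz, c2 z Dz).
have nr : (fun z => normre (stemval F z)) @ within D (nbhs z) --> normre (stemval F z).
  by apply: cvgB; exact: cvg_cddot.
have ni : (fun z => normim (stemval F z)) @ within D (nbhs z) --> normim (stemval F z).
  by apply: cvgM; [exact: cvg_cst|exact: cvg_cddot].
have nv : (fun z => (normsq (stemval F z))^-1) @ within D (nbhs z) --> (normsq (stemval F z))^-1.
  apply: cvgV; first exact: u0.
  by rewrite /normsq !expr2; apply: cvgD; apply: cvgM.
split; apply: cvgZ => //.
  by apply: cvgD; apply: cvgZ => //; exact: cvg_cdconj.
by apply: cvgB; apply: cvgZ => //; exact: cvg_cdconj.
Qed.

End Continuity.

(** * Power series *)

Section Coordinates.
Context {R : realType}.

Definition co m (x : CD R m) (i : 'I_(2 ^ m)) : R := (cdcoords x)`_i.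

Lemma size_cdcoords m (x : CD R m) : size (cdcoords x) = (2 ^ m)%N.
Proof.
by elim: m x => [//|m IH] [x1 x2]; rewrite /= size_cat !IH expnS mul2n addnn.
Qed.

Lemma nth_cdcoordsD m (x y : CD R m) i :
  (cdcoords (x + y))`_i = (cdcoords x)`_i + (cdcoords y)`_i.
Proof.
elim: m x y i => [|m IH].
  by move=> x y [|[|i]] //=; rewrite addr0.
move=> [x1 x2] [y1 y2] i; rewrite /= !nth_cat !size_cdcoords.
by case: ifP => _; exact: IH.
Qed.

Lemma nth_cdcoordsZ m (a : R) (x : CD R m) i :
  (cdcoords (a *: x))`_i = a * (cdcoords x)`_i.
Proof.
elim: m x i => [|m IH].
  by move=> x [|[|i]] //=; rewrite mulr0.
move=> [x1 x2] i; rewrite /= !nth_cat !size_cdcoords.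
by case: ifP => _; exact: IH.
Qed.

Lemma coD m (x y : CD R m) i : co (x + y) i = co x i + co y i.
Proof. exact: nth_cdcoordsD. Qed.

Lemma coZ m (a : R) (x : CD R m) i : co (a *: x) i = a * co x i.
Proof. exact: nth_cdcoordsZ. Qed.

Lemma co_norm m (x : CD R m) i : `|co x i| <= `|x|.
Proof.
rewrite /co; move: (nat_of_ord i) => {}i; elim: m x i => [|m IH].
  by move=> x [|[|i]] //=; rewrite normr0.
move=> x i; rewrite (cd_norm_pair x) /= nth_cat le_max.
by case: ifP => _; rewrite IH ?orbT.
Qed.

Lemma cd_basis m : exists b : nat -> CD R m, forall x : CD R m,
  x = \sum_(i < 2 ^ m) co x i *: b i.
Proof.
suff [b H] : exists b : nat -> CD R m, forall x : CD R m,
    x = \sum_(0 <= i < 2 ^ m) (cdcoords x)`_i *: b i.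
  by exists b => x; rewrite {1}(H x) big_mkord.
elim: m => [|m [b H]].
  exists (fun=> 1) => x; rewrite big_nat1 /=.
  exact/esym/(@mulr1 R).
pose B i : CD R m.+1 := if (i < 2 ^ m)%N then (b i, 0) else (0, b (i - 2 ^ m)%N).
exists B => x.
have s1 (r : seq nat) (G : nat -> CD R m.+1) :
    (\sum_(i <- r) G i).1 = \sum_(i <- r) (G i).1 :> CD R m.
  by apply: (big_morph (fun x : CD R m.+1 => x.1 : CD R m)).
have s2 (r : seq nat) (G : nat -> CD R m.+1) :
    (\sum_(i <- r) G i).2 = \sum_(i <- r) (G i).2 :> CD R m.
  by apply: (big_morph (fun x : CD R m.+1 => x.2 : CD R m)).
have E : (2 ^ m.+1 = 2 ^ m + 2 ^ m)%N by rewrite expnS mul2n addnn.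
have lo i : (i < 2 ^ m)%N -> (cdcoords x)`_i = (cdcoords (x.1 : CD R m))`_i.
  by move=> im; rewrite [cdcoords x]/= nth_cat size_cdcoords im.
have hi i : (cdcoords x)`_(i + 2 ^ m) = (cdcoords (x.2 : CD R m))`_i.
  by rewrite [cdcoords x]/= nth_cat size_cdcoords ltnNge leq_addl /= addnK.
have split (G : nat -> CD R m) : \sum_(0 <= i < 2 ^ m + 2 ^ m) G i =
    \sum_(0 <= i < 2 ^ m) G i + \sum_(0 <= i < 2 ^ m) G (i + 2 ^ m)%N.
  rewrite (@big_cat_nat _ _ _ (2 ^ m)) ?leq_addr//=; congr (_ + _).
  by rewrite -{1}[(2 ^ m)%N]add0n big_addn addnK.
rewrite [LHS]surjective_pairing [RHS]surjective_pairing s1 s2 E.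
congr (_, _); apply/esym.
  apply: (etrans (split _)); rewrite [X in _ + X]big1_seq ?addr0.
    rewrite [RHS](H x.1); apply: eq_big_nat => i /andP[_ im].
    by rewrite lo// /B im.
  by move=> i _; rewrite /B ltnNge leq_addl /= scaler0.
apply: (etrans (split _)); rewrite [X in X + _]big1_seq ?add0r.
  rewrite [RHS](H x.2); apply: eq_big_nat => i /andP[_ im].
  by rewrite hi /B ltnNge leq_addl /= addnK.
by move=> i /andP[_]; rewrite mem_index_iota => /andP[_ im]; rewrite /B im /= scaler0.
Qed.

End Coordinates.

(** * Homogeneous polynomials with size bounds *)

Section HomogeneousPolynomials.
Context {R : realType}.

(* P is a homogeneous polynomial of degree k in the coordinates, given by
   nested Horner-like sums whose coefficients have total size at most M. *)
Fixpoint hpoly (m n k : nat) (M : R) (P : CD R m -> CD R n) : Prop :=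
  match k with
  | 0 => exists2 c, `|c| <= M & forall h, P h = c
  | k'.+1 => exists (Q : 'I_(2 ^ m) -> CD R m -> CD R n) (K : 'I_(2 ^ m) -> R),
      [/\ forall i, hpoly k' (K i) (Q i), \sum_i K i <= M &
          forall h, P h = \sum_i co h i *: Q i h]
  end.

Definition bounded_linear n p (L : CD R n -> CD R p) (K : R) :=
  [/\ forall x y, L (x + y) = L x + L y, forall (a : R) x, L (a *: x) = a *: L x &
      forall x, `|L x| <= K * `|x|].

Definition bounded_bilinear n p q (B : CD R n -> CD R p -> CD R q) (K : R) :=
  [/\ forall x y z, B (x + y) z = B x z + B y z,
      forall (a : R) x y, B (a *: x) y = a *: B x y,
      forall x y z, B z (x + y) = B z x + B z y,
      forall (a : R) x y, B x (a *: y) = a *: B x y &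
      forall x y, `|B x y| <= K * `|x| * `|y|].

Lemma bounded_linear_sum n p (L : CD R n -> CD R p) K (I : Type) (r : seq I) (F : I -> CD R n) :
  bounded_linear L K -> L (\sum_(i <- r) F i) = \sum_(i <- r) L (F i).
Proof.
move=> [LD LZ _]; apply: (big_morph L) => //.
by rewrite -(scale0r (0 : CD R n)) LZ scale0r.
Qed.

Lemma bounded_linearB n p (L : CD R n -> CD R p) K x y :
  bounded_linear L K -> L (x - y) = L x - L y.
Proof. by move=> [LD LZ _]; rewrite -[- y]scaleN1r -[- L y]scaleN1r LD LZ. Qed.

Lemma bilinear_left n p q (B : CD R n -> CD R p -> CD R q) K y :
  0 <= K -> bounded_bilinear B K -> bounded_linear (B^~ y) (K * `|y|).
Proof.
by move=> K0 [BD BZ _ _ Bn]; split=> // x; rewrite mulrAC; exact: Bn.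
Qed.

Lemma bilinear_right n p q (B : CD R n -> CD R p -> CD R q) K x :
  0 <= K -> bounded_bilinear B K -> bounded_linear (B x) (K * `|x|).
Proof. by move=> K0 [_ _ BD BZ Bn]; split=> // y; exact: Bn. Qed.

Lemma cdmul_bilinear n : bounded_bilinear (@cdmul R n) (2 ^+ n).
Proof.
split; [exact: cdmulDl|exact: cdmulZl| |exact: cdmulZr|exact: cdmul_norm].
by move=> *; exact: cdmulDr.
Qed.

(** Taking the scalar in [CD R 0] makes scalar multiplication an instance of [bounded_bilinear]. *)
Definition cdscale n (a : CD R 0) (x : CD R n) : CD R n := (a : R) *: x.

Lemma cdscale_bilinear n : bounded_bilinear (@cdscale n) 1.
Proof.
rewrite /cdscale; split.
- by move=> x y z; rewrite scalerDl.
- by move=> a x y; rewrite scalerA.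
- by move=> x y z; rewrite scalerDr.
- by move=> a x y; rewrite !scalerA mulrC.
- by move=> x y; rewrite mul1r normrZ.
Qed.

Section Fixed.
Context {m n : nat}.
Implicit Types (P Q : CD R m -> CD R n).

Lemma hpoly_ext k M P Q : P =1 Q -> hpoly k M P -> hpoly k M Q.
Proof.
move=> /funext ->; exact.
Qed.

Lemma hpoly_ge0 k M P : hpoly k M P -> 0 <= M.
Proof.
elim: k M P => [|k IH] M P /=; first by move=> [c /(le_trans (normr_ge0 _))].
move=> [Q [K [HQ KM _]]]; apply: le_trans KM; apply: sumr_ge0 => i _.
exact: IH (HQ i).
Qed.

Lemma hpoly_le k M M' P : M <= M' -> hpoly k M P -> hpoly k M' P.
Proof.
case: k => [|k] MM' /=; first by move=> [c cM Pc]; exists c => //; exact: le_trans MM'.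
by move=> [Q [K [HQ KM PE]]]; exists Q, K; split=> //; exact: le_trans MM'.
Qed.

Lemma hpoly0 k : hpoly k 0 (fun _ : CD R m => 0 : CD R n).
Proof.
elim: k => [|k IH] /=; first by exists 0; rewrite ?normr0.
exists (fun _ _ => 0), (fun=> 0); split=> //; first by rewrite big1.
by move=> h; rewrite big1// => i _; rewrite scaler0.
Qed.

Lemma hpolyD k M N P Q : hpoly k M P -> hpoly k N Q ->
  hpoly k (M + N) (fun h => P h + Q h).
Proof.
elim: k M N P Q => [|k IH] M N P Q /=.
  move=> [c cM Pc] [d dN Qd]; exists (c + d); last by move=> h; rewrite Pc Qd.
  by apply: (le_trans (ler_normD _ _)); exact: lerD.
move=> [P' [K [HP KM PE]]] [Q' [L [HQ LN QE]]].
exists (fun i h => P' i h + Q' i h), (fun i => K i + L i); split.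
- by move=> i; exact: IH.
- by rewrite big_split /=; exact: lerD.
- by move=> h; rewrite PE QE -big_split; apply: eq_bigr => i _; rewrite scalerDr.
Qed.

Lemma hpoly_sum k (I : Type) (r : seq I) (S : pred I) (M : I -> R) (P : I -> CD R m -> CD R n) :
  (forall i, S i -> hpoly k (M i) (P i)) ->
  hpoly k (\sum_(i <- r | S i) M i) (fun h => \sum_(i <- r | S i) P i h).
Proof.
move=> HP; elim: r => [|i r IH].
  rewrite big_nil; apply: hpoly_ext (hpoly0 k) => h; by rewrite big_nil.
rewrite big_cons; case: ifP => Si.
  by apply: hpoly_ext (hpolyD (HP i Si) IH) => h; rewrite big_cons Si.
by apply: hpoly_ext IH => h; rewrite big_cons Si.
Qed.

Lemma hpoly_co k M P i : hpoly k M P -> hpoly k.+1 M (fun h => co h i *: P h).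
Proof.
move=> HP; exists (fun j => if j == i then P else fun=> 0), (fun j => if j == i then M else 0).
split; first by move=> j; case: eqP => _ //; exact: hpoly0.
  by rewrite -big_mkcond big_pred1_eq.
move=> h; rewrite (bigD1 i)//= eqxx big1 ?addr0// => j /negbTE ->.
by rewrite scaler0.
Qed.

Lemma hpoly_norm k M P h : hpoly k M P -> `|P h| <= M * `|h| ^+ k.
Proof.
elim: k M P => [|k IH] M P /=; first by move=> [c cM ->]; rewrite expr0 mulr1.
move=> [Q [K [HQ KM ->]]]; apply: (le_trans (ler_norm_sum _ _ _)).
apply: (@le_trans _ _ ((\sum_i K i) * `|h| ^+ k.+1)); last by rewrite ler_wpM2r// exprn_ge0.
rewrite mulr_suml; apply: ler_sum => i _; rewrite normrZ exprS mulrCA.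
by apply: ler_pM => //; [exact: co_norm|exact: IH].
Qed.

Lemma hpoly_lip k M P (r : R) h h' : hpoly k M P -> `|h| <= r -> `|h'| <= r ->
  r * `|P h - P h'| <= k%:R * M * r ^+ k * `|h - h'|.
Proof.
move=> HP hr h'r; have r0 : 0 <= r by exact: le_trans hr.
elim: k M P HP => [|k IH] M P /=.
  by move=> [c cM PE]; rewrite !PE subrr normr0 mulr0 !mul0r.
move=> [Q [K [HQ KM PE]]]; rewrite !PE -sumrB.
apply: (@le_trans _ _ (k.+1%:R * (\sum_i K i) * r ^+ k.+1 * `|h - h'|)); last first.
  rewrite ler_wpM2r// ler_wpM2r ?exprn_ge0// ler_wpM2l//.
rewrite mulr_sumr !mulr_suml.
apply: (@le_trans _ _ (\sum_i r * `|co h i *: Q i h - co h' i *: Q i h'|)).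
  by rewrite -mulr_sumr ler_wpM2l// ler_norm_sum.
apply: ler_sum => i _.
have -> : co h i *: Q i h - co h' i *: Q i h' =
    co (h - h') i *: Q i h + co h' i *: (Q i h - Q i h').
  by rewrite coD -[- h']scaleN1r coZ; vring.
have K0 : 0 <= K i by exact: hpoly_ge0 (HQ i).
have Qh : `|Q i h| <= K i * r ^+ k.
  apply: (le_trans (hpoly_norm _ (HQ i))).
  by rewrite ler_wpM2l// lerXn2r ?nnegrE.
apply: (@le_trans _ _ (r * (`|h - h'| * (K i * r ^+ k)) + r * (r * `|Q i h - Q i h'|))).
  rewrite -mulrDr ler_wpM2l//; apply: (le_trans (ler_normD _ _)).
  rewrite !normrZ; apply: lerD; first by apply: ler_pM => //; exact: co_norm.
  by rewrite ler_wpM2r//; apply: le_trans h'r; exact: co_norm.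
apply: (@le_trans _ _ (r * (`|h - h'| * (K i * r ^+ k)) + r * (k%:R * K i * r ^+ k * `|h - h'|))).
  by rewrite lerD2l ler_wpM2l//; exact: IH.
by rewrite le_eqVlt; apply/orP; left; apply/eqP; rewrite exprS -natr1; ring.
Qed.

End Fixed.

Lemma hpoly_linear m n p k M (P : CD R m -> CD R n) (L : CD R n -> CD R p) K : 0 <= K ->
  bounded_linear L K -> hpoly k M P -> hpoly k (K * M) (fun h => L (P h)).
Proof.
move=> K0 LK; have [_ LZ Ln] := LK; elim: k M P => [|k IH] M P /=.
  move=> [c cM PE]; exists (L c); last by move=> h; rewrite PE.
  by apply: (le_trans (Ln c)); rewrite ler_wpM2l.
move=> [Q [N [HQ NM PE]]]; exists (fun i h => L (Q i h)), (fun i => K * N i); split.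
- by move=> i; exact: IH.
- by rewrite -mulr_sumr ler_wpM2l.
- move=> h; rewrite PE (bounded_linear_sum _ _ LK); apply: eq_bigr => i _.
  by rewrite LZ.
Qed.

Lemma hpoly_bilinear m n p q k l M N (P : CD R m -> CD R n) (Q : CD R m -> CD R p)
    (B : CD R n -> CD R p -> CD R q) K : 0 <= K -> bounded_bilinear B K ->
  hpoly k M P -> hpoly l N Q -> hpoly (k + l) (K * M * N) (fun h => B (P h) (Q h)).
Proof.
move=> K0 BK HP HQ; have N0 := hpoly_ge0 HQ; elim: k M P HP => [|k IH] M P /=.
  move=> [c cM PE]; have M0 : 0 <= M by exact: le_trans cM.
  have : hpoly l (K * `|c| * N) (fun h => B c (Q h)).
    apply: hpoly_linear HQ; first by rewrite mulr_ge0.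
    exact: bilinear_right.
  move=> H; apply: (hpoly_le (M := K * `|c| * N)).
    by rewrite ler_wpM2r// ler_wpM2l.
  by apply: hpoly_ext H => h; rewrite PE.
move=> [P' [L [HP LM PE]]].
exists (fun i h => B (P' i h) (Q h)), (fun i => K * L i * N); split.
- by move=> i; exact: IH.
- by rewrite -mulr_suml -mulr_sumr ler_wpM2r// ler_wpM2l.
- move=> h; rewrite PE (bounded_linear_sum _ _ (bilinear_left (Q h) K0 BK)).
  by apply: eq_bigr => i _; case: BK => _ -> _ _ _.
Qed.

Lemma hpoly_id m : exists K : R, hpoly 1 K (@id (CD R m)).
Proof.
have [b H] := cd_basis (R := R) m; exists (\sum_(i < 2 ^ m) `|b i|).
exists (fun i _ => b i), (fun i => `|b i|); split=> //.
by move=> i; exists (b i).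
Qed.

End HomogeneousPolynomials.

(** * Geometric bounds and interchange of summations *)

Section GeometricSeries.
Context {R : realType}.

Lemma geo_sum_le (y : R) a K : 0 <= y -> y <= 2^-1 ->
  \sum_(a <= k < K) y ^+ k <= 2 * y ^+ a.
Proof.
move=> y0 y2; case: (leqP a K) => [aK|Ka]; last first.
  by rewrite big_geq ?(ltnW Ka)// mulr_ge0// exprn_ge0.
rewrite -(subnK aK) addnC; move: (K - a)%N => d {aK K}.
elim: d a => [|d IH] a.
  by rewrite addn0 big_geq// mulr_ge0// exprn_ge0.
rewrite big_ltn ?addnS ?ltnS ?leq_addr// -addSn.
have := IH a.+1; have ya : 0 <= y ^+ a by exact: exprn_ge0.
have : y ^+ a.+1 <= 2^-1 * y ^+ a by rewrite exprS ler_wpM2r.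
lra.
Qed.

Lemma cvg_norm_le n (u : nat -> CD R n) (l : CD R n) (B : R) :
  u @ \oo --> l -> (forall k, `|u k| <= B) -> `|l| <= B.
Proof.
move=> ul uB; have nl : (fun k => `|u k|) @ \oo --> `|l| by exact: cvg_norm.
rewrite -(cvg_lim _ nl)//; apply: limr_le; [by apply/cvg_ex; exists `|l| | by near=> k].
Unshelve. all: by end_near.
Qed.

Lemma cvg_geo_close n (s t : nat -> CD R n) (l : CD R n) (C y : R) : 0 <= y -> y <= 2^-1 ->
  (forall k, `|t k - s k| <= C * y ^+ k) -> s @ \oo --> l -> t @ \oo --> l.
Proof.
move=> y0 y2 ts sl.
have h : (fun k => t k - s k) @ \oo --> (0 : CD R n).
  apply/norm_cvg0P.
  apply: (@squeeze_cvgr _ _ _ _ (fun=> 0) (fun k => C * y ^+ k)).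
  - by near=> k; rewrite normr_ge0 ts.
  - exact: cvg_cst.
  - rewrite -[X in _ --> X](mulr0 C); apply: cvgM; first exact: cvg_cst.
    by apply: cvg_expr; rewrite ger0_norm//; lra.
have -> : t = (fun k => (t k - s k) + s k) by apply/funext => k; rewrite subrK.
by rewrite -(add0r l); apply: cvgD.
Unshelve. all: by end_near.
Qed.

(** Completeness is reached by splitting into halves down to the real line. *)
Lemma geo_series_cvg n (u : nat -> CD R n) (C y : R) : 0 <= y -> y <= 2^-1 ->
  (forall k, `|u k| <= C * y ^+ k) -> exists l : CD R n, series u @ \oo --> l.
Proof.
move=> y0 y2; elim: n u => [|n IH] u uB.
  suff /cvg_ex[l ul] : cvgn (series u) by exists l.
  apply: (@normed_cvg _ R^o); apply: (@series_le_cvg _ _ (geometric C y)) => //.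
  - by move=> k; rewrite /= normr_ge0.
  - by move=> k; exact: le_trans (uB k).
  - by apply: is_cvg_geometric_series; rewrite ger0_norm//; lra.
have [l1 h1] : exists l : CD R n, series (fun k => (u k).1 : CD R n) @ \oo --> l.
  by apply: IH => k; apply: le_trans (uB k); rewrite (cd_norm_pair (u k)) le_max lexx.
have [l2 h2] : exists l : CD R n, series (fun k => (u k).2 : CD R n) @ \oo --> l.
  by apply: IH => k; apply: le_trans (uB k); rewrite (cd_norm_pair (u k)) le_max lexx orbT.
exists ((l1, l2) : CD R n.+1); apply/cvg_cdpair; split => /=.
  have -> : (fun t => (series u t).1 : CD R n) = series (fun k => (u k).1 : CD R n) => //.
  by apply/funext => t; rewrite /series /=; apply: (big_morph (fun x : CD R n.+1 => x.1 : CD R n)).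
have -> : (fun t => (series u t).2 : CD R n) = series (fun k => (u k).2 : CD R n) => //.
by apply/funext => t; rewrite /series /=; apply: (big_morph (fun x : CD R n.+1 => x.2 : CD R n)).
Qed.

Lemma geo_tail n (u : nat -> CD R n) (l : CD R n) (C y : R) K : 0 <= C -> 0 <= y -> y <= 2^-1 ->
  (forall k, `|u k| <= C * y ^+ k) -> series u @ \oo --> l ->
  `|l - series u K| <= 2 * C * y ^+ K.
Proof.
move=> C0 y0 y2 uB ul.
have sh : (fun k => series u (k + K)%N - series u K) @ \oo --> l - series u K.
  by apply: cvgB; [rewrite -(cvg_shiftn K) in ul|exact: cvg_cst].
apply: (cvg_norm_le sh) => k.
rewrite /series /= (@big_cat_nat _ _ _ K)//= ?leq_addl// addrAC subrr add0r.
apply: (le_trans (ler_norm_sum _ _ _)).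
apply: (@le_trans _ _ (\sum_(K <= i < k + K) C * y ^+ i)).
  by apply: ler_sum => i _; exact: uB.
by rewrite -mulr_sumr (mulrC 2) -mulrA ler_wpM2l// geo_sum_le.
Qed.

(** As [r j k] vanishes for [k < j], a triangular partial sum equals a square one. Replacing each of
    its rows by the limit costs [2 C y^j y^K], which sums to at most [4 C y^K]. *)
Lemma double_series n (r : nat -> nat -> CD R n) (s : nat -> CD R n) (l : CD R n) (C y : R) :
  0 <= C -> 0 <= y -> y <= 2^-1 -> (forall j k, (k < j)%N -> r j k = 0) ->
  (forall j k, `|r j k| <= C * y ^+ j * y ^+ k) ->
  (forall j, series (r j) @ \oo --> s j) -> series s @ \oo --> l ->
  series (fun k => \sum_(j < k.+1) r j k) @ \oo --> l.
Proof.
move=> C0 y0 y2 r0 rB rs sl; apply: (cvg_geo_close (C := 4 * C) y0 y2) sl => K.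
have -> : series (fun k => \sum_(j < k.+1) r j k) K = \sum_(0 <= j < K) series (r j) K.
  rewrite /series /= exchange_big /=; apply: eq_big_nat => k /andP[_ kK].
  rewrite -(big_mkord xpredT (fun j => r j k)) [RHS](@big_cat_nat _ _ _ k.+1)//=.
  rewrite [X in _ = _ + X]big_nat_cond [X in _ = _ + X]big1 ?addr0// => j /andP[/andP[kj _] _].
  exact: r0.
rewrite /series /= -sumrB; apply: (le_trans (ler_norm_sum _ _ _)).
apply: (@le_trans _ _ (\sum_(0 <= j < K) 2 * C * y ^+ K * y ^+ j)).
  apply: ler_sum => j _; rewrite distrC mulrAC -(mulrA 2 C).
  by apply: geo_tail => //; rewrite mulr_ge0// exprn_ge0.
rewrite -mulr_sumr.
apply: (@le_trans _ _ (2 * C * y ^+ K * 2)).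
  rewrite ler_wpM2l ?mulr_ge0 ?exprn_ge0//.
  by have := geo_sum_le 0 K y0 y2; rewrite expr0 mulr1.
by rewrite le_eqVlt; apply/orP; left; apply/eqP; ring.
Qed.

End GeometricSeries.

Section CauchyProduct.
Context {R : realType}.

Lemma bounded_linear0 n p (L : CD R n -> CD R p) K : bounded_linear L K -> L 0 = 0.
Proof. by move=> LK; rewrite -(subrr (0 : CD R n)) (bounded_linearB _ _ LK) subrr. Qed.

Lemma cvg_bounded_linear n p (L : CD R n -> CD R p) K {T} {F : set_system T} {FF : Filter F}
    (u : T -> CD R n) (l : CD R n) :
  bounded_linear L K -> u @ F --> l -> (fun t => L (u t)) @ F --> L l.
Proof.
move=> LK ul; have [_ _ Ln] := LK.
have h : (fun t => L (u t) - L l) @ F --> (0 : CD R p).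
  apply/norm_cvg0P; apply: (@squeeze_cvgr _ _ _ _ (fun=> 0) (fun t => K * `|u t - l|)).
  - by near=> t; rewrite normr_ge0 -(bounded_linearB _ _ LK) Ln.
  - exact: cvg_cst.
  - rewrite -[X in _ --> X](mulr0 K); apply: cvgM; first exact: cvg_cst.
    rewrite -(normr0 (CD R n)); apply: cvg_norm; rewrite -(subrr l).
    by apply: cvgB => //; exact: cvg_cst.
have -> : (fun t => L (u t)) = (fun t => (L (u t) - L l) + L l).
  by apply/funext => t; rewrite subrK.
by rewrite -[X in _ --> X](add0r (L l)); apply: cvgD => //; exact: cvg_cst.
Unshelve. all: by end_near.
Qed.

Lemma cvg_shifted n (u : nat -> CD R n) (l : CD R n) j :
  u @ \oo --> l -> (fun k => u (k - j)%N) @ \oo --> l.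
Proof. by rewrite cvg_centern. Qed.

(** The hypotheses bound the terms by powers of [y ^+ 2] because [y^(2k) <= y^j y^k] for [j <= k]:
    half of the decay is spent on the outer index, as [double_series] requires. *)
Lemma cauchy_product n p q (B : CD R n -> CD R p -> CD R q) K u v U V (C1 C2 y : R) :
  0 <= K -> bounded_bilinear B K -> 0 <= C1 -> 0 <= C2 -> 0 <= y -> y <= 2^-1 ->
  (forall k, `|u k| <= C1 * (y ^+ 2) ^+ k) -> (forall k, `|v k| <= C2 * (y ^+ 2) ^+ k) ->
  series u @ \oo --> U -> series v @ \oo --> V ->
  series (fun k => \sum_(j < k.+1) B (u j) (v (k - j)%N)) @ \oo --> B U V.
Proof.
move=> K0 BK C10 C20 y0 y2 uB vB uU vV; have [_ _ _ _ Bn] := BK.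
pose r j k := if (j <= k)%N then B (u j) (v (k - j)%N) else 0.
have -> : (fun k => \sum_(j < k.+1) B (u j) (v (k - j)%N)) = (fun k => \sum_(j < k.+1) r j k).
  by apply/funext => k; apply: eq_bigr => j _; rewrite /r -ltnS ltn_ord.
apply: (@double_series _ _ _ (fun j => B (u j) V) _ (K * C1 * C2) y) => //.
- by rewrite !mulr_ge0.
- by move=> j k kj; rewrite /r leqNgt kj.
- move=> j k; rewrite /r; case: ifP => [jk|_]; last first.
    by rewrite normr0 !mulr_ge0 ?exprn_ge0.
  apply: (le_trans (Bn _ _)).
  apply: (@le_trans _ _ (K * (C1 * (y ^+ 2) ^+ j) * (C2 * (y ^+ 2) ^+ (k - j)))).
    by apply: ler_pM => //; [rewrite mulr_ge0|rewrite ler_wpM2l].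
  have -> : K * (C1 * (y ^+ 2) ^+ j) * (C2 * (y ^+ 2) ^+ (k - j)) =
      K * C1 * C2 * (y ^+ 2) ^+ k.
    by rewrite -{2}(subnKC jk) exprD; ring.
  rewrite -[leRHS]mulrA ler_wpM2l ?mulr_ge0// exprAC expr2 ler_wpM2r ?exprn_ge0//.
  by apply: ler_wiXn2l => //; lra.
- move=> j; have -> : series (r j) = (fun k => B (u j) (series v (k - j)%N)).
    apply/funext; elim=> [|k IH].
      by rewrite /series /= sub0n !big_geq// (bounded_linear0 (bilinear_right (u j) K0 BK)).
    rewrite seriesSr IH /r; case: leqP => jk.
      by rewrite subSn// seriesSr; case: BK => _ _ -> _ _.
    have e1 : (k.+1 - j = 0)%N by apply/eqP; rewrite subn_eq0.
    have e2 : (k - j = 0)%N by apply/eqP; rewrite subn_eq0 ltnW.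
    by rewrite addr0 e1 e2.
  exact: (cvg_bounded_linear (bilinear_right (u j) K0 BK) (cvg_shifted j vV)).
have -> : series (fun j => B (u j) V) = (fun k => B (series u k) V).
  by apply/funext => k; rewrite /series /= (bounded_linear_sum _ _ (bilinear_left V K0 BK)).
exact: (cvg_bounded_linear (bilinear_left V K0 BK) uU).
Qed.

End CauchyProduct.

(** * Germs of analytic maps: sums, products, composition *)

Section AnalyticGerms.
Context {R : realType}.

(** Equivalent to [real_analytic_at]. The growth rate [r] of the homogeneous parts and the radius
    [d] of validity are independent, so either may be worsened alone. *)
Definition an m n (f : CD R m -> CD R n) (a : CD R m) :=
  exists (P : nat -> CD R m -> CD R n) (C r d : R),
    [/\ [/\ 0 <= C, 0 < r & 0 < d], forall k, hpoly k (C * r ^+ k) (P k) &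
        forall h, `|h| < d -> series (P^~ h) @ \oo --> f (a + h)].

(** The [k + 1] summands of a Cauchy product are absorbed by doubling the growth rate. *)
Lemma expn2_ge k : k.+1%:R <= 2 ^+ k :> R.
Proof. by rewrite -natrX ler_nat ltn_expl. Qed.

Lemma an_near m n (f g : CD R m -> CD R n) a :
  (\forall x \near a, f x = g x) -> an f a -> an g a.
Proof.
move=> /nbhs_ballP[e e0 fg] [P [C [r [d [[C0 r0 d0] HP PE]]]]].
exists P, C, r, (Num.min d e); split=> //; first by rewrite lt_min d0.
move=> h; rewrite lt_min => /andP[hd he]; rewrite -fg; first exact: PE.
by rewrite -ball_normE /= opprD addrA subrr sub0r normrN.
Qed.

Lemma an_cst m n (c : CD R n) (a : CD R m) : an (fun=> c) a.
Proof.
exists (fun k => if k is 0 then fun=> c else fun=> 0), `|c|, 1, 1; split=> //.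
  move=> [|k]; first by exists c => //; rewrite expr0 mulr1.
  apply: (hpoly_le (M := 0)); last exact: hpoly0.
  by rewrite mulr_ge0// exprn_ge0.
move=> h _; apply: (@cvg_near_eq _ _ _ _ _ (fun=> c)); last exact: cvg_cst.
near=> k; have k0 : (0 < k)%N by near: k; exact: nbhs_infty_gt.
rewrite /series /= big_ltn// big_nat_cond big1 ?addr0// => -[|i]//.
Unshelve. all: by end_near.
Qed.

Lemma an_id m (a : CD R m) : an id a.
Proof.
have [K HK] := hpoly_id (R := R) m; have K0 := hpoly_ge0 HK.
exists (fun k => if k is 0 then fun=> a else if k is 1 then id else fun=> 0), (K + `|a|), 1, 1.
split=> //; first by split=> //; exact: addr_ge0.
  move=> [|[|k]]; rewrite expr1n mulr1.
  - by exists a => //; rewrite lerDr.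
  - by apply: hpoly_le HK; rewrite lerDl.
  - by apply: hpoly_le (hpoly0 _); rewrite addr_ge0.
move=> h _; apply: (@cvg_near_eq _ _ _ _ _ (fun=> a + h)); last exact: cvg_cst.
near=> k; have k0 : (1 < k)%N by near: k; exact: nbhs_infty_gt.
rewrite /series /= big_ltn 1?ltnW// big_ltn// big_nat_cond big1 ?addr0// => -[|[|i]]//.
Unshelve. all: by end_near.
Qed.

Lemma an_linear m n p (L : CD R n -> CD R p) K (f : CD R m -> CD R n) a : 0 <= K ->
  bounded_linear L K -> an f a -> an (fun x => L (f x)) a.
Proof.
move=> K0 LK [P [C [r [d [[C0 r0 d0] HP PE]]]]].
exists (fun k h => L (P k h)), (K * C), r, d; split.
- by split=> //; exact: mulr_ge0.
- by move=> k; rewrite -mulrA; exact: (hpoly_linear K0 LK).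
move=> h hd; have -> : series (fun k => L (P k h)) = (fun k => L (series (P^~ h) k)).
  by apply/funext => k; rewrite /series /= (bounded_linear_sum _ _ LK).
by apply: (cvg_bounded_linear LK); exact: PE.
Qed.

Lemma anD m n (f g : CD R m -> CD R n) a : an f a -> an g a -> an (fun x => f x + g x) a.
Proof.
move=> [P [C [r [d [[C0 r0 d0] HP PE]]]]] [Q [C' [r' [d' [[C0' r0' d0'] HQ QE]]]]].
exists (fun k h => P k h + Q k h), (C + C'), (r + r'), (Num.min d d'); split.
- by rewrite lt_min d0 d0' addr_ge0// addr_gt0.
- move=> k; apply: hpoly_le (hpolyD (HP k) (HQ k)).
  rewrite mulrDl; apply: lerD; rewrite ler_wpM2l// lerXn2r ?nnegrE ?addr_ge0 ?ltW//.
    by rewrite ltrDl.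
  by rewrite ltrDr.
move=> h; rewrite lt_min => /andP[hd hd'].
have -> : series (fun k => P k h + Q k h) = (fun k => series (P^~ h) k + series (Q^~ h) k).
  by apply/funext => k; rewrite /series /= big_split.
by apply: cvgD; [exact: PE|exact: QE].
Qed.

Lemma an_bilinear m n p q (B : CD R n -> CD R p -> CD R q) K
    (f : CD R m -> CD R n) (g : CD R m -> CD R p) a : 0 <= K -> bounded_bilinear B K ->
  an f a -> an g a -> an (fun x => B (f x) (g x)) a.
Proof.
move=> K0 BK [P [C [r [d [[C0 r0 d0] HP PE]]]]] [Q [C' [r' [d' [[C0' r0' d0'] HQ QE]]]]].
pose s := r + r'; have s0 : 0 < s by exact: addr_gt0.
have {}HP k : hpoly k (C * s ^+ k) (P k).
  apply: hpoly_le (HP k); rewrite ler_wpM2l// lerXn2r ?nnegrE ?ltW//.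
  by rewrite ltrDl.
have {}HQ k : hpoly k (C' * s ^+ k) (Q k).
  apply: hpoly_le (HQ k); rewrite ler_wpM2l// lerXn2r ?nnegrE ?ltW//.
  by rewrite ltrDr.
(* The rate [2 * s] pays for the number of summands. The radius [(4 * s)^-1] makes
   [s |h| <= (1/2)^2], the ratio asked by [cauchy_product] with [y = 1/2]. *)
exists (fun k h => \sum_(j < k.+1) B (P j h) (Q (k - j)%N h)), (K * C * C'), (2 * s),
  (Num.min (Num.min d d') (4 * s)^-1).
split.
- by rewrite !mulr_ge0// mulr_gt0// !lt_min d0 d0' invr_gt0 mulr_gt0.
- move=> k; apply: (hpoly_le (M := \sum_(j < k.+1) K * (C * s ^+ j) * (C' * s ^+ (k - j)))).
    have -> : \sum_(j < k.+1) K * (C * s ^+ j) * (C' * s ^+ (k - j)) =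
        k.+1%:R * (K * C * C' * s ^+ k).
      rewrite mulr_natl -[X in _ *+ X]card_ord -sumr_const; apply: eq_bigr => j _.
      by rewrite -[X in _ = _ * s ^+ X](@subnKC j) -1?ltnS// exprD; ring.
    rewrite exprMn [leRHS]mulrCA; apply: ler_wpM2r; last exact: expn2_ge.
    by rewrite !mulr_ge0// exprn_ge0// ltW.
  apply: hpoly_sum => j _.
  have jk : (j <= k)%N by rewrite -ltnS.
  by rewrite -[X in hpoly X](subnKC jk); exact: hpoly_bilinear.
move=> h; rewrite !lt_min => /andP[/andP[hd hd'] hs].
have sh : s * `|h| <= 2^-1 ^+ 2.
  apply: (le_trans (ler_wpM2l (ltW s0) (ltW hs))).
  by rewrite le_eqVlt; apply/orP; left; apply/eqP; field; exact: lt0r_neq0.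
apply: (@cauchy_product _ _ _ _ B K (P^~ h) (Q^~ h) _ _ C C' 2^-1) => //.
- by move=> k; apply: (le_trans (hpoly_norm _ (HP k))); rewrite -mulrA ler_wpM2l// -exprMn
    lerXn2r ?nnegrE ?exprn_ge0 ?mulr_ge0// ltW.
- by move=> k; apply: (le_trans (hpoly_norm _ (HQ k))); rewrite -mulrA ler_wpM2l// -exprMn
    lerXn2r ?nnegrE ?exprn_ge0 ?mulr_ge0// ltW.
- exact: PE.
- exact: QE.
Qed.

End AnalyticGerms.

Section Composition.
Context {R : realType}.

Lemma cvg_bigsum n (I : Type) (r : seq I) (u : I -> nat -> CD R n) (l : I -> CD R n) :
  (forall i, u i @ \oo --> l i) -> (fun N => \sum_(i <- r) u i N) @ \oo --> \sum_(i <- r) l i.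
Proof.
move=> ul; elim: r => [|i r IH].
  by rewrite big_nil; under eq_fun do rewrite big_nil; exact: cvg_cst.
by rewrite big_cons; under eq_fun do rewrite big_cons; exact: cvgD.
Qed.

Lemma hpoly_at0 m n k M (P : CD R m -> CD R n) : hpoly k.+1 M P -> P 0 = 0.
Proof.
by move=> /(hpoly_norm 0); rewrite normr0 expr0n mulr0 normr_le0 => /eqP.
Qed.

Lemma series_cst0 n (u : nat -> CD R n) (l : CD R n) :
  (forall k, u k.+1 = 0) -> series u @ \oo --> l -> l = u 0.
Proof.
move=> u0 ul; apply: (cvg_unique _ ul); first exact: norm_hausdorff.
apply: (@cvg_near_eq _ _ _ _ _ (fun=> u 0)); last exact: cvg_cst.
near=> k; have k0 : (0 < k)%N by near: k; exact: nbhs_infty_gt.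
by rewrite /series /= big_ltn// big_nat_cond big1 ?addr0// => -[|i]//.
Unshelve. all: by end_near.
Qed.

(* The pullback of a homogeneous polynomial of degree j under a power series
   without constant term starts in degree j. *)
Lemma hpoly_subst m n p (y : 'I_(2 ^ n) -> nat -> CD R m -> CD R 0) (Y : CD R m -> CD R n)
    (C s d : R) : 0 <= C -> 0 < s -> 2 * s * d <= 2^-1 ^+ 2 ->
  (forall i k, hpoly k (C * s ^+ k) (y i k)) -> (forall i h, y i 0 h = 0) ->
  (forall i h, `|h| < d -> series ((y i)^~ h) @ \oo --> (co (Y h) i : CD R 0)) ->
  forall j M (Q : CD R n -> CD R p), hpoly j M Q ->
  exists q : nat -> CD R m -> CD R p,
    [/\ forall k, hpoly k (M * C ^+ j * (2 * s) ^+ k) (q k),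
        forall k h, (k < j)%N -> q k h = 0 &
        forall h, `|h| < d -> series (q^~ h) @ \oo --> Q (Y h)].
Proof.
move=> C0 s0 sd Hy y0 yY; have s20 : 0 <= 2 * s by rewrite mulr_ge0// ltW.
have small (h : CD R m) k : `|h| < d -> (2 * s) ^+ k * `|h| ^+ k <= (2^-1 ^+ 2) ^+ k.
  move=> hd; rewrite -exprMn; apply: lerXn2r;
    [by rewrite nnegrE mulr_ge0|by rewrite nnegrE exprn_ge0|].
  by apply: le_trans sd; rewrite ler_wpM2l// ltW.
elim=> [|j IH] M Q /=.
  move=> [c cM QE]; exists (fun k => if k is 0 then fun=> c else fun=> 0); split=> //.
    move=> [|k]; first by exists c => //; rewrite !expr0 !mulr1.
    apply: hpoly_le (hpoly0 _); rewrite !mulr_ge0 ?exprn_ge0//.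
    exact: le_trans cM.
  move=> h hd; rewrite QE; apply: (@cvg_near_eq _ _ _ _ _ (fun=> c)); last exact: cvg_cst.
  near=> k; have k0 : (0 < k)%N by near: k; exact: nbhs_infty_gt.
  by rewrite /series /= big_ltn// big_nat_cond big1 ?addr0// => -[|i]//.
move=> [Q' [K [HQ KM QE]]].
have /choice[q Hq] : forall i, exists q : nat -> CD R m -> CD R p,
    [/\ forall k, hpoly k (K i * C ^+ j * (2 * s) ^+ k) (q k),
        forall k h, (k < j)%N -> q k h = 0 &
        forall h, `|h| < d -> series (q^~ h) @ \oo --> Q' i (Y h)].
  by move=> i; apply: IH.
exists (fun k h => \sum_i \sum_(a < k.+1) cdscale (y i a h) (q i (k - a)%N h)); split.
- move=> k; apply: (hpoly_le (M := \sum_i (K i * C ^+ j.+1 * (2 * s) ^+ k))).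
    rewrite -!mulr_suml ler_wpM2r ?exprn_ge0// ler_wpM2r ?exprn_ge0//.
  apply: hpoly_sum => i _; have K0 := hpoly_ge0 (HQ i); have [Hk _ _] := Hq i.
  (* The term [a = 0] is zero since the substituted series have no constant term. The rate [2 * s]
     leaves weights [2^-a] on the others, whose sum over [a >= 1] is at most 1, so the bound is
     uniform in [k]. *)
  apply: (hpoly_le (M := \sum_(a < k.+1) if a == 0 :> nat then 0 else
      1 * (C * s ^+ a) * (K i * C ^+ j * (2 * s) ^+ (k - a)))).
    have -> : \sum_(a < k.+1) (if a == 0 :> nat then 0 else
        1 * (C * s ^+ a) * (K i * C ^+ j * (2 * s) ^+ (k - a))) =
        (K i * C ^+ j.+1 * (2 * s) ^+ k) * \sum_(1 <= a < k.+1) 2^-1 ^+ a.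
      rewrite -(big_mkord xpredT (fun a => if a == 0%N then 0 else
        1 * (C * s ^+ a) * (K i * C ^+ j * (2 * s) ^+ (k - a)))).
      rewrite big_ltn// eqxx add0r mulr_sumr; apply: eq_big_nat => a /andP[a0 ak].
      have -> : (2 * s) ^+ k = (2 * s) ^+ a * (2 * s) ^+ (k - a).
        by rewrite -exprD subnKC.
      rewrite gtn_eqF// [(2 * s) ^+ a]exprMn exprVn exprS; field.
      by rewrite expf_neq0.
    rewrite -[leRHS]mulr1 ler_wpM2l ?mulr_ge0 ?exprn_ge0//.
    have := geo_sum_le 1 k.+1 (_ : 0 <= 2^-1 :> R) (lexx _).
    by rewrite expr1 mulfV// => ->.
  apply: hpoly_sum => a _; case: eqP => a0.
    by apply: hpoly_ext (hpoly0 _) => h; rewrite a0 y0 /cdscale scale0r.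
  have ak : (a <= k)%N by rewrite -ltnS.
  rewrite -[X in hpoly X](subnKC ak); apply: hpoly_bilinear => //.
  exact: cdscale_bilinear.
- move=> k h kj; rewrite big1// => i _; rewrite big1// => a _.
  have [_ q0 _] := Hq i; have [a0|a0] := eqVneq (nat_of_ord a) 0%N.
    by rewrite a0 y0 /cdscale scale0r.
  have ak : (a <= k)%N by rewrite -ltnS.
  rewrite q0 ?/cdscale ?scaler0// ltn_subLR//.
  by apply: leq_trans kj _; rewrite -add1n leq_add2r lt0n.
- move=> h hd; rewrite QE.
  have -> : series (fun k => \sum_i \sum_(a < k.+1) cdscale (y i a h) (q i (k - a)%N h)) =
    (fun N => \sum_i series (fun k => \sum_(a < k.+1) cdscale (y i a h) (q i (k - a)%N h)) N).
    by apply/funext => N; rewrite /series /= exchange_big.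
  apply: cvg_bigsum => i; have [Hk _ qY] := Hq i; have K0 := hpoly_ge0 (HQ i).
  apply: (@cauchy_product _ _ _ _ (@cdscale R p) 1 ((y i)^~ h) ((q i)^~ h) _ _
    C (K i * C ^+ j) 2^-1) => //.
  - exact: cdscale_bilinear.
  - by rewrite mulr_ge0// exprn_ge0.
  - move=> k; apply: (le_trans (hpoly_norm _ (Hy i k))); rewrite -mulrA ler_wpM2l//.
    apply: le_trans (small h k hd); apply: ler_wpM2r; first exact: exprn_ge0.
    by apply: lerXn2r; rewrite ?nnegrE ?(ltW s0)//; lra.
  - move=> k; apply: (le_trans (hpoly_norm _ (Hk k))); rewrite -mulrA ler_wpM2l//.
      by rewrite mulr_ge0// exprn_ge0.
    exact: small.
  - exact: yY.
  - exact: qY.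
Unshelve. all: by end_near.
Qed.

End Composition.

Section AnalyticComposition.
Context {R : realType}.

Lemma co_linear n i : bounded_linear (fun x : CD R n => co x i : CD R 0) 1.
Proof.
split; [by move=> x y; exact: coD|by move=> x y; exact: coZ|].
by move=> x; rewrite mul1r; exact: co_norm.
Qed.

Lemma an_center m n (P : nat -> CD R m -> CD R n) (C r d : R) (f : CD R m -> CD R n) a :
  0 < d -> (forall k, hpoly k (C * r ^+ k) (P k)) ->
  (forall h, `|h| < d -> series (P^~ h) @ \oo --> f (a + h)) ->
  forall h, P 0 h = f a.
Proof.
move=> d0 HP PE h; have [c _ Pc] := HP 0; rewrite Pc -(Pc 0); apply/esym.
have := PE 0; rewrite normr0 addr0 => /(_ d0); apply: series_cst0 => k.
exact: hpoly_at0 (HP k.+1).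
Qed.

Lemma an_comp m n p (f : CD R n -> CD R p) (g : CD R m -> CD R n) a :
  an g a -> an f (g a) -> an (fun x => f (g x)) a.
Proof.
move=> [G [C1 [s [d1 [[C10 s0 d10] HG GE]]]]] [Q [Cf [t [df [[Cf0 t0 df0] HQ QE]]]]].
have G0 := an_center d10 HG GE.
(* The coordinates of the increment of [g]: its expansion without the constant term, as
   [hpoly_subst] demands. *)
pose y (i : 'I_(2 ^ n)) k (h : CD R m) : CD R 0 := if k is 0 then 0 else co (G k h) i.
pose Y h := g (a + h) - g a.
pose d2 := Num.min d1 (8 * s)^-1.
have d20 : 0 < d2 by rewrite lt_min d10 invr_gt0 mulr_gt0.
have sd2 : s * d2 <= 8^-1.
  apply: (@le_trans _ _ (s * (8 * s)^-1));
    first by apply: ler_wpM2l; [exact: ltW|rewrite /d2 ge_min lexx orbT].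
  by rewrite le_eqVlt; apply/orP; left; apply/eqP; field; exact: lt0r_neq0.
have d2d1 : d2 <= d1 by rewrite /d2 ge_min lexx.
clearbody d2.
have d2sd : 2 * s * d2 <= 2^-1 ^+ 2 by rewrite expr2; lra.
have Hy i k : hpoly k (C1 * s ^+ k) (y i k).
  case: k => [|k].
    by apply: hpoly_le (hpoly0 0); rewrite mulr_ge0// exprn_ge0// ltW.
  by rewrite -[_ * _]mul1r; exact: (hpoly_linear ler01 (co_linear i) (HG k.+1)).
have y0 i h : y i 0 h = 0 by [].
have yY i h : `|h| < d2 -> series ((y i)^~ h) @ \oo --> (co (Y h) i : CD R 0).
  move=> /lt_le_trans/(_ d2d1) hd1.
  have H : (fun N => co (series (G^~ h) N - g a) i : CD R 0) @ \oo --> (co (Y h) i : CD R 0).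
    apply: (cvg_bounded_linear (co_linear i)); apply: cvgB; first exact: GE.
    exact: cvg_cst.
  refine (cvg_near_eq _ H); near=> N; have N0 : (0 < N)%N by near: N; exact: nbhs_infty_gt.
  rewrite /series /= big_ltn// [in RHS]big_ltn// G0 add0r addrAC subrr add0r.
  rewrite (bounded_linear_sum _ _ (co_linear i)); apply: eq_big_nat => k /andP[k0 _].
  by rewrite /y; case: k k0.
have Hsub := hpoly_subst C10 s0 d2sd Hy y0 yY.
have /choice[q Hq] : forall j, exists q : nat -> CD R m -> CD R p,
    [/\ forall k, hpoly k (Cf * t ^+ j * C1 ^+ j * (2 * s) ^+ k) (q k),
        forall k h, (k < j)%N -> q k h = 0 &
        forall h, `|h| < d2 -> series (q^~ h) @ \oo --> Q j (Y h)].
  by move=> j; apply: Hsub.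
(* The j-th pullback has size [Cf th^j (2 s)^k] and starts in degree [j], so [th^j] may be traded
   for [(1 + th)^k] even when [th] exceeds 1. *)
pose th := t * C1; have th0 : 0 <= th by rewrite mulr_ge0// ltW.
have th1 : 0 < 1 + th by rewrite ltr_pwDl.
have thP j k : (j <= k)%N -> th ^+ j <= (1 + th) ^+ k.
  move=> jk; apply: (@le_trans _ _ ((1 + th) ^+ j)).
    by apply: lerXn2r; rewrite ?nnegrE ?(ltW th1)// lerDr.
  by apply: ler_weXn2l => //; rewrite lerDl.
(* The rate contains a factor 2 for the number of summands. Of the radii, [(8 * s * (1 + th))^-1]
   brings the ratio [(1 + th) * (2 * s * |h|)] down to 1/4, and [df / (2 * C1 * s + 1)] keeps the
   increment of [g] within the radius of [f]. *)
exists (fun k h => \sum_(j < k.+1) q j k h), Cf, (4 * s * (1 + th)),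
  (Num.min d2 (Num.min (8 * s * (1 + th))^-1 (df / (2 * C1 * s + 1)))).
split.
- split=> //; first by rewrite !mulr_gt0.
  rewrite !lt_min d20 invr_gt0 andTb; apply/andP; split; first by rewrite !mulr_gt0.
  by apply: divr_gt0 => //; rewrite ltr_wpDl// !mulr_ge0// ltW.
- move=> k; apply: (hpoly_le (M := \sum_(j < k.+1) Cf * t ^+ j * C1 ^+ j * (2 * s) ^+ k)); last first.
    by apply: hpoly_sum => j _; have [] := Hq j.
  apply: (@le_trans _ _ (\sum_(j < k.+1) Cf * ((1 + th) ^+ k * (2 * s) ^+ k))).
    apply: ler_sum => j _; rewrite -!mulrA ler_wpM2l// mulrA -exprMn ler_wpM2r ?exprn_ge0//.
      by rewrite mulr_ge0// ltW.
    by rewrite -/th thP// -ltnS.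
  rewrite sumr_const card_ord -[leLHS]mulr_natl [leLHS]mulrCA ler_wpM2l//.
  have -> : (4 * s * (1 + th)) ^+ k = 2 ^+ k * ((1 + th) ^+ k * (2 * s) ^+ k).
    by rewrite -!exprMn; congr (_ ^+ _); ring.
  apply: ler_wpM2r; last exact: expn2_ge.
  by rewrite mulr_ge0// exprn_ge0// ?mulr_ge0// ltW.
move=> h; rewrite !lt_min => /and3P[hd2 hx hdf].
have hs : s * `|h| <= 8^-1.
  by apply: le_trans sd2; rewrite ler_wpM2l// ltW.
have Yh : `|Y h| < df.
  have hd1 := lt_le_trans hd2 d2d1.
  have := @geo_tail _ _ (G^~ h) (g (a + h)) C1 (s * `|h|) 1 C10 _ _ _ (GE _ hd1).
  rewrite mulr_ge0 ?(ltW s0)// => /(_ isT) H.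
  have {}H : `|Y h| <= 2 * C1 * (s * `|h|).
    rewrite /Y -(G0 h); have : series (G^~ h) 1 = G 0 h by rewrite /series /= big_nat1.
    move=> <-; rewrite -[X in _ <= _ * X]expr1; apply: H; first lra.
    move=> k; apply: (le_trans (hpoly_norm _ (HG k))).
    by rewrite -mulrA -exprMn.
  apply: (le_lt_trans H); move: hdf; rewrite ltr_pdivlMr; last first.
    by rewrite ltr_wpDl// !mulr_ge0// ltW.
  apply: le_lt_trans; rewrite mulrDr mulr1.
  have -> : 2 * C1 * (s * `|h|) = `|h| * (2 * C1 * s) by ring.
  by rewrite lerDl.
have xh : 2 * s * `|h| <= (2^-1 ^+ 2) / (1 + th).
  apply: (@le_trans _ _ (2 * s * (8 * s * (1 + th))^-1)).
    by rewrite ler_wpM2l ?ltW// mulr_gt0.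
  rewrite le_eqVlt; apply/orP; left; apply/eqP; field.
  by rewrite !lt0r_neq0.
apply: (@double_series _ _ (fun j k => q j k h) (fun j => Q j (Y h)) _ Cf 2^-1) => //.
- by move=> j k kj; have [_ -> //] := Hq j.
- move=> j k; have [jk|kj] := leqP j k; last first.
    have [_ -> // _] := Hq j; by rewrite normr0 !mulr_ge0 ?exprn_ge0.
  have [Hk _ _] := Hq j; apply: (le_trans (hpoly_norm _ (Hk k))).
  rewrite -(mulrA Cf) -exprMn -/th -!mulrA ler_wpM2l// -exprMn.
  apply: (@le_trans _ _ ((1 + th) ^+ k * (2^-1 ^+ 2 / (1 + th)) ^+ k)).
    apply: ler_pM; rewrite ?exprn_ge0 ?mulr_ge0 ?(ltW s0) ?(ltW t0) ?thP//.
    by apply: lerXn2r; rewrite ?nnegrE ?mulr_ge0 ?(ltW s0) ?invr_ge0 ?(ltW th1)// mulrA.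
  rewrite -exprMn mulrC mulfVK ?lt0r_neq0// exprAC expr2 ler_wpM2r ?exprn_ge0//.
  by apply: ler_wiXn2l => //; lra.
- by move=> j; have [_ _ H] := Hq j; exact: H.
- have -> : f (g (a + h)) = f (g a + Y h) by rewrite /Y [in RHS]addrC subrK.
  exact: QE.
Unshelve. all: by end_near.
Qed.

End AnalyticComposition.

(** * Lipschitz bounds; the inverse and the square root *)

Section AnalyticFunctions.
Context {R : realType}.

Lemma an_lip m n (f : CD R m -> CD R n) a : an f a ->
  exists d K : R, 0 < d /\ forall x y, `|x - a| < d -> `|y - a| < d ->
    `|f x - f y| <= K * `|x - y|.
Proof.
move=> [P [C [r [d [[C0 r0 d0] HP PE]]]]].
(* With [r * s <= 1/4], the factor [k] from [hpoly_lip] is absorbed by [2 ^+ k] and the ratio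
   remains 1/2. *)
pose s := Num.min d (4 * r)^-1.
have s0 : 0 < s by rewrite lt_min d0 invr_gt0 mulr_gt0.
have sd : s <= d by rewrite ge_min lexx.
have rs : r * s <= 4^-1.
  apply: (@le_trans _ _ (r * (4 * r)^-1)).
    by apply: ler_wpM2l; [exact: ltW|rewrite /s ge_min lexx orbT].
  by rewrite le_eqVlt; apply/orP; left; apply/eqP; field; exact: lt0r_neq0.
clearbody s; exists s, (2 * C / s); split=> // x y xs ys.
have xE : series (P^~ (x - a)) @ \oo --> f x.
  by have := PE _ (lt_le_trans xs sd); rewrite [a + _]addrC subrK.
have yE : series (P^~ (y - a)) @ \oo --> f y.
  by have := PE _ (lt_le_trans ys sd); rewrite [a + _]addrC subrK.
apply: (cvg_norm_le (cvgB xE yE)) => N; rewrite fctE /series /= -sumrB.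
apply: (le_trans (ler_norm_sum _ _ _)).
rewrite mulrAC ler_pdivlMr// mulr_suml.
apply: (@le_trans _ _ (\sum_(0 <= k < N) (C * `|x - y|) * 2^-1 ^+ k)).
  apply: ler_sum => k _; rewrite mulrC.
  apply: (le_trans (hpoly_lip (HP k) (ltW xs) (ltW ys))).
  rewrite opprB addrA subrK.
  have -> : k%:R * (C * r ^+ k) * s ^+ k * `|x - y| = (C * `|x - y|) * (k%:R * (r * s) ^+ k).
    by rewrite exprMn; ring.
  rewrite ler_wpM2l ?mulr_ge0//.
  apply: (@le_trans _ _ (2 ^+ k * (4^-1) ^+ k)); last first.
    by rewrite -exprMn; have -> : 2 * 4^-1 = 2^-1 :> R by field.
  apply: ler_pM => //; first by rewrite exprn_ge0// mulr_ge0// ltW.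
    by apply: le_trans (expn2_ge k); rewrite ler_nat.
  by apply: lerXn2r; rewrite ?nnegrE// mulr_ge0// ltW.
rewrite -mulr_sumr mulrC -mulrA ler_wpM2r ?mulr_ge0//.
have := @geo_sum_le R 2^-1 0 N _ (lexx _); rewrite expr0 mulr1; apply.
by rewrite invr_ge0.
Qed.

Lemma an_continuous m n (f : CD R m -> CD R n) a : an f a -> {for a, continuous f}.
Proof.
move=> /an_lip[d [K [d0 H]]]; apply/cvgrPdist_lt => e e0 /=.
near=> x; have xa : `|x - a| < d.
  by near: x; apply/nbhs_ballP; exists d => //= x; rewrite -ball_normE /= distrC.
have aa : `|a - a| < d by rewrite subrr normr0.
apply: (le_lt_trans (H _ _ aa xa)).
have K1 : 0 < `|K| + 1 by rewrite ltr_wpDl.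
apply: (@le_lt_trans _ _ ((`|K| + 1) * `|a - x|)).
  by rewrite ler_wpM2r//; apply: (le_trans (ler_norm _)); rewrite lerDl.
rewrite mulrC -ltr_pdivlMr//.
near: x; apply/nbhs_ballP; exists (e / (`|K| + 1)); first by rewrite /= divr_gt0.
by move=> x; rewrite -ball_normE.
Unshelve. all: by end_near.
Qed.

Lemma an_power_series (f : CD R 0 -> CD R 0) (b : CD R 0) (c : nat -> R) (C r d : R) :
  0 <= C -> 0 < r -> 0 < d -> (forall k, `|c k| <= C * r ^+ k) ->
  (forall h : R, `|h| < d -> series (fun k => c k * h ^+ k) @ \oo --> (f (b + h) : R)) ->
  an f b.
Proof.
move=> C0 r0 d0 cB fE; exists (fun k h => c k * h ^+ k), C, r, d; split=> // k.
apply: (hpoly_le (cB k)); elim: k (c k) => [|k IH] x.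
  by exists x => // h; rewrite expr0 mulr1.
apply: hpoly_ext (@hpoly_co R 0 0 k _ _ (ord0 : 'I_1) (IH x)) => h.
by rewrite /co /= exprS /GRing.scale /= mulrCA.
Qed.

Lemma an_inv (b : CD R 0) : b != 0 -> an (fun x : CD R 0 => (x : R)^-1 : CD R 0) b.
Proof.
move=> b0; have nb : 0 < `|b : R| by rewrite normr_gt0.
apply: (@an_power_series _ _ (fun k => (b : R)^-1 * (- (b : R)^-1) ^+ k)
  `|(b : R)^-1| `|(b : R)^-1| `|b : R|) => //.
- by rewrite normr_gt0 invr_eq0.
- by move=> k; rewrite normrM normrX normrN.
move=> h hb; have -> : (fun k => (b : R)^-1 * (- (b : R)^-1) ^+ k * h ^+ k) =
    geometric (b : R)^-1 (- (b : R)^-1 * h).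
  by apply/funext => k; rewrite /geometric /= exprMn mulrA.
have q1 : `|- (b : R)^-1 * h| < 1.
  by rewrite normrM normrN normfV mulrC ltr_pdivrMr// mul1r.
have q0 : 1 - (- (b : R)^-1 * h) != 0.
  rewrite subr_eq0; apply/eqP => e; move: q1; rewrite -e normr1 ltxx//.
suff -> : (b + h)^-1 = (b : R)^-1 * (1 - (- (b : R)^-1 * h))^-1 :> R.
  exact: cvg_geometric_series.
rewrite -invfM; congr (_ ^-1).
by rewrite mulNr opprK mulrDr mulr1 mulrA mulfV// mul1r.
Qed.

(** The binomial coefficients of exponent 1/2. *)
Fixpoint sqrt_coef (k : nat) : R :=
  if k is k'.+1 then (2^-1 - k'%:R) / k'.+1%:R * sqrt_coef k' else 1.

Lemma sqrt_coef_le1 k : `|sqrt_coef k| <= 1.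
Proof.
elim: k => [|k IH] /=; first by rewrite normr1.
rewrite normrM mulr_ile1// normrM normfV normr_nat ler_pdivrMr// mul1r.
rewrite ler_norml -natr1; have : 0 <= k%:R :> R by []; move=> h.
by apply/andP; split; lra.
Qed.

(** The square P of the generating series satisfies [(1 + u) P' = P], that is
    [(l + 1) p(l + 1) = (1 - l) p(l)], as the symmetry j to l - j shows. The factor [1 - l] cuts the
    sequence off after degree 1. *)
Lemma sqrt_coef_square k : \sum_(j < k.+1) sqrt_coef j * sqrt_coef (k - j) =
  if (k <= 1)%N then 1 else 0.
Proof.
pose p k := \sum_(j < k.+1) sqrt_coef j * sqrt_coef (k - j).
have rec j : j.+1%:R * sqrt_coef j.+1 = (2^-1 - j%:R) * sqrt_coef j.
  by rewrite /= mulrA mulrCA divff ?mulr1// pnatr_eq0.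
have half l : \sum_(j < l.+1) (j%:R * (sqrt_coef j * sqrt_coef (l - j)) : R) =
    2^-1 * l%:R * p l.
  have sym : \sum_(j < l.+1) (j%:R * (sqrt_coef j * sqrt_coef (l - j)) : R) =
      \sum_(j < l.+1) ((l - j)%:R * (sqrt_coef j * sqrt_coef (l - j)) : R).
    rewrite (reindex_inj rev_ord_inj) /=; apply: eq_bigr => j _.
    by rewrite subSS subKn -1?ltnS// [sqrt_coef (l - j) * _]mulrC.
  have : \sum_(j < l.+1) (j%:R * (sqrt_coef j * sqrt_coef (l - j)) : R) +
      \sum_(j < l.+1) ((l - j)%:R * (sqrt_coef j * sqrt_coef (l - j)) : R) = l%:R * p l.
    rewrite -big_split /= mulr_sumr; apply: eq_bigr => j _.
    by rewrite -mulrDl -natrD subnKC// -ltnS.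
  rewrite -sym; lra.
have step l : l.+1%:R * p l.+1 = (1 - l%:R) * p l.
  have -> : l.+1%:R * p l.+1 =
      2 * \sum_(j < l.+2) (j%:R * (sqrt_coef j * sqrt_coef (l.+1 - j)) : R).
    by rewrite half; field.
  rewrite big_ord_recl /= mul0r add0r.
  transitivity (2 * \sum_(j < l.+1) (2^-1 * (sqrt_coef j * sqrt_coef (l - j)) -
      j%:R * (sqrt_coef j * sqrt_coef (l - j)))).
    congr (_ * _); apply: eq_bigr => j _; rewrite /bump /= add1n subSS mulrA rec.
    by ring.
  by rewrite sumrB -mulr_sumr half -/(p l); field.
have p0 : p 0%N = 1 by rewrite /p big_ord1 /= mulr1.
have p1 : p 1%N = 1 by have := step 0%N; rewrite p0 subr0 !mul1r.
have p2 l : p l.+2 = 0.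
  elim: l => [|l IH].
    by have /eqP := step 1%N; rewrite subrr mul0r mulf_eq0 pnatr_eq0 => /eqP.
  by have /eqP := step l.+2; rewrite IH mulr0 mulf_eq0 pnatr_eq0 => /eqP.
by case: k => [|[|k]]; [exact: p0|exact: p1|exact: p2].
Qed.

Lemma sqrt_series (u : R) : `|u| <= 4^-1 ->
  series (fun k => sqrt_coef k * u ^+ k) @ \oo --> (Num.sqrt (1 + u) : R).
Proof.
move=> u4; pose v k : CD R 0 := sqrt_coef k * u ^+ k.
have vB k : `|v k| <= 1 * (2^-1 ^+ 2) ^+ k.
  rewrite normrM mul1r normrX -[leRHS]mul1r; apply: ler_pM => //; first exact: sqrt_coef_le1.
  apply: lerXn2r; rewrite ?nnegrE//; apply: (le_trans u4).
  by rewrite le_eqVlt; apply/orP; left; apply/eqP; rewrite expr2; field.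
have h4 : 2^-1 ^+ 2 <= 2^-1 :> R by rewrite expr2; lra.
have h40 : 0 <= 2^-1 ^+ 2 :> R by rewrite exprn_ge0.
have [S vS] := geo_series_cvg h40 h4 vB.
have h2 : 0 <= 2^-1 :> R by rewrite invr_ge0.
have := cauchy_product ler01 (@cdscale_bilinear R 0) ler01 ler01 h2 (lexx _) vB vB vS vS.
have -> : (fun k => \sum_(j < k.+1) cdscale (v j) (v (k - j)%N)) =
    (fun k => if k is 0 then 1 else if k is 1 then u else 0 : CD R 0).
  apply/funext => k; transitivity ((if (k <= 1)%N then 1 else 0) * u ^+ k); last first.
    by case: k => [|[|k]]; rewrite ?expr0 ?expr1 ?mul1r ?mul0r.
  rewrite -sqrt_coef_square mulr_suml; apply: eq_bigr => j _; rewrite /cdscale /v /GRing.scale /=.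
  have -> : u ^+ k = u ^+ j * u ^+ (k - j) by rewrite -exprD subnKC// -ltnS.
  by ring.
move=> H; have {H} SS : (S : R) ^+ 2 = 1 + u.
  apply: (cvg_unique _ H); first exact: norm_hausdorff.
  apply: (@cvg_near_eq _ _ _ _ _ (fun=> 1 + u : CD R 0)); last exact: cvg_cst.
  near=> N; have N0 : (1 < N)%N by near: N; exact: nbhs_infty_gt.
  by rewrite /series /= big_ltn 1?ltnW// big_ltn// big_nat_cond big1 ?addr0// => -[|[|i]]//.
(* The constant term is 1 and the tail is at most [2 * 4^-1], so the sum is the nonnegative root. *)
have S0 : 0 <= (S : R).
  have := geo_tail 1 ler01 h40 h4 vB vS; rewrite /series /= big_nat1 /v expr0 !mul1r mulr1 expr1.
  rewrite ler_norml => /andP[+ _]; rewrite expr2; lra.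
by rewrite -SS sqrtr_sqr ger0_norm.
Unshelve. all: by end_near.
Qed.

Lemma an_sqrt (b : CD R 0) : 0 < (b : R) -> an (fun x : CD R 0 => Num.sqrt (x : R) : CD R 0) b.
Proof.
move=> b0; have s0 : 0 <= Num.sqrt (b : R) by exact: sqrtr_ge0.
apply: (@an_power_series _ _ (fun k => Num.sqrt (b : R) * (sqrt_coef k * (b : R)^-1 ^+ k))
  (Num.sqrt (b : R)) (b : R)^-1 (4^-1 * b : R)) => //.
- by rewrite invr_gt0.
- by rewrite mulr_gt0.
- move=> k; rewrite normrM ger0_norm// ler_wpM2l// normrM -[leRHS]mul1r.
  apply: ler_pM => //; first exact: sqrt_coef_le1.
  by rewrite ger0_norm ?exprn_ge0// invr_ge0 ltW.
move=> h hb; have u4 : `|h / b| <= 4^-1.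
  by rewrite normrM normfV (gtr0_norm b0) ler_pdivrMr// ltW.
have -> : Num.sqrt (b + h : R) = Num.sqrt (b : R) * Num.sqrt (1 + h / b).
  by rewrite -sqrtrM ?ltW// mulrDr mulr1 mulrCA divff ?mulr1// gt_eqF.
have -> : series (fun k => Num.sqrt (b : R) * (sqrt_coef k * (b : R)^-1 ^+ k) * h ^+ k) =
    (fun N => Num.sqrt (b : R) * series (fun k => sqrt_coef k * (h / b) ^+ k) N).
  apply/funext => N; rewrite /series /= mulr_sumr; apply: eq_bigr => k _.
  by rewrite exprMn; ring.
by apply: cvgM; [exact: cvg_cst|exact: sqrt_series].
Qed.

End AnalyticFunctions.

(** * Homogeneous parts versus multi-index coefficients *)

Section RealAnalytic.
Context {R : realType}.

Definition monomial m (h : CD R m) (w : seq 'I_(2 ^ m)) : R := \prod_(i <- w) co h i.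

(** Unfolding the nested sums gives one term per word of coordinates. Words with the same exponents
    are not merged, so the total size stays below the bound. *)
Lemma hpoly_words m n k M (P : CD R m -> CD R n) : hpoly k M P ->
  exists s : seq (seq 'I_(2 ^ m) * CD R n),
    [/\ forall t, t \in s -> size t.1 = k, \sum_(t <- s) `|t.2| <= M &
        forall h, P h = \sum_(t <- s) monomial h t.1 *: t.2].
Proof.
elim: k M P => [|k IH] M P /=.
  move=> [c cM PE]; exists [:: ([::], c)]; split.
  - by move=> t; rewrite inE => /eqP ->.
  - by rewrite big_seq1.
  - by move=> h; rewrite big_seq1 /monomial big_nil scale1r.
move=> [Q [K [HQ KM PE]]].
have /choice[s Hs] : forall i, exists s : seq (seq 'I_(2 ^ m) * CD R n),
    [/\ forall t, t \in s -> size t.1 = k, \sum_(t <- s) `|t.2| <= K i &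
        forall h, Q i h = \sum_(t <- s) monomial h t.1 *: t.2].
  by move=> i; exact: IH.
exists (flatten [seq [seq (i :: t.1, t.2) | t <- s i] | i <- index_enum 'I_(2 ^ m)]); split.
- move=> t /flattenP[l /mapP[i _ ->] /mapP[t' t's ->]] /=.
  by have [-> //] := Hs i.
- apply: le_trans KM; rewrite big_flatten big_map; apply: ler_sum => i _.
  by rewrite big_map; have [] := Hs i.
- move=> h; rewrite PE big_flatten big_map; apply: eq_bigr => i _.
  have [_ _ ->] := Hs i; rewrite big_map scaler_sumr; apply: eq_bigr => t _.
  by rewrite /monomial big_cons scalerA.
Qed.

Definition exponents m (w : seq 'I_(2 ^ m)) : {ffun 'I_(2 ^ m) -> nat} :=
  [ffun i => count_mem i w].

Lemma monomialE m (h : CD R m) w :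
  monomial h w = \prod_(i < 2 ^ m) (cdcoords h)`_i ^+ exponents w i.
Proof.
elim: w => [|j w IH].
  by rewrite /monomial big_nil big1// => i _; rewrite ffunE expr0.
rewrite /monomial big_cons -/(monomial h w) IH.
rewrite [RHS](bigD1 j)//= ffunE /= eqxx add1n exprS -mulrA; congr (_ * _).
rewrite [LHS](bigD1 j)//= ffunE; congr (_ * _).
by apply: eq_bigr => i ij; rewrite !ffunE /= eq_sym (negbTE ij).
Qed.

Lemma sum_exponents m (w : seq 'I_(2 ^ m)) : (\sum_i exponents w i = size w)%N.
Proof.
elim: w => [|j w IH]; first by rewrite big1// => i _; rewrite ffunE.
rewrite /= -IH (bigD1 j)//= [in RHS](bigD1 j)//= !ffunE /= eqxx -addnA add1n; congr (_ + _).+1.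
by apply: eq_bigr => i ij; rewrite !ffunE /= eq_sym (negbTE ij).
Qed.

(** Regroups a sum over words by their exponents. The indices of [sum_degree] are functions into
    ['I_k.+1], and exponents of total degree [k] fit there. *)
Lemma sum_degreeE d k (W : nmodType) (E : {ffun 'I_d -> nat} -> W) (I : Type) (s : seq I)
    (p : I -> {ffun 'I_d -> nat}) (F : I -> W) (S : pred I) :
  (forall i, S i -> (\sum_j p i j = k)%N) ->
  (forall e : {ffun 'I_d -> nat}, (\sum_j e j = k)%N ->
    E e = \sum_(i <- s | S i && (p i == e)) F i) ->
  sum_degree k E = \sum_(i <- s | S i) F i.
Proof.
move=> Sp EE; rewrite /sum_degree.
pose q i : {ffun 'I_d -> 'I_k.+1} := [ffun j => inord (p i j)].
have pk i j : S i -> (p i j < k.+1)%N.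
  by move=> /Sp <-; rewrite ltnS (bigD1 j)//= leq_addr.
rewrite (partition_big q (fun a => \sum_j a j == k)%N) /=; last first.
  move=> i Si; apply/eqP; rewrite -[RHS](Sp i Si); apply: eq_bigr => j _.
  by rewrite ffunE inordK// pk.
apply: eq_bigr => a /eqP ak; rewrite EE; last first.
  by rewrite -[RHS]ak; apply: eq_bigr => j _; rewrite ffunE.
apply: eq_bigl => i; case Si: (S i) => //=; apply/eqP/eqP => [pe|qa].
  by apply/ffunP => j; rewrite !ffunE pe ffunE; apply: val_inj; rewrite /= inordK.
by apply/ffunP => j; rewrite -qa !ffunE inordK// pk.
Qed.

Lemma hpoly_sum_degree m n k M (P : CD R m -> CD R n) : hpoly k M P ->
  exists c : {ffun 'I_(2 ^ m) -> nat} -> CD R n,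
    sum_degree k (fun e => `|c e|) <= M /\
    forall h, P h = sum_degree k (fun e => (\prod_(i < 2 ^ m) (cdcoords h)`_i ^+ e i) *: c e).
Proof.
move=> /hpoly_words[s [sk sM PE]].
pose S (t : seq 'I_(2 ^ m) * CD R n) := size t.1 == k.
have Sp t : S t -> (\sum_j exponents t.1 j = k)%N by move=> /eqP <-; exact: sum_exponents.
have sS (W : nmodType) (F : seq 'I_(2 ^ m) * CD R n -> W) :
    \sum_(t <- s | S t) F t = \sum_(t <- s) F t.
  rewrite big_seq_cond [RHS]big_seq; apply: eq_bigl => t.
  by case: (boolP (t \in s)) => //= ts; rewrite /S (sk t ts) eqxx.
exists (fun e => \sum_(t <- s | S t && (exponents t.1 == e)) t.2); split.
  apply: le_trans sM.
  rewrite -sS -(@sum_degreeE _ k _ (fun e => \sum_(t <- s | S t && (exponents t.1 == e)) `|t.2|)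
    _ s (fun t => exponents t.1) _ S)//.
  by apply: ler_sum => a _; exact: ler_norm_sum.
move=> h; rewrite PE -sS; apply/esym; apply: (sum_degreeE (p := fun t => exponents t.1)) => // e _.
rewrite scaler_sumr; apply: eq_bigr => t /andP[_ /eqP <-].
by rewrite monomialE.
Qed.

Lemma hpoly_prod m (e : {ffun 'I_(2 ^ m) -> nat}) (r : seq 'I_(2 ^ m)) :
  hpoly (\sum_(i <- r) e i) 1 (fun h : CD R m => \prod_(i <- r) (cdcoords h)`_i ^+ e i : CD R 0).
Proof.
elim: r => [|i r IH].
  by rewrite big_nil; exists 1; rewrite ?normr1// => h; rewrite big_nil.
have H : hpoly (e i) 1 (fun h : CD R m => (cdcoords h)`_i ^+ e i : CD R 0).
  elim: (e i) => [|k IHk]; first by exists 1; rewrite ?normr1// => h; rewrite expr0.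
  by apply: hpoly_ext (hpoly_co i IHk) => h; rewrite exprS.
rewrite big_cons; have := hpoly_bilinear ler01 (cdscale_bilinear 0) H IH.
rewrite !mul1r; apply: hpoly_ext => h.
by rewrite big_cons.
Qed.

Lemma sum_degree_hpoly m n k (c : {ffun 'I_(2 ^ m) -> nat} -> CD R n) :
  hpoly k (sum_degree k (fun e => `|c e|))
    (fun h : CD R m => sum_degree k (fun e => (\prod_(i < 2 ^ m) (cdcoords h)`_i ^+ e i) *: c e)).
Proof.
apply: hpoly_sum => a /eqP ak; set e := [ffun i => nat_of_ord (a i)].
have H := hpoly_prod e (index_enum 'I_(2 ^ m)).
have ek : (\sum_i e i = k)%N by rewrite -ak; apply: eq_bigr => i _; rewrite ffunE.
rewrite ek in H.
have := hpoly_linear (K := `|c e|) (L := fun x : CD R 0 => cdscale x (c e)) _ _ H.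
rewrite mulr1; apply=> //.
have := bilinear_left (c e) ler01 (cdscale_bilinear n).
by rewrite mul1r.
Qed.

Lemma an_real_analytic_at m n (f : CD R m -> CD R n) a : an f a -> real_analytic_at f a.
Proof.
move=> [P [C [r [d [[C0 r0 d0] HP PE]]]]].
have /choice[c Hc] : forall k, exists c : {ffun 'I_(2 ^ m) -> nat} -> CD R n,
    sum_degree k (fun e => `|c e|) <= C * r ^+ k /\
    forall h, P k h = sum_degree k (fun e => (\prod_(i < 2 ^ m) (cdcoords h)`_i ^+ e i) *: c e).
  by move=> k; exact: hpoly_sum_degree.
(* One coefficient family for all degrees: the total degree of [e] selects the homogeneous part to
   read. *)
pose c0 (e : {ffun 'I_(2 ^ m) -> nat}) := c (\sum_i e i)%N e.
have c0E (W : nmodType) k (F : {ffun 'I_(2 ^ m) -> nat} -> CD R n -> W) :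
    sum_degree k (fun e => F e (c0 e)) = sum_degree k (fun e => F e (c k e)).
  apply: eq_bigr => b /eqP bk; rewrite /c0; congr (F _ (c _ _)).
  by rewrite -[RHS]bk; apply: eq_bigr => i _; rewrite ffunE.
exists c0, (2 * r)^-1; split.
- by rewrite invr_gt0 mulr_gt0.
- apply: (@series_le_cvg _ _ (geometric C 2^-1)).
  + by move=> k; apply: sumr_ge0 => b _; rewrite mulr_ge0// exprn_ge0// invr_ge0 mulr_ge0// ltW.
  + by move=> k; rewrite /geometric /= mulr_ge0.
  + move=> k; rewrite (c0E _ k (fun e x => `|x| * (2 * r)^-1 ^+ k)) /sum_degree -mulr_suml.
    have [Hk _] := Hc k.
    apply: (@le_trans _ _ (C * r ^+ k * (2 * r)^-1 ^+ k)).
      by apply: ler_wpM2r => //; rewrite exprn_ge0// invr_ge0 mulr_ge0// ltW.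
    rewrite -mulrA -exprMn /geometric /= le_eqVlt; apply/orP; left; apply/eqP.
    by congr (_ * _ ^+ _); field; exact: lt0r_neq0.
  + by apply: is_cvg_geometric_series; rewrite ger0_norm//; lra.
apply/nbhs_ballP; exists d => //= h; rewrite -ball_normE /= sub0r normrN => hd.
have -> : (fun k => sum_degree k (fun e => (\prod_(i < 2 ^ m) (cdcoords h)`_i ^+ e i) *: c0 e)) =
    P^~ h.
  apply/funext => k.
  rewrite (c0E _ k (fun e x => (\prod_(i < 2 ^ m) (cdcoords h)`_i ^+ e i) *: x)).
  by have [_ ->] := Hc k.
exact: PE.
Qed.

Lemma real_analytic_at_an m n (f : CD R m -> CD R n) a : real_analytic_at f a -> an f a.
Proof.
move=> [c [r [r0 cr /nbhs_ballP[d /= d0 fE]]]].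
(* The terms of a convergent series are bounded, being differences of consecutive partial sums. *)
have [B HB] : exists B : R, forall k, sum_degree k (fun e => `|c e| * r ^+ k) <= B.
  have bnd : bounded_fun (series (fun k => sum_degree k (fun e => `|c e| * r ^+ k))).
    exact: cvg_seq_bounded.
  have [B [Br HB]] := bnd; exists (2 * (`|B| + 1)) => k.
  have B1 : B < `|B| + 1 by rewrite ltr_pwDr// ler_norm.
  have := HB _ B1 k.+1 I; have := HB _ B1 k I => /= h1 h2.
  rewrite -[X in X <= _](seriesSB (fun k => sum_degree k (fun e => `|c e| * r ^+ k))).
  apply: (le_trans (ler_norm _)); apply: (le_trans (ler_normB _ _)).
  by rewrite mulrDl mul1r; apply: lerD.
have B0 : 0 <= B.
  by apply: le_trans (HB 0%N); apply: sumr_ge0 => b _; rewrite mulr_ge0// exprn_ge0// ltW.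
exists (fun k h => sum_degree k (fun e => (\prod_(i < 2 ^ m) (cdcoords h)`_i ^+ e i) *: c e)),
  B, r^-1, d; split.
- by rewrite invr_gt0.
- move=> k; apply: hpoly_le (sum_degree_hpoly k c).
  by rewrite exprVn ler_pdivlMr ?exprn_gt0// /sum_degree mulr_suml; exact: HB.
move=> h hd; apply: fE; rewrite -ball_normE /= sub0r normrN//.
Qed.

End RealAnalytic.

Section AnalyticAlgebra.
Context {R : realType} {m : nat}.

Lemma bounded_linear_id n (c : R) : bounded_linear (fun x : CD R n => c *: x) `|c|.
Proof.
split; [by move=> x y; rewrite scalerDr|by move=> a x; rewrite !scalerA mulrC|].
by move=> x; rewrite normrZ.
Qed.

Lemma cdconj_linear n : bounded_linear (@cdconj R n) 1.
Proof.
split; [exact: cdconjD|exact: cdconjZ|].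
by move=> x; rewrite mul1r cdconj_norm.
Qed.

Lemma cdre_linear n : bounded_linear (fun x : CD R n => cdre x : CD R 0) 1.
Proof.
split; [by move=> x y; rewrite cdreD|by move=> a x; rewrite cdreZ|].
by move=> x; rewrite mul1r cdre_norm.
Qed.

Lemma anZ n (c : R) (f : CD R m -> CD R n) a : an f a -> an (fun x => c *: f x) a.
Proof. by move=> fa; exact: (an_linear (normr_ge0 c) (bounded_linear_id n c) fa). Qed.

Lemma anN n (f : CD R m -> CD R n) a : an f a -> an (fun x => - f x) a.
Proof.
move=> /(anZ (-1)); apply: an_near.
by near=> x; rewrite scaleN1r.
Unshelve. all: by end_near.
Qed.

Lemma anB n (f g : CD R m -> CD R n) a : an f a -> an g a -> an (fun x => f x - g x) a.
Proof. by move=> fa ga; apply: anD => //; exact: anN. Qed.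

Lemma an_cdconj n (f : CD R m -> CD R n) a : an f a -> an (fun x => cdconj (f x)) a.
Proof. by move=> fa; exact: (an_linear ler01 (cdconj_linear n) fa). Qed.

Lemma an_cdre n (f : CD R m -> CD R n) a : an f a -> an (fun x => cdre (f x) : CD R 0) a.
Proof. by move=> fa; exact: (an_linear ler01 (cdre_linear n) fa). Qed.

Lemma an_cdmul n (f g : CD R m -> CD R n) a : an f a -> an g a -> an (fun x => f x ** g x) a.
Proof.
by move=> fa ga; apply: (an_bilinear _ (cdmul_bilinear n)) => //; rewrite exprn_ge0.
Qed.

Lemma an_cdscale n (f : CD R m -> CD R 0) (g : CD R m -> CD R n) a : an f a -> an g a ->
  an (fun x => (f x : R) *: g x) a.
Proof. by move=> fa ga; exact: (an_bilinear ler01 (cdscale_bilinear n) fa ga). Qed.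

Lemma an_cddot n (f g : CD R m -> CD R n) a : an f a -> an g a ->
  an (fun x => cddot (f x) (g x) : CD R 0) a.
Proof. by move=> fa ga; apply: an_cdre; apply: an_cdmul => //; exact: an_cdconj. Qed.

Lemma an_recip (f : CD R m -> CD R 0) a : f a != 0 -> an f a ->
  an (fun x => (f x : R)^-1 : CD R 0) a.
Proof. by move=> fa0 fa; apply: (an_comp fa); exact: an_inv. Qed.

Lemma an_cdinv n (f : CD R m -> CD R n) a : f a != 0 -> an f a -> an (fun x => cdinv (f x)) a.
Proof.
move=> fa0 fa; apply: an_cdscale; last exact: an_cdconj.
by apply: an_recip; [rewrite cddot_eq0|exact: an_cddot].
Qed.

Lemma an_pair (f g : CD R m -> CD R 0) a : an f a -> an g a ->
  an (fun x => (f x, g x) : CD R 1) a.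
Proof.
move=> fa ga.
have L1 : bounded_linear (fun x : CD R 0 => (x, 0) : CD R 1) 1.
  split.
  - by move=> x y; rewrite cdpairD /= addr0.
  - by move=> c x; rewrite cdpairZ /= scaler0.
  - by move=> x; rewrite (cd_norm_pair (m := 0)) /= normr0 mul1r ge_max lexx normr_ge0.
have L2 : bounded_linear (fun x : CD R 0 => (0, x) : CD R 1) 1.
  split.
  - by move=> x y; rewrite cdpairD /= addr0.
  - by move=> c x; rewrite cdpairZ /= scaler0.
  - by move=> x; rewrite (cd_norm_pair (m := 0)) /= normr0 mul1r ge_max lexx normr_ge0.
apply: an_near (anD (an_linear ler01 L1 fa) (an_linear ler01 L2 ga)).
by near=> x; rewrite cdpairD /= addr0 add0r.
Unshelve. all: by end_near.
Qed.

End AnalyticAlgebra.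

(** * Even and odd parts across the real axis *)

Section EvenOdd.
Context {R : realType} {n p : nat}.
Notation A := (CD R n).

Lemma an_cdim m (f : CD R m -> A) a : an f a -> an (fun x => cdim (f x)) a.
Proof. by move=> fa; apply: anZ; apply: anB => //; exact: an_cdconj. Qed.

Lemma an_polar (x : A) : cdim x != 0 -> an (@polar R n) x.
Proof.
move=> x0; apply: an_pair; first exact: an_cdre (an_id x).
apply: (an_comp (f := fun x : CD R 0 => Num.sqrt (x : R) : CD R 0)).
  by apply: an_cddot; exact: an_cdim (an_id x).
by apply: an_sqrt; rewrite cddot_gt0.
Qed.

Definition sqim (h : A) : R := cddot (cdim h) (cdim h).

Lemma hpoly_cdim : exists K, hpoly 1 K (@cdim R n).
Proof.
have [K HK] := hpoly_id (R := R) n; have HN := hpoly_linear ler01 (cdconj_linear n) HK.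
have H := hpolyD HK (hpoly_linear (normr_ge0 _) (bounded_linear_id n (-1)) HN).
have := hpoly_linear (normr_ge0 _) (bounded_linear_id n 2^-1) H => H2.
by eexists; apply: hpoly_ext H2 => h; rewrite scaleN1r.
Qed.

Lemma hpoly_sqim : exists K, hpoly 2 K (fun h : A => sqim h : CD R 0).
Proof.
have [K HK] := hpoly_cdim.
have HC := hpoly_linear ler01 (cdconj_linear n) HK.
have H := hpoly_bilinear (exprn_ge0 n (ler0n _ 2)) (cdmul_bilinear n) HK HC.
by eexists; exact: (hpoly_linear ler01 (cdre_linear n) H).
Qed.

(** Degree [k - 1], where degree -1 stands for the zero polynomial: the odd part loses one degree
    when beta is divided out. *)
Definition hpoly_pred k (M : R) (P : A -> CD R p) :=
  if k is k'.+1 then hpoly k' M P else forall h, P h = 0.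

Lemma hpoly_pred_scale k l N M (s : A -> CD R 0) (P : A -> CD R p) : 0 <= M ->
  hpoly l.+1 N s -> hpoly_pred k M P -> hpoly (l + k) (N * M) (fun h => cdscale (s h) (P h)).
Proof.
move=> M0 Hs; have N0 := hpoly_ge0 Hs; case: k => [|k] /= HP.
  rewrite addn0; apply: (hpoly_le (M := 0)); first exact: mulr_ge0.
  by apply: hpoly_ext (hpoly0 _) => h; rewrite HP /cdscale scaler0.
have := hpoly_bilinear ler01 (cdscale_bilinear p) Hs HP.
by rewrite mul1r addSnnS.
Qed.

Lemma hpoly_even_odd : exists2 K : R, 1 <= K & forall k M (P : CD R 1 -> CD R p), hpoly k M P ->
  exists Pe Po : A -> CD R p, [/\ hpoly k (M * K ^+ k) Pe, hpoly_pred k (M * K ^+ k) Po &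
    forall h (b : R), b ^+ 2 = sqim h -> P ((cdre h, b) : CD R 1) = Pe h + b *: Po h].
Proof.
have [S HS] := hpoly_sqim; have S0 := hpoly_ge0 HS.
have [N HN] := hpoly_id (R := R) n.
have {}HN := hpoly_linear ler01 (cdre_linear n) HN.
set a := (1 * N) in HN; have a0 := hpoly_ge0 HN.
pose K := 1 + a + S; have K1 : 1 <= K by rewrite /K -addrA lerDl addr_ge0.
have aK : a <= K by rewrite /K; lra.
have SK : S <= K by rewrite /K; lra.
clearbody K; exists K => //; elim=> [|k IH] M P /=.
  move=> [c cM PE]; exists (fun=> c), (fun=> 0); split=> //.
    by exists c => //; rewrite expr0 mulr1.
  by move=> h b _; rewrite PE scaler0 addr0.
move=> [Q [L [HQ LM PE]]].
pose i0 : 'I_(2 ^ 1) := @Ordinal 2 0 isT; pose i1 : 'I_(2 ^ 1) := @Ordinal 2 1 isT.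
have sum2 (V : nmodType) (F : 'I_(2 ^ 1) -> V) : \sum_i F i = F i0 + F i1.
  rewrite (bigD1 i0)//= (bigD1 i1)//= big1 ?addr0// => -[[|[|i]] Hi] //.
have [P0e [P0o [H0e H0o E0]]] := IH _ _ (HQ i0).
have [P1e [P1o [H1e H1o E1]]] := IH _ _ (HQ i1).
have L0 := hpoly_ge0 (HQ i0); have L1 := hpoly_ge0 (HQ i1).
have Kk : 0 <= K ^+ k by rewrite exprn_ge0//; exact: le_trans K1.
have K0 : 0 <= K by exact: le_trans K1.
rewrite sum2 in LM.
(* From P = alpha Q0 + beta Q1, the odd part of Q1 meets beta^2, which is the quadratic form [sqim],
   and its even part becomes odd. Both multipliers have size at most [K]. *)
exists (fun h => cdscale (cdre h : CD R 0) (P0e h) + cdscale (sqim h : CD R 0) (P1o h)),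
  (fun h => cdscale (cdre h : CD R 0) (P0o h) + P1e h); split.
- have h1 := hpoly_bilinear ler01 (cdscale_bilinear p) HN H0e.
  have h2 := hpoly_pred_scale (mulr_ge0 L1 Kk) HS H1o.
  apply: hpoly_le (hpolyD h1 h2).
  rewrite mul1r exprS; apply: (@le_trans _ _ ((L i0 + L i1) * (K * K ^+ k))).
    rewrite mulrDl; apply: lerD; rewrite mulrCA ler_wpM2l// ler_wpM2r//.
  by rewrite ler_wpM2r// mulr_ge0.
- have h1 := hpoly_pred_scale (mulr_ge0 L0 Kk) HN H0o.
  rewrite add0n in h1.
  apply: hpoly_le (hpolyD h1 H1e).
  rewrite exprS; apply: (@le_trans _ _ ((L i0 + L i1) * (K * K ^+ k))).
    rewrite mulrDl; apply: lerD; first by rewrite mulrCA ler_wpM2l// ler_wpM2r//.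
    by rewrite ler_wpM2l// ler_peMl.
  by rewrite ler_wpM2r// mulr_ge0.
- move=> h b bE; rewrite PE sum2 (E0 _ _ bE) (E1 _ _ bE) /cdscale /co /=.
  by rewrite -bE; vring.
Qed.

Lemma an_even_odd (F : CD R 1 -> CD R p) (x0 : A) : cdreal x0 -> an F ((cdre x0, 0) : CD R 1) ->
  exists (Ge Go : A -> CD R p) (d : R), [/\ 0 < d, an Ge x0, an Go x0 &
    forall x, `|x - x0| < d -> forall b : R, b ^+ 2 = sqim x ->
      F ((cdre x, b) : CD R 1) = Ge x + b *: Go x].
Proof.
move=> /cdreal_cdim x0r [P [C [r [d [[C0 r0 d0] HP PE]]]]].
have [K K1 HK] := hpoly_even_odd; have K0 : 0 < K by exact: lt_le_trans K1.
have /choice[Pe /choice[Po Peo]] : forall k, exists Pe Po : A -> CD R p,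
    [/\ hpoly k (C * r ^+ k * K ^+ k) Pe, hpoly_pred k (C * r ^+ k * K ^+ k) Po &
    forall h (b : R), b ^+ 2 = sqim h -> P k ((cdre h, b) : CD R 1) = Pe h + b *: Po h].
  by move=> k; exact: HK (HP k).
have [S HS] := hpoly_sqim; have S0 := hpoly_ge0 HS.
pose s := r * K; have s0 : 0 < s by exact: mulr_gt0.
have He k : hpoly k (C * s ^+ k) (Pe k) by rewrite /s exprMn mulrA; have [] := Peo k.
have Ho k : hpoly k (C * s * s ^+ k) (Po k.+1).
  by rewrite -mulrA -exprS /s exprMn mulrA; have [] := Peo k.+1.
(* The first bound makes both series geometric with ratio 1/2; the second keeps the point (alpha,
   beta) within the radius of the expansion of [F]. *)
pose e := Num.min (2 * s)^-1 (d / (S + 1)).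
have S1 : 0 < S + 1 by rewrite ltr_wpDl.
have e0 : 0 < e by rewrite lt_min invr_gt0 mulr_gt0//= divr_gt0.
have small (h : A) : `|h| < e -> s * `|h| <= 2^-1.
  rewrite lt_min => /andP[/ltW he _]; apply: (@le_trans _ _ (s * (2 * s)^-1)).
    by apply: ler_wpM2l => //; exact: ltW.
  by rewrite le_eqVlt; apply/orP; left; apply/eqP; field; exact: lt0r_neq0.
have sh0 (h : A) : 0 <= s * `|h| by rewrite mulr_ge0// ltW.
have /choice[ge geP] : forall h : A, exists l : CD R p, `|h| < e -> series (Pe^~ h) @ \oo --> l.
  move=> h; have [he|] := boolP (`|h| < e); last by exists 0.
  have [l ll] : exists l : CD R p, series (Pe^~ h) @ \oo --> l.
    apply: (geo_series_cvg (C := C) (sh0 h) (small h he)) => k.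
    by rewrite exprMn mulrA; exact: hpoly_norm.
  by exists l.
have /choice[go goP] : forall h : A, exists l : CD R p, `|h| < e ->
    series (fun k => Po k.+1 h) @ \oo --> l.
  move=> h; have [he|] := boolP (`|h| < e); last by exists 0.
  have [l ll] : exists l : CD R p, series (fun k => Po k.+1 h) @ \oo --> l.
    apply: (geo_series_cvg (C := C * s) (sh0 h) (small h he)) => k.
    by rewrite [(s * _) ^+ k]exprMn mulrA; exact: hpoly_norm.
  by exists l.
exists (fun x => ge (x - x0)), (fun x => go (x - x0)), e; split=> //.
- exists Pe, C, s, e; split=> // h he; rewrite [x0 + h]addrC addrK; exact: geP.
- exists (fun k => Po k.+1), (C * s), s, e; split=> //.
    by split=> //; rewrite mulr_ge0// ltW.
  by move=> h he; rewrite [x0 + h]addrC addrK; exact: goP.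
move=> x xe b bE; set h := x - x0.
have bE' : b ^+ 2 = sqim h.
  rewrite bE /sqim; suff -> : cdim h = cdim x by [].
  by rewrite /h /cdim cdconjB opprB addrACA -[x - cdconj x]addr0; move: x0r; rewrite /cdim => /eqP;
    rewrite scaler_eq0 invr_eq0 pnatr_eq0 /= subr_eq0 => /eqP <-; congr (_ *: _); vring.
have hx : cdre x = cdre x0 + cdre h by rewrite -cdreD /h addrC subrK.
(* From [b^2 = sqim h <= S |h|^2] and [S <= (S + 1)^2], which avoids a square root of [S]. *)
have bh : `|b| <= (S + 1) * `|h|.
  have Sh : 0 <= (S + 1) * `|h| by rewrite mulr_ge0// ltW.
  rewrite -ler_sqr ?nnegrE// -normrX ger0_norm ?sqr_ge0// bE' exprMn.
  apply: (le_trans (ler_norm _)); apply: (le_trans (hpoly_norm h HS)).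
  rewrite ler_wpM2r ?exprn_ge0// expr2; nra.
have hd : `|((cdre h, b) : CD R 1)| < d.
  have he : (S + 1) * `|h| < d.
    by move: xe; rewrite lt_min => /andP[_]; rewrite ltr_pdivlMr// mulrC.
  rewrite (cd_norm_pair (m := 0)) /= gt_max; apply/andP; split.
    apply: le_lt_trans he; apply: (le_trans (cdre_norm h)).
    by rewrite ler_peMl// lerDr.
  exact: le_lt_trans he.
have := PE _ hd.
have -> : ((cdre x0, 0) : CD R 1) + ((cdre h, b) : CD R 1) = ((cdre x, b) : CD R 1).
  by rewrite cdpairD /= add0r -hx.
move=> FE; apply: (cvg_unique _ FE); first exact: norm_hausdorff.
have -> : series (P^~ ((cdre h, b) : CD R 1)) =
    (fun N => series (Pe^~ h) N + b *: series (Po^~ h) N).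
  apply/funext => N; rewrite /series /= scaler_sumr -big_split; apply: eq_bigr => k _.
  by have [_ _ ->] := Peo k.
apply: cvgD; first exact: geP.
apply: cvgZ; first exact: cvg_cst.
rewrite -(cvg_shiftS (series (Po^~ h))).
have -> : (fun N => series (Po^~ h) N.+1) = series (fun k => Po k.+1 h).
  apply/funext => N; rewrite /series /= big_nat_recl//.
  by have [_ /= -> _] := Peo 0%N; rewrite add0r.
exact: goP.
Qed.

End EvenOdd.

(** * Analytic slice functions *)

Section AnalyticSlice.
Context {R : realType} {n : nat}.
Notation A := (CD R n).
Notation stemT := ((CD R 1 -> A) * (CD R 1 -> A))%type.
Implicit Types (z w : CD R 1) (J I x y : A) (Om U : set A) (f g E : A -> A) (F G : stemT).
Hypothesis n3 : (n <= 3)%N.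
Hypothesis n0 : (0 < n)%N.

(* The analytic extension of F.2 (alpha, beta) / beta to the real axis. *)
Definition stem_quot F x : A :=
  if cdim x == 0 then lim ((fun t : R => t^-1 *: F.2 ((cdre x, t) : CD R 1)) @ 0^')
  else ((polar x).2 : R)^-1 *: F.2 (polar x).

Definition stem_analytic Om F :=
  forall z, plane Om z -> an F.1 z /\ an F.2 z.

Lemma polar_real x : cdim x = 0 -> polar x = ((cdre x, 0) : CD R 1).
Proof. by move=> e; rewrite /polar e cddot0l sqrtr0. Qed.

Lemma plane_polar Om x : circular Om -> Om x -> plane Om (polar x).
Proof.
move=> cO Ox; have [J JS xE] := cd_polar x n0.
by apply/(circularP _ cO JS); rewrite -xE.
Qed.

Lemma polar_neq0' x : cdim x != 0 -> (polar x).2 != 0 :> R.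
Proof. by move=> x0; rewrite /polar /= gt_eqF// sqrtr_gt0 cddot_gt0. Qed.

Lemma sqim_polar x : ((polar x).2 : R) ^+ 2 = sqim x.
Proof. by rewrite sqr_sqrtr// cddot_ge0. Qed.

Lemma near_cdim_neq0 x : cdim x != 0 -> \forall y \near x, cdim y != 0.
Proof.
move=> x0; have /an_continuous c : an (@cdim R n) x by exact: an_cdim (an_id x).
exact: (cvgr_neq0 (cdim x) c x0).
Qed.

Lemma open_near Om x : open Om -> Om x -> \forall y \near x, Om y.
Proof. by move=> oO Ox; apply: open_nbhs_nbhs. Qed.

Lemma stem_even_analytic Om F x : circular Om -> open Om -> stem_sym Om F ->
  stem_analytic Om F -> Om x -> an (fun y => F.1 (polar y)) x.
Proof.
move=> cO oO sym aF Ox; have [F1a _] := aF _ (plane_polar cO Ox).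
have [xr|xr] := eqVneq (cdim x) 0; last by apply: an_comp => //; exact: an_polar.
rewrite (polar_real xr) in F1a.
have [Ge [Go [d [d0 Gea Goa FE]]]] := an_even_odd (proj2 (cdreal_cdim x) xr) F1a.
apply: an_near Gea; near=> y.
have Oy : Om y by near: y; exact: open_near.
have yd : `|y - x| < d.
  by near: y; apply/nbhs_ballP; exists d => //= y; rewrite -ball_normE /= distrC.
(* The expansion holds for both signs of beta; since [F.1] is even, comparing them kills the odd
   part. *)
have [e1 _] := sym _ (plane_polar cO Oy).
have h1 := FE y yd _ (sqim_polar y).
have h2 := FE y yd (- ((polar y).2 : R)) _; rewrite sqrrN in h2.
move: e1; rewrite h1 [cdconj _]/= (h2 (sqim_polar y)) => e1.
by apply: cddot_ext => w; have := congr1 (cddot^~ w) e1; rewrite !cddotLE; lra.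
Unshelve. all: by end_near.
Qed.

Lemma stem_odd_local Om F x : circular Om -> open Om -> stem_sym Om F ->
  stem_analytic Om F -> Om x -> cdim x = 0 ->
  exists (G : A -> A) (d : R), [/\ 0 < d, an G x &
    forall y, `|y - x| < d -> forall b : R, b ^+ 2 = sqim y ->
      F.2 ((cdre y, b) : CD R 1) = b *: G y].
Proof.
move=> cO oO sym aF Ox xr; have [_ F2a] := aF _ (plane_polar cO Ox).
rewrite (polar_real xr) in F2a.
have [Ge [Go [d [d0 Gea Goa FE]]]] := an_even_odd (proj2 (cdreal_cdim x) xr) F2a.
have /nbhs_ballP[e /= e0 eO] := open_near oO Ox.
exists Go, (Num.min d e); split=> //; first by rewrite lt_min d0.
move=> y; rewrite lt_min => /andP[yd ye] b bE.
have Oy : Om y by apply: eO; rewrite -ball_normE /= distrC.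
have Pb : plane Om ((cdre y, b) : CD R 1).
  have := plane_polar cO Oy; have : b ^+ 2 = ((polar y).2 : R) ^+ 2 by rewrite sqim_polar.
  move/eqP; rewrite eqf_sqr => /orP[/eqP ->//|/eqP -> h].
  exact: (plane_conj cO h).
have [_ e2] := sym _ Pb.
have h1 := FE y yd _ bE.
have h2 := FE y yd (- b) _; rewrite sqrrN in h2.
move: e2; rewrite [cdconj _]/= (h2 bE) h1 => e2.
apply: cddot_ext => w; have := congr1 (cddot^~ w) e2; rewrite !cddotLE; lra.
Qed.

Lemma sqim_slice z J : imunits J -> sqim (slice_point z J) = (z.2 : R) ^+ 2.
Proof.
by move=> JS; rewrite /sqim cdim_slice// cddotZl cddotZr imunits_sqr// mulr1 expr2.
Qed.

Lemma real_slice x J : cdim x = 0 -> x = slice_point ((cdre x, 0) : CD R 1) J.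
Proof.
move=> xr; have /cdreal_cdim[a ->] := xr.
by rewrite /slice_point /= scale0r addr0 cdreZ cdre1 mulr1.
Qed.

Lemma cvg_approach x J : cdim x = 0 -> imunits J ->
  (fun t : R => slice_point ((cdre x, t) : CD R 1) J) @ 0^' --> x.
Proof.
move=> xr JS; rewrite {2}(real_slice J xr) /slice_point /=.
apply: cvgD; first exact: cvg_cst.
by apply: cvgZ; [exact: nbhs_dnbhs|exact: cvg_cst].
Qed.

Lemma approach_neq0 x J : imunits J ->
  \forall t \near (0 : R)^', cdim (slice_point ((cdre x, t) : CD R 1) J) != 0.
Proof.
move=> JS; near=> t; have t0 : t != 0 by near: t; exact: nbhs_dnbhs_neq.
rewrite cdim_slice// scaler_eq0 negb_or t0 /= -cddot_eq0 imunits_sqr//.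
Unshelve. all: by end_near.
Qed.

Lemma stem_quot_analytic Om F x : circular Om -> open Om -> stem_sym Om F ->
  stem_analytic Om F -> Om x -> an (stem_quot F) x.
Proof.
move=> cO oO sym aF Ox.
have [xr|xr] := eqVneq (cdim x) 0; last first.
  have [_ F2a] := aF _ (plane_polar cO Ox).
  have ap := an_polar xr.
  have H : an (fun y => ((polar y).2 : R)^-1 *: F.2 (polar y)) x.
    apply: an_cdscale; last exact: an_comp.
    apply: an_recip; first exact: polar_neq0'.
    apply: (an_comp (f := fun x : CD R 0 => Num.sqrt (x : R) : CD R 0)).
      by apply: an_cddot; exact: an_cdim (an_id x).
    by apply: an_sqrt; rewrite cddot_gt0.
  apply: an_near H; near=> y; rewrite /stem_quot ifF//; apply/negbTE.
  by near: y; exact: near_cdim_neq0.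
have [G [d [d0 Ga GE]]] := stem_odd_local cO oO sym aF Ox xr.
have [d1 [K [d10 GK]]] := an_lip Ga.
apply: an_near Ga; near=> y.
have yd : `|y - x| < d.
  by near: y; apply/nbhs_ballP; exists d => //= y; rewrite -ball_normE /= distrC.
have yd1 : `|y - x| < d1.
  by near: y; apply/nbhs_ballP; exists d1 => //= y; rewrite -ball_normE /= distrC.
rewrite /stem_quot; case: eqVneq => yr; last first.
  rewrite [F.2 _](GE y yd _ (sqim_polar y)) scalerA mulVf ?scale1r//.
  exact: polar_neq0'.
have [J JS] := exists_imunit (R := R) n0.
apply/esym/cvg_lim; first exact: norm_hausdorff.
have cy := cvg_approach yr JS.
(* Continuity of [G] is needed at every real [y] near [x], not just at [x]; the Lipschitz bound
   around [x] provides it. *)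
have Gy : (fun t : R => G (slice_point ((cdre y, t) : CD R 1) J)) @ 0^' --> G y.
  apply/cvgrPdist_le => e e0; near=> t.
  have td1 : `|slice_point ((cdre y, t) : CD R 1) J - x| < d1.
    near: t; apply: (cvgr_norm_lt (y - x)) => //.
    by apply: cvgB; [exact: cy|exact: cvg_cst].
  apply: (le_trans (GK _ _ yd1 td1)).
  have K1 : 0 < `|K| + 1 by rewrite ltr_wpDl.
  apply: (@le_trans _ _ ((`|K| + 1) * `|y - slice_point ((cdre y, t) : CD R 1) J|)).
    by rewrite ler_wpM2r//; apply: (le_trans (ler_norm _)); rewrite lerDl.
  rewrite mulrC -ler_pdivlMr//.
  by near: t; move: cy => /cvgrPdist_le; apply; rewrite divr_gt0.
refine (cvg_near_eq _ Gy); near=> t.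
have t0 : t != 0 by near: t; exact: nbhs_dnbhs_neq.
have td : `|slice_point ((cdre y, t) : CD R 1) J - x| < d.
  near: t; apply: (cvgr_norm_lt (y - x)) => //.
  by apply: cvgB; [exact: cy|exact: cvg_cst].
have := GE _ td t; rewrite sqim_slice// cdre_slice//= => ->//.
by rewrite scalerA mulVf// scale1r.
Unshelve. all: by end_near.
Qed.

Lemma stem_quot_spherical Om f F x : circular Om -> is_stem Om f F -> Om x ->
  ~ cdreal x -> stem_quot F x = spherical_derivative f x.
Proof.
move=> cO sF Ox xr; rewrite (spherical_derivative_polar n3 n0 cO sF Ox xr) /stem_quot.
by rewrite ifF//; apply/eqP => /cdreal_cdim.
Qed.

End AnalyticSlice.

Section AnalyticTwist.
Context {R : realType} {n : nat}.
Notation A := (CD R n).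
Notation stemT := ((CD R 1 -> A) * (CD R 1 -> A))%type.
Implicit Types (z w : CD R 1) (J I x y : A) (Om U : set A) (f g E : A -> A) (F G : stemT).
Hypothesis n3 : (n <= 3)%N.
Hypothesis n0 : (0 < n)%N.

Lemma sinv_analytic Om F : stem_analytic Om F ->
  (forall z, plane Om z -> normsq (stemval F z) != 0) -> stem_analytic Om (sinv F).
Proof.
move=> aF u0 z Oz; have [a1 a2] := aF z Oz.
have nr : an (fun z => normre (stemval F z) : CD R 0) z by apply: anB; exact: an_cddot.
have ni : an (fun z => normim (stemval F z) : CD R 0) z.
  by apply: (anZ (n := 0)); exact: an_cddot.
have nq : an (fun z => (normsq (stemval F z))^-1 : CD R 0) z.
  apply: an_recip; first exact: u0.
  apply: anD; rewrite /=; under [X in an X]eq_fun do rewrite expr2.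
    exact: (an_cdmul (n := 0) nr nr).
  exact: (an_cdmul (n := 0) ni ni).
have [c1 c2] := (an_cdconj a1, an_cdconj a2).
split; apply: an_cdscale => //.
  by apply: anD; apply: an_cdscale.
by apply: anB; apply: an_cdscale.
Qed.

Section Extension.
Variables (Om : set A) (f E : A -> A) (F : stemT).
Hypotheses (cO : circular Om) (sF : is_stem Om f F) (eE : analytic_extension Om f E).

Lemma extension_an x : Om x -> an E x.
Proof. by move=> Ox; have [[_ Ea] _] := eE; exact: real_analytic_at_an (Ea x Ox). Qed.

Lemma extension_stem z J : imunits J -> plane Om z ->
  F.2 z = (z.2 : R) *: E (slice_point z J).
Proof.
move=> JS Oz; have Ox : Om (slice_point z J) by exact/(circularP z cO JS).
have [z0|z0] := eqVneq (z.2 : R) 0; first by rewrite z0 scale0r (stem_real (is_stem_sym sF) Oz).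
have [_ ->//] := eE; last by move=> /(cdreal_slice z JS) /eqP; rewrite (negbTE z0).
by rewrite (spherical_derivativeE n3 cO sF Oz JS z0) scalerA mulfV ?scale1r.
Qed.

Lemma extension_polar x : Om x -> F.2 (polar x) = ((polar x).2 : R) *: E x.
Proof.
move=> Ox; have [J JS xE] := cd_polar x n0.
by rewrite {3}xE -(extension_stem JS)//; exact: plane_polar.
Qed.

Lemma extension_circular z J I : imunits J -> imunits I -> plane Om z ->
  E (slice_point z J) = E (slice_point z I).
Proof.
move=> JS IS Oz; have [z0|z0] := eqVneq (z.2 : R) 0; first by rewrite /slice_point z0 !scale0r.
by apply: (scalerI z0); rewrite -!extension_stem.
Qed.

Variable Om0 : set A.
Hypotheses (cO0 : circular Om0) (oO : open Om) (sub : Om `<=` Om0).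
Hypotheses (sF0 : is_stem Om0 f F) (aF : stem_analytic Om F).
Hypothesis u0 : forall z, plane Om z -> normsq (stemval F z) != 0.

Definition hat := Om `\` zeros Om E.

Lemma hatP x : hat x <-> Om x /\ E x != 0.
Proof.
split=> [[Ox h]|[Ox /eqP h]]; last by split=> // -[].
by split=> //; apply/eqP => e; apply: h.
Qed.

Lemma hat_open : open hat.
Proof.
rewrite openE => x /hatP[Ox Ex]; rewrite /interior.
have H : \forall y \near x, Om y /\ E y != 0.
  near=> y; split; first by near: y; exact: open_near.
  by near: y; apply: (cvgr_neq0 (E x)) => //; exact: an_continuous (extension_an Ox).
by apply: filterS H => y /hatP.
Unshelve. all: by end_near.
Qed.

Lemma hat_twistable : twistable Om0 f F E hat.
Proof.
split=> // z J JS /hatP[Ox Ex]; have Oz : plane Om z by exact/(circularP z cO JS).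
have Oz0 : plane Om0 z by apply/(circularP z cO0 JS); exact: sub.
split=> //; first exact: u0; first exact: extension_stem.
move=> I IS; apply/hatP; split; first exact/(circularP z cO IS).
by rewrite (extension_circular IS JS).
Qed.

(** With [E] in place of [F.2 / beta], the unit J, which has no limit at real points, disappears:
    [cdim x] replaces beta J. Hence the slice conjugate is analytic across the axis. *)
Lemma slice_conj_extension x : Om x ->
  slice_conj Om0 f x = cdconj (F.1 (polar x)) + cdim x ** cdconj (E x).
Proof.
move=> Ox; have [J JS xE] := cd_polar x n0; have Oz := plane_polar n0 cO Ox.
have Oz0 : plane Om0 (polar x) by apply: plane_polar => //; exact: sub.
rewrite {1}xE (slice_conj_val n3 cO0 sF0 Oz0 JS) /cxval /=; congr (_ + _).
rewrite (extension_polar Ox) cdconjZ cdmulZr -cdmulZl; congr (_ ** _).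
by rewrite {2}xE cdim_slice.
Qed.

Lemma slice_conj_neq0 x : Om x -> slice_conj Om0 f x != 0.
Proof.
move=> Ox; have [J JS xE] := cd_polar x n0; have Oz := plane_polar n0 cO Ox.
have Oz0 : plane Om0 (polar x) by apply: plane_polar => //; exact: sub.
rewrite xE (slice_conj_val n3 cO0 sF0 Oz0 JS); apply/eqP => /(cxval_eq0 n3 JS)/eqP.
by rewrite normsq_conj; apply/negP; exact: u0.
Qed.

Lemma hat_analytic : real_analytic hat (Tmap Om0 f E).
Proof.
split; first exact: hat_open.
move=> x /hatP[Ox Ex]; apply: an_real_analytic_at.
have Ea := extension_an Ox.
have ca : an (slice_conj Om0 f) x.
  have H : an (fun y => cdconj (F.1 (polar y)) + cdim y ** cdconj (E y)) x.
    apply: anD;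
      first by apply: an_cdconj; apply: (stem_even_analytic n0 cO) => //; exact: is_stem_sym sF.
    by apply: an_cdmul; [exact: an_cdim (an_id x)|exact: an_cdconj].
  apply: an_near H; near=> y; rewrite slice_conj_extension//.
  by near: y; exact: open_near.
apply: an_cdmul; last exact: an_cdinv.
apply: an_cdmul; first by apply: an_cdinv => //; exact: slice_conj_neq0.
by apply: an_cdmul => //; apply: an_cdmul => //; exact: an_id.
Unshelve. all: by end_near.
Qed.

End Extension.

(** Off the axis this is [cddot_cxinv2] after cancelling beta^2. Both sides are continuous, so it
    extends to the real points by approaching them inside one slice. It shows that the two
    extensions have the same zeros. *)
Lemma extension_norm Om f g E E' F x : circular Om -> open Om -> is_stem Om f F ->
  is_stem Om g (sinv F) -> stem_analytic Om F ->
  (forall z, plane Om z -> normsq (stemval F z) != 0) ->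
  analytic_extension Om f E -> analytic_extension Om g E' -> Om x ->
  cddot (E' x) (E' x) * normsq (stemval F (polar x)) = cddot (E x) (E x).
Proof.
move=> cO oO sF sG aF u0 eE eE' Ox.
have nonreal y : Om y -> cdim y != 0 ->
    cddot (E' y) (E' y) * normsq (stemval F (polar y)) = cddot (E y) (E y).
  move=> Oy yr; have Oz := plane_polar n0 cO Oy; have := cddot_cxinv2 (u0 _ Oz).
  rewrite -[(cxinv _).2]/((sinv F).2 (polar y)).
  rewrite (extension_polar cO sG eE' Oy) /= (extension_polar cO sF eE Oy).
  rewrite !(cddotZl ((polar y).2 : R)) !(cddotZr ((polar y).2 : R)) => e.
  have p0 := polar_neq0' yr; have q0 := u0 _ Oz.
  by apply: (mulfI p0); apply: (mulfI p0); rewrite -[RHS](mulfVK q0) -e !mulrA.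
have [xr|xr] := eqVneq (cdim x) 0; last exact: nonreal.
have [J JS] := exists_imunit (R := R) n0; have cx := cvg_approach xr JS.
have cont m (H : A -> CD R m) : {for x, continuous H} ->
    (fun t : R => H (slice_point ((cdre x, t) : CD R 1) J)) @ 0^' --> H x.
  by move=> Hc; apply: (cvg_comp _ _ cx); exact: Hc.
have Ec : {for x, continuous E} by exact: an_continuous (extension_an eE Ox).
have Ec' : {for x, continuous E'} by exact: an_continuous (extension_an eE' Ox).
have F1c := an_continuous (stem_even_analytic n0 cO oO (is_stem_sym sF) aF Ox).
have pc : (fun t : R => polar (slice_point ((cdre x, t) : CD R 1) J)) @ 0^' --> polar x.
  exact: cvg_polar cx.
have F2c : (fun t : R => F.2 (polar (slice_point ((cdre x, t) : CD R 1) J))) @ 0^' --> F.2 (polar x).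
  rewrite (extension_polar cO sF eE Ox).
  have H : (fun t : R => ((polar (slice_point ((cdre x, t) : CD R 1) J)).2 : R) *:
      E (slice_point ((cdre x, t) : CD R 1) J)) @ 0^' --> ((polar x).2 : R) *: E x.
    by apply: cvgZ; [have [_ h] := proj1 (cvg_cdpair (m := 0) _ _) pc|exact: cont].
  refine (cvg_near_eq _ H); near=> t; rewrite (extension_polar cO sF eE)//.
  by near: t; apply: cx; exact: open_near.
have {}F1c := cont _ _ F1c.
have lim1 : (fun t : R => cddot (E (slice_point ((cdre x, t) : CD R 1) J))
    (E (slice_point ((cdre x, t) : CD R 1) J))) @ 0^' --> cddot (E x) (E x).
  by apply: cvg_cddot; exact: cont.
have lim2 : (fun t : R => cddot (E' (slice_point ((cdre x, t) : CD R 1) J))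
    (E' (slice_point ((cdre x, t) : CD R 1) J)) *
    normsq (stemval F (polar (slice_point ((cdre x, t) : CD R 1) J)))) @ 0^' -->
    cddot (E' x) (E' x) * normsq (stemval F (polar x)).
  apply: cvgM; first by apply: cvg_cddot; exact: cont.
  rewrite /normsq !expr2; under eq_fun do rewrite !expr2; apply: cvgD; apply: cvgM.
  - by apply: cvgB; apply: cvg_cddot.
  - by apply: cvgB; apply: cvg_cddot.
  - by apply: cvgM; [exact: cvg_cst|exact: cvg_cddot].
  - by apply: cvgM; [exact: cvg_cst|exact: cvg_cddot].
apply: (cvg_unique _ lim2); first exact: norm_hausdorff.
refine (cvg_near_eq _ lim1); near=> t; apply: nonreal.
  by near: t; apply: cx; exact: open_near.
by near: t; exact: approach_neq0.
Unshelve. all: by end_near.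
Qed.

End AnalyticTwist.

(** * Analyticity of slice regular functions *)

Section RootsOfUnity.
Context {R : realType}.
Notation C := R[i].
Notation N := (@Normc.normc R).

Lemma normc_ge0 (z : C) : 0 <= N z.
Proof. by case: z => x y; exact: sqrtr_ge0. Qed.

Lemma normc_real (r : R) : N r%:C%C = `|r|.
Proof. by rewrite /Normc.normc /= expr0n addr0 sqrtr_sqr. Qed.

Lemma normcX (z : C) k : N (z ^+ k) = N z ^+ k.
Proof. by elim: k => [|k IH]; rewrite ?expr0 ?Normc.normc1// !exprS Normc.normcM IH. Qed.

Lemma normc_sum (I : Type) (r : seq I) (G : I -> C) :
  N (\sum_(i <- r) G i) <= \sum_(i <- r) N (G i).
Proof.
elim/big_rec2 : _ => [|i y1 y2 _ h]; first by rewrite Normc.normc0.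
by apply: (le_trans (le_normcD _ _)); rewrite lerD2l.
Qed.

Lemma normc_sum_le (G : nat -> C) M (B : R) : (forall j, (j < M)%N -> N (G j) <= B) ->
  N (\sum_(0 <= j < M) G j) <= M%:R * B.
Proof.
move=> GB; apply: (le_trans (normc_sum _ _)).
apply: (@le_trans _ _ (\sum_(0 <= j < M) B)).
  by apply: ler_sum_nat => j /andP[_ jM]; exact: GB.
by rewrite sumr_const_nat subn0 mulr_natl.
Qed.

Definition cis (t : R) : C := (cos t +i* sin t)%C.

Lemma cisD s t : cis (s + t) = cis s * cis t.
Proof. by rewrite /cis cosD sinD; apply/eqP; rewrite eq_complex /= eqxx addrC eqxx. Qed.

Lemma cis0 : cis 0 = 1.
Proof. by rewrite /cis cos0 sin0. Qed.

Lemma cisX t k : cis t ^+ k = cis (k%:R * t).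
Proof.
elim: k => [|k IH]; first by rewrite expr0 mul0r cis0.
by rewrite exprS IH -cisD -natr1 mulrDl mul1r addrC.
Qed.

Lemma normc_cis t : N (cis t) = 1.
Proof. by rewrite /cis /= cos2Dsin2 sqrtr1. Qed.

Definition omega M : C := cis (pi *+ 2 / M%:R).

Lemma normc_omegaX M k : N (omega M ^+ k) = 1.
Proof. by rewrite normcX normc_cis expr1n. Qed.

Lemma omega_neq0 M : omega M != 0.
Proof.
apply/eqP => e; have := normc_cis (pi *+ 2 / M%:R); rewrite -/(omega M) e Normc.normc0.
by move/eqP; rewrite eq_sym oner_eq0.
Qed.

Lemma omegaM M : (0 < M)%N -> omega M ^+ M = 1.
Proof.
move=> M0; rewrite cisX mulrC mulfVK ?pnatr_eq0 -?lt0n//.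
by rewrite /cis cos2pi sin2pi.
Qed.

Lemma omegaX_neq1 M k : (0 < k < M)%N -> omega M ^+ k != 1.
Proof.
move=> /andP[k0 kM]; have M0 : 0 < M%:R :> R by rewrite ltr0n (leq_trans _ kM).
apply/eqP; rewrite cisX => /(congr1 (@complex.Re R)) /=.
(* Half the angle lies strictly between 0 and pi, where the sine is positive; so the cosine of the
   full angle is not 1. *)
set t : R := pi * (k%:R / M%:R).
have -> : k%:R * (pi *+ 2 / M%:R) = t *+ 2 by rewrite /t mulr2n [RHS]mulr2n; ring.
have t0 : 0 < t < pi.
  have p0 := @pi_gt0 R; apply/andP; split; rewrite /t; first by rewrite mulr_gt0// divr_gt0// ltr0n.
  by rewrite -[ltRHS]mulr1 ltr_pM2l// ltr_pdivrMr// mul1r ltr_nat.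
rewrite cos_mulr2n; have := sin_gt0_pi t0; have := cos2Dsin2 t.
move: (sin t) (cos t) => s c; nra.
Qed.

Lemma sum_roots (z : C) M : z ^+ M = 1 -> z != 1 -> \sum_(0 <= j < M) z ^+ j = 0.
Proof.
move=> zM z1; have : (z - 1) * \sum_(0 <= j < M) z ^+ j = 0.
  by rewrite big_mkord -subrX1 zM subrr.
by move/eqP; rewrite mulf_eq0 subr_eq0 (negbTE z1) => /eqP.
Qed.

Lemma omega_close (d : R) : 0 < d -> exists M0, forall M, (M0 <= M)%N -> N (omega M - 1) < d.
Proof.
move=> d0; have c0 := @continuous_cos R 0.
(* The squared distance from [cis t] to 1 is [2 (1 - cos t)]. *)
have /cvgrPdist_lt/(_ (d ^+ 2 / 2)) H := c0.
have {}H : \forall t \near (0 : R), `|cos 0 - cos t| < d ^+ 2 / 2.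
  by apply: H; rewrite divr_gt0// exprn_gt0.
have /nbhs_ballP[e /= e0 He] := H.
exists (Num.truncn ((pi *+ 2) / e)).+1 => M MM.
have M0 : 0 < M%:R :> R by rewrite ltr0n (leq_trans _ MM).
have p0 : 0 < pi *+ 2 :> R by rewrite mulr2n addr_gt0// pi_gt0.
have Me : pi *+ 2 / M%:R < e.
  rewrite ltr_pdivrMr// mulrC -ltr_pdivrMr//.
  apply: (lt_le_trans (truncnS_gt _)); by rewrite ler_nat.
have := He (pi *+ 2 / M%:R); rewrite -ball_normE /= sub0r normrN ger0_norm
  ?divr_ge0 ?(ltW p0)// => /(_ Me).
rewrite cos0 => h.
rewrite subr0.
rewrite -(@ltr_pXn2r _ 2)// ?nnegrE ?sqrtr_ge0 ?(ltW d0)//.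
rewrite sqr_sqrtr ?addr_ge0 ?sqr_ge0//.
have := cos2Dsin2 (pi *+ 2 / M%:R : R); move: h; rewrite ltr_norml => /andP[_].
move: (sin _) (cos _) => s c; nra.
Qed.

End RootsOfUnity.

(** * Cauchy's formula with averages over roots of unity *)

Section DiscreteCauchy.
Context {R : realType}.
Notation C := R[i].
Notation N := (@Normc.normc R).
Variables (F F' : C -> C) (a : C) (rho B : R).
Hypothesis rho0 : 0 < rho.
Hypothesis F'B : forall z, N (z - a) <= rho -> N (F' z) <= B.

Definition uniform_diff (e d : R) := forall z z', N (z - a) <= rho -> N (z' - a) <= rho ->
  N (z' - z) < d -> N (F z' - F z - F' z * (z' - z)) <= e * N (z' - z).

(* The circles of centre a + (1 - t) w and radius t rho shrink from the boundary
   of the disc to the point a + w. *)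
Definition circ M (w : C) (t : R) (j : nat) : C :=
  a + (1 - t)%:C%C * w + (t * rho)%:C%C * omega M ^+ j.

Lemma circ_disc M w t j : N w <= rho -> 0 <= t -> t <= 1 -> N (circ M w t j - a) <= rho.
Proof.
move=> wr t0 t1; have -> : circ M w t j - a = (1 - t)%:C%C * w + (t * rho)%:C%C * omega M ^+ j.
  by rewrite /circ; ring.
apply: (le_trans (le_normcD _ _)); rewrite !Normc.normcM !normc_real normc_omegaX mulr1.
rewrite ger0_norm ?subr_ge0// (ger0_norm (_ : 0 <= t * rho)) ?mulr_ge0 ?(ltW rho0)//.
have : (1 - t) * N w <= (1 - t) * rho by rewrite ler_wpM2l// subr_ge0.
lra.
Qed.

(** A discrete form of the vanishing of the integral of F' along a closed curve: each summand times
    the chord [q] is an increment of [F] up to [e] times the chord length, and the increments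
    telescope around the circle. *)
Lemma mean_derivative e d M w t : 0 <= e -> uniform_diff e d -> (1 < M)%N -> N w <= rho ->
  rho * N (omega M - 1) < d -> 0 <= t -> t <= 1 ->
  N (\sum_(0 <= j < M) F' (circ M w t j) * omega M ^+ j) <= M%:R * e.
Proof.
move=> e0 H M1 wr wd t0 t1; have M0 : (0 < M)%N by exact: ltnW.
have o1 : omega M != 1 :> C by have := @omegaX_neq1 R M 1; rewrite M1 expr1; apply.
(* The degenerate circle has chord zero, which cannot be divided out; there the roots of unity sum
   to zero. *)
have [t00|t00] := eqVneq t 0.
  have -> : \sum_(0 <= j < M) F' (circ M w t j) * omega M ^+ j =
      F' (a + w) * \sum_(0 <= j < M) omega M ^+ j.
    rewrite mulr_sumr; apply: eq_bigr => j _; congr (F' _ * _).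
    by rewrite /circ t00 subr0 mul0r rmorph1 rmorph0; ring.
  by rewrite sum_roots ?omegaM// mulr0 Normc.normc0 mulr_ge0.
have tp : 0 < t by rewrite lt_def t00.
pose q : C := (t * rho)%:C%C * (omega M - 1).
have q0 : 0 < N q.
  rewrite lt_def normc_ge0 andbT; apply/eqP => /Normc.eq0_normc /eqP.
  rewrite mulf_eq0 subr_eq0 (negbTE o1) orbF => /eqP/(congr1 (@complex.Re R)) /= /eqP.
  by rewrite mulf_eq0 (negbTE t00) gt_eqF.
have step j : circ M w t j.+1 - circ M w t j = q * omega M ^+ j.
  by rewrite /circ /q exprS; ring.
have Nstep j : N (circ M w t j.+1 - circ M w t j) = N q.
  by rewrite step Normc.normcM normc_omegaX mulr1.
have qd : N q < d.
  apply: le_lt_trans wd; rewrite /q Normc.normcM normc_real ger0_norm ?mulr_ge0 ?(ltW rho0)//.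
  by rewrite ler_wpM2r ?normc_ge0// ler_piMl// ltW.
have tel : \sum_(0 <= j < M) (F (circ M w t j.+1) - F (circ M w t j)) = 0.
  rewrite telescope_sumr// [circ M w t M](_ : _ = circ M w t 0) ?subrr//.
  by rewrite /circ omegaM// expr0.
have E : q * \sum_(0 <= j < M) F' (circ M w t j) * omega M ^+ j =
    - \sum_(0 <= j < M) (F (circ M w t j.+1) - F (circ M w t j)
         - F' (circ M w t j) * (circ M w t j.+1 - circ M w t j)).
  rewrite sumrB tel sub0r opprK mulr_sumr; apply: eq_bigr => j _.
  by rewrite step; ring.
have : N (q * \sum_(0 <= j < M) F' (circ M w t j) * omega M ^+ j) <= M%:R * (e * N q).
  rewrite E normcN; apply: normc_sum_le => j _; rewrite -(Nstep j); apply: H.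
  - exact: circ_disc.
  - exact: circ_disc.
  - by rewrite Nstep.
by rewrite Normc.normcM mulrC mulrA ler_pM2r.
Qed.

(* The Cauchy kernel 1 / (1 - x / zeta), truncated at order K. *)
Definition kernel K M (x : C) j : C := \sum_(0 <= k < K) (x / omega M ^+ j) ^+ k.

Lemma kernel_norm K M x j : N x <= 1 -> N (kernel K M x j) <= K%:R.
Proof.
move=> x1; rewrite -[leRHS]mulr1; apply: normc_sum_le => k _.
by rewrite normcX Normc.normcM Normc.normcV normc_omegaX invr1 mulr1 exprn_ile1 ?normc_ge0.
Qed.

Lemma kernelE K M x j : (omega M ^+ j - x) * kernel K M x j =
  omega M ^+ j * (1 - (x / omega M ^+ j) ^+ K).
Proof.
have o0 : omega M ^+ j != 0 :> C by rewrite expf_neq0// omega_neq0.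
have -> : omega M ^+ j - x = omega M ^+ j * (1 - x / omega M ^+ j).
  by rewrite mulrBr mulr1 mulrCA mulfV// mulr1.
rewrite -mulrA; congr (_ * _).
have := subrX1 (x / omega M ^+ j) K; rewrite /kernel big_mkord => H.
by rewrite -opprB mulNr -H opprB.
Qed.

(** Only the power 0 has a nonzero average; [K <= M] prevents a higher power of the root from
    returning to 1. *)
Lemma sum_kernel K M x : (0 < K)%N -> (K <= M)%N ->
  \sum_(0 <= j < M) kernel K M x j = M%:R.
Proof.
move=> K0 KM; rewrite /kernel exchange_big /= big_ltn// [X in _ + X]big1_seq ?addr0.
  by under eq_bigr do rewrite expr0; rewrite sumr_const_nat subn0.
move=> k /andP[_]; rewrite mem_index_iota => /andP[k0 kK].
have -> : \sum_(0 <= j < M) (x / omega M ^+ j) ^+ k =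
    x ^+ k * \sum_(0 <= j < M) ((omega M ^+ k)^-1) ^+ j.
  rewrite mulr_sumr; apply: eq_bigr => j _.
  by rewrite exprMn; congr (_ * _); rewrite !exprVn -!exprM mulnC.
have kM : (k < M)%N by exact: leq_trans KM.
have M0 : (0 < M)%N by exact: leq_trans kM.
rewrite sum_roots ?mulr0//.
  by rewrite exprVn -exprM mulnC exprM omegaM// expr1n invr1.
by rewrite invr_eq1 omegaX_neq1// k0.
Qed.

(** At [t = 0] all nodes are [a + w], which gives [M F(a + w)]; at [t = 1] they lie on the circle of
    radius [rho], which gives [M] times the truncated expansion. *)
Definition homotopy K M w t := \sum_(0 <= j < M) F (circ M w t j) * kernel K M (w / rho%:C%C) j.

Lemma homotopy_bound e d K M w : 0 <= e -> 0 < d -> uniform_diff e d -> (1 < M)%N -> N w <= rho ->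
  rho * N (omega M - 1) < d ->
  N (homotopy K M w 1 - homotopy K M w 0) <=
    M%:R * (rho * e * (1 + 2 * K%:R) + rho * (B * N (w / rho%:C%C) ^+ K)).
Proof.
move=> e0 d0 H M1 wr wd; set x := w / rho%:C%C.
have r0 : rho%:C%C != 0 :> C by apply/eqP => /(congr1 (@complex.Re R)) /= /eqP; rewrite gt_eqF.
have x1 : N x <= 1.
  by rewrite /x Normc.normcM Normc.normcV normc_real gtr0_norm// ler_pdivrMr// mul1r.
have wx : w = rho%:C%C * x by rewrite /x mulrCA mulfV// mulr1.
(* Enough steps for each node to move by less than [d]: a node travels at most [2 * rho] in all. *)
pose T := (Num.truncn (2 * rho / d)).+1.
have T0 : 0 < T%:R :> R by rewrite ltr0n.
have Td : 2 * rho / T%:R < d.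
  by rewrite ltr_pdivrMr// [ltRHS]mulrC -ltr_pdivrMr// /T truncnS_gt.
pose tt i : R := i%:R / T%:R.
have tt0 i : 0 <= tt i by rewrite divr_ge0.
have tt1 i : (i <= T)%N -> tt i <= 1 by move=> iT; rewrite ler_pdivrMr// mul1r ler_nat.
have -> : homotopy K M w 1 - homotopy K M w 0 =
    \sum_(0 <= i < T) (homotopy K M w (tt i.+1) - homotopy K M w (tt i)).
  by rewrite telescope_sumr// /tt mul0r mulfV ?gt_eqF.
set bnd := M%:R * _.
have -> : bnd = T%:R * (bnd / T%:R) by rewrite mulrC mulfVK// gt_eqF.
apply: normc_sum_le => i iT.
pose st j : C := circ M w (tt i.+1) j - circ M w (tt i) j.
have stE j : st j = (rho / T%:R)%:C%C * (omega M ^+ j - x).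
  rewrite /st /circ {1 2}wx /tt -natr1 !rmorphM !rmorphB !rmorphM !rmorphD !rmorph1 /=.
  by ring.
have Nst j : N (st j) <= 2 * rho / T%:R.
  rewrite stE Normc.normcM normc_real gtr0_norm ?divr_gt0//.
  have : N (omega M ^+ j - x) <= 2.
    apply: (le_trans (le_normcD _ _)); rewrite normcN normc_omegaX.
    by rewrite -[leRHS](_ : 1 + 1 = _)// lerD2l.
  have rT : 0 < rho / T%:R by exact: divr_gt0.
  by move=> h; rewrite -[leRHS]mulrA [leRHS]mulrC ler_pM2l.
pose err j : C := F (circ M w (tt i.+1) j) - F (circ M w (tt i) j) - F' (circ M w (tt i) j) * st j.
have Nerr j : N (err j) <= e * (2 * rho / T%:R).
  apply: (@le_trans _ _ (e * N (st j))); last by rewrite ler_wpM2l.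
  apply: H; [apply: circ_disc|apply: circ_disc|] => //; first exact: (tt1 _ (ltnW iT)).
    exact: tt1.
  exact: (le_lt_trans (Nst j) Td).
(* The displacement of node j is [(rho / T) (omega^j - x)], and the kernel cancels its last factor
   by [kernelE]. What is left is a mean of F' (small by [mean_derivative]), the truncation term with
   [x^K], and the linearisation errors. *)
have -> : homotopy K M w (tt i.+1) - homotopy K M w (tt i) =
   (rho / T%:R)%:C%C * (\sum_(0 <= j < M) F' (circ M w (tt i) j) * omega M ^+ j)
   - (rho / T%:R)%:C%C * (\sum_(0 <= j < M) F' (circ M w (tt i) j) *
       (omega M ^+ j * (x / omega M ^+ j) ^+ K))
   + \sum_(0 <= j < M) err j * kernel K M x j.
  rewrite /homotopy -sumrB !mulr_sumr -sumrB -big_split /=; apply: eq_bigr => j _.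
  rewrite -mulrBl -/x.
  have -> : F (circ M w (tt i.+1) j) - F (circ M w (tt i) j) = F' (circ M w (tt i) j) * st j + err j.
    by rewrite /err; ring.
  rewrite mulrDl stE; congr (_ + _).
  have := kernelE K M x j => kE.
  transitivity ((rho / T%:R)%:C%C * F' (circ M w (tt i) j) * ((omega M ^+ j - x) * kernel K M x j)).
    by ring.
  by rewrite kE; ring.
have b1 : N (\sum_(0 <= j < M) F' (circ M w (tt i) j) * omega M ^+ j) <= M%:R * e.
  by apply: (mean_derivative e0 H M1 wr wd) => //; exact: (tt1 _ (ltnW iT)).
have b2 : N (\sum_(0 <= j < M) F' (circ M w (tt i) j) * (omega M ^+ j * (x / omega M ^+ j) ^+ K))
    <= M%:R * (B * N x ^+ K).
  apply: normc_sum_le => j _; rewrite Normc.normcM.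
  have -> : N (omega M ^+ j * (x / omega M ^+ j) ^+ K) = N x ^+ K.
    rewrite Normc.normcM normc_omegaX mul1r normcX Normc.normcM Normc.normcV.
    by rewrite normc_omegaX invr1 mulr1.
  rewrite ler_wpM2r ?exprn_ge0 ?normc_ge0//.
  by apply: F'B; apply: circ_disc => //; exact: (tt1 _ (ltnW iT)).
have b3 : N (\sum_(0 <= j < M) err j * kernel K M x j) <= M%:R * (e * (2 * rho / T%:R) * K%:R).
  apply: normc_sum_le => j _; rewrite Normc.normcM; apply: ler_pM; rewrite ?normc_ge0//.
  exact: kernel_norm.
have rT : 0 <= rho / T%:R by rewrite divr_ge0// ltW.
apply: (le_trans (le_normcD _ _)).
apply: (@le_trans _ _ (rho / T%:R * (M%:R * e) + rho / T%:R * (M%:R * (B * N x ^+ K)) +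
    M%:R * (e * (2 * rho / T%:R) * K%:R))).
  apply: lerD => //; apply: (le_trans (le_normcD _ _)).
  rewrite normcN !(Normc.normcM (rho / T%:R)%:C%C) normc_real ger0_norm//.
  by apply: lerD; apply: ler_wpM2l.
rewrite le_eqVlt; apply/orP; left; apply/eqP; rewrite /bnd; field.
by rewrite gt_eqF.
Qed.

Lemma normc_nat M : N M%:R = M%:R.
Proof.
have -> : (M%:R : C) = (M%:R : R)%:C%C by rewrite rmorph_nat.
by rewrite normc_real ger0_norm.
Qed.

Definition cauchy_coef M k : C :=
  (M%:R)^-1 * \sum_(0 <= j < M) F (a + rho%:C%C * omega M ^+ j) / (rho%:C%C * omega M ^+ j) ^+ k.

Lemma cauchy_coef_approx e d K M w : 0 <= e -> 0 < d -> uniform_diff e d -> (1 < M)%N ->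
  (0 < K)%N -> (K <= M)%N -> N w <= rho -> rho * N (omega M - 1) < d ->
  N (\sum_(0 <= k < K) cauchy_coef M k * w ^+ k - F (a + w)) <=
    rho * e * (1 + 2 * K%:R) + rho * (B * N (w / rho%:C%C) ^+ K).
Proof.
move=> e0 d0 H M1 K0 KM wr wd; have := homotopy_bound K e0 d0 H M1 wr wd.
have M0 : (M%:R : C) != 0 by rewrite pnatr_eq0 -lt0n ltnW.
have -> : homotopy K M w 0 = M%:R * F (a + w).
  rewrite -(sum_kernel (w / rho%:C%C) K0 KM) mulr_suml; apply: eq_bigr => j _.
  by rewrite mulrC /circ subr0 mul0r rmorph1 rmorph0; congr (_ * F _); ring.
have -> : homotopy K M w 1 = M%:R * \sum_(0 <= k < K) cauchy_coef M k * w ^+ k.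
  rewrite mulr_sumr /homotopy /kernel; under eq_bigr do rewrite mulr_sumr.
  rewrite exchange_big /=; apply: eq_bigr => k _.
  rewrite /cauchy_coef mulrA mulVKf// mulr_suml; apply: eq_bigr => j _.
  have -> : circ M w 1 j = a + rho%:C%C * omega M ^+ j.
    by rewrite /circ subrr mul1r rmorph0; ring.
  by rewrite -[w / _ / _]mulrA -invfM exprMn exprVn mulrA mulrAC.
by rewrite -mulrBr (Normc.normcM M%:R) normc_nat ler_pM2l// ltr0n ltnW.
Qed.

Lemma cauchy_coef_bound M k (B0 : R) : (0 < M)%N ->
  (forall z, N (z - a) <= rho -> N (F z) <= B0) -> N (cauchy_coef M k) <= B0 * rho^-1 ^+ k.
Proof.
move=> M0 FB; rewrite /cauchy_coef Normc.normcM Normc.normcV normc_nat.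
rewrite mulrC ler_pdivrMr ?ltr0n// mulrC; apply: normc_sum_le => j _.
rewrite Normc.normcM Normc.normcV normcX Normc.normcM normc_real normc_omegaX mulr1 gtr0_norm//.
rewrite exprVn; apply: ler_wpM2r; first by rewrite invr_ge0 exprn_ge0// ltW.
apply: FB.
by rewrite addrC addKr Normc.normcM normc_real normc_omegaX mulr1 gtr0_norm.
Qed.

End DiscreteCauchy.

Section CauchyExpansion.
Context {R : realType}.
Notation C := R[i].
Notation N := (@Normc.normc R).
Notation Re := (@complex.Re R).
Notation Im := (@complex.Im R).

Lemma Re_normc (z : C) : `|Re z| <= N z.
Proof. by case: z => x y /=; rewrite -[`|x|]sqrtr_sqr ler_wsqrtr// lerDl sqr_ge0. Qed.

Lemma Im_normc (z : C) : `|Im z| <= N z.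
Proof. by case: z => x y /=; rewrite -[`|y|]sqrtr_sqr ler_wsqrtr// lerDr sqr_ge0. Qed.

(** The image of an ultrafilter is an ultrafilter, and a compact segment makes it converge. *)
Lemma ultra_lim (U : set_system nat) (u : nat -> R) (b : R) : UltraFilter U ->
  (forall M, `|u M| <= b) -> exists2 l, `|l| <= b & u @ U --> l.
Proof.
move=> UU ub.
have UF : UltraFilter (u @ U).
  split; first exact: fmap_proper_filter.
  move=> G GG sub; rewrite predeqE => S; split; last exact: sub.
  move=> GS; have [//|nS] := in_ultra_setVsetC (u @^-1` S) UU.
  have GnS : G (~` S) by apply: sub.
  by have /filter_ex[? []] : G (S `&` ~` S) by exact: filterI.
have := @segment_compact R (- b) b; rewrite compact_ultra => /(_ _ UF).
have Ub : (u @ U) `[- b, b]%classic.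
  by apply: (@filterE _ U) => M /=; rewrite in_itv /= -ler_norml.
by move=> /(_ Ub)[l [lb ul]]; exists l => //; move: lb; rewrite /= in_itv /= -ler_norml.
Qed.

Lemma complex_ReM (z w : C) : Re (z * w) = Re z * Re w - Im z * Im w.
Proof. by case: z w => [x y] [x' y']. Qed.

Lemma Re_sum K (G : nat -> C) : Re (\sum_(0 <= k < K) G k) = \sum_(0 <= k < K) Re (G k).
Proof. by apply: (big_morph Re) => // -[x y] [x' y']. Qed.

Lemma cauchy_expansion (F F' : C -> C) a (rho B B0 : R) : 0 < rho ->
  (forall z, N (z - a) <= rho -> N (F' z) <= B) ->
  (forall z, N (z - a) <= rho -> N (F z) <= B0) ->
  (forall e, 0 < e -> exists2 d, 0 < d & uniform_diff F F' a rho e d) ->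
  exists c : nat -> C,
    (forall k, `|Re (c k)| <= B0 * rho^-1 ^+ k /\ `|Im (c k)| <= B0 * rho^-1 ^+ k) /\
    forall w, N w <= rho -> forall K, (0 < K)%N ->
      `|\sum_(0 <= k < K) Re (c k * w ^+ k) - Re (F (a + w))| <= rho * (B * N (w / rho%:C%C) ^+ K).
Proof.
move=> rho0 F'B FB H.
(* A single ultrafilter serves all coefficients at once, with no diagonal extraction. *)
have [U [UU sU]] := @ultraFilterLemma nat \oo _.
pose cc M k := cauchy_coef F a rho M.+1 k.
have ccB M k : N (cc M k) <= B0 * rho^-1 ^+ k by apply: cauchy_coef_bound => //; exact: F'B.
have /choice[cr crP] : forall k, exists l, `|l| <= B0 * rho^-1 ^+ k /\
    (fun M => Re (cc M k)) @ U --> l.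
  move=> k; have [l l1 l2] := ultra_lim UU (fun M => le_trans (Re_normc _) (ccB M k)).
  by exists l.
have /choice[ci ciP] : forall k, exists l, `|l| <= B0 * rho^-1 ^+ k /\
    (fun M => Im (cc M k)) @ U --> l.
  move=> k; have [l l1 l2] := ultra_lim UU (fun M => le_trans (Im_normc _) (ccB M k)).
  by exists l.
exists (fun k => (cr k +i* ci k)%C); split.
  by move=> k; have [] := crP k; have [] := ciP k.
move=> w wr K K0; set bnd := rho * (B * _).
apply/ler_addgt0Pr => e e0.
(* Chosen so that the discretisation error [rho * e1 * (1 + 2 * K%:R)] is exactly [e]. [K] is fixed
   while the number of roots grows. *)
pose e1 := e / (rho * (1 + 2 * K%:R)).
have K1 : 0 < 1 + 2 * K%:R :> R by rewrite ltr_pwDl// mulr_ge0.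
have e10 : 0 < e1 by rewrite divr_gt0// mulr_gt0.
have [d d0 Hd] := H _ e10.
have [M0 HM0] := omega_close (divr_gt0 d0 rho0).
have lim : (fun M => \sum_(0 <= k < K) Re (cc M k * w ^+ k)) @ U -->
    \sum_(0 <= k < K) Re ((cr k +i* ci k)%C * w ^+ k).
  elim: K {K0 bnd e1 K1 e10 Hd M0 HM0} => [|K IH].
    rewrite big_geq//; under eq_fun do rewrite big_geq//; exact: cvg_cst.
  rewrite big_nat_recr//=; under eq_fun do rewrite big_nat_recr//=.
  apply: cvgD; first exact: IH.
  rewrite complex_ReM; under eq_fun do rewrite complex_ReM.
  apply: cvgB; apply: cvgM; try exact: cvg_cst.
    by have [] := crP K.
  by have [] := ciP K.
have lim2 : (fun M => `|\sum_(0 <= k < K) Re (cc M k * w ^+ k) - Re (F (a + w))|) @ U -->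
    `|\sum_(0 <= k < K) Re ((cr k +i* ci k)%C * w ^+ k) - Re (F (a + w))|.
  by apply: cvg_norm; apply: cvgB lim _; exact: cvg_cst.
apply: (cvgr_to_le lim2).
have HU : U [set M | (M0 + K + 1 <= M)%N] by apply: sU; exists (M0 + K + 1)%N.
apply: filterS HU => M /= MM; rewrite -Re_sum -raddfB.
apply: (le_trans (Re_normc _)).
have MK : (K <= M.+1)%N by rewrite (leq_trans _ (leqW MM))// -addnA addnCA leq_addr.
have M1 : (1 < M.+1)%N by rewrite ltnS (leq_trans _ MM)// addn1.
have om : rho * N (omega M.+1 - 1) < d.
  rewrite mulrC -ltr_pdivlMr//; apply: HM0; apply: leq_trans (leqW MM).
  by rewrite -addnA leq_addr.
apply: (le_trans (cauchy_coef_approx rho0 F'B (ltW e10) d0 Hd M1 K0 MK wr om)).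
rewrite addrC lerD2l /e1 le_eqVlt; apply/orP; left; apply/eqP; field.
by rewrite !gt_eqF.
Qed.

End CauchyExpansion.

(** * Mean values and uniform continuity on boxes *)

Section Partials.
Context {R : realType}.

Lemma mvt_center (f df : R -> R) (m r a b : R) :
  (forall x, `|x - m| <= r -> is_derive x 1 f (df x)) -> `|a - m| <= r -> `|b - m| <= r ->
  exists c, [/\ `|c - m| <= r, `|c - a| <= `|b - a| & f b - f a = df c * (b - a)].
Proof.
move=> H.
have K x y : x <= y -> `|x - m| <= r -> `|y - m| <= r ->
    exists c, [/\ x <= c, c <= y, `|c - m| <= r & f y - f x = df c * (y - x)].
  move=> xy; rewrite !ler_norml => /andP[x1 x2] /andP[y1 y2].
  have seg c : c \in `[x, y] -> `|c - m| <= r.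
    by rewrite in_itv /= ler_norml => /andP[c1 c2]; apply/andP; split; lra.
  have [||c cI E] := @MVT_segment R f df x y xy.
  - by move=> c cI; apply: H; apply: seg; exact: subset_itv_oo_cc cI.
  - apply: derivable_within_continuous => c cI.
    by have [] := H c (seg c cI).
  by exists c; split; [rewrite (itvP cI)|rewrite (itvP cI)|exact: seg|].
move=> am bm; have [ab|/ltW ba] := leP a b.
  have [c [c1 c2 cm E]] := K a b ab am bm; exists c; split=> //.
  by rewrite !ger0_norm ?subr_ge0// lerD2r.
have [c [c1 c2 cm E]] := K b a ba bm am; exists c; split=> //.
  by rewrite !ler0_norm ?subr_le0// lerN2 lerD2r.
by rewrite -opprB E -mulrN opprB.
Qed.

Lemma is_derive_dalpha (u : CD R 1 -> CD R 0) (x y : R) : derivable u (x, y) ((1, 0) : CD R 1) ->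
  is_derive x 1 (fun t : R => u (t, y) : R) (dalpha u (x, y) : R).
Proof.
have E : (fun h : R => h^-1 *: ((u \o shift ((x, y) : CD R 1)) (h *: ((1, 0) : CD R 1)) - u (x, y))) =
   (fun h : R => h^-1 *: (((fun t : R => u (t, y) : R^o) \o shift x) (h *: (1 : R^o)) - u (x, y))).
  apply/funext => h /=; congr (_ *: (u _ - _)); congr (_, _).
  by rewrite -[RHS]add0r; congr (_ + _); exact: (@mulr0 R).
by rewrite /derivable /dalpha /derive E => H; apply: DeriveDef.
Qed.

Lemma is_derive_dbeta (u : CD R 1 -> CD R 0) (x y : R) : derivable u (x, y) ((0, 1) : CD R 1) ->
  is_derive y 1 (fun t : R => u (x, t) : R) (dbeta u (x, y) : R).
Proof.
have E : (fun h : R => h^-1 *: ((u \o shift ((x, y) : CD R 1)) (h *: ((0, 1) : CD R 1)) - u (x, y))) =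
   (fun h : R => h^-1 *: (((fun t : R => u (x, t) : R^o) \o shift y) (h *: (1 : R^o)) - u (x, y))).
  apply/funext => h /=; congr (_ *: (u _ - _)); congr (_, _).
  by rewrite -[RHS]add0r; congr (_ + _); exact: (@mulr0 R).
by rewrite /derivable /dbeta /derive E => H; apply: DeriveDef.
Qed.

Definition box (z0 : CD R 1) (r : R) : set (CD R 1) :=
  [set z | `|(z.1 : R) - z0.1| <= r /\ `|(z.2 : R) - z0.2| <= r].

Lemma box_compact z0 r : compact (box z0 r).
Proof.
have -> : box z0 r = (`[z0.1 - r, z0.1 + r] `*` `[z0.2 - r, z0.2 + r])%classic.
  by apply/seteqP; split=> -[x y] /=; rewrite !in_itv /= -!ler_distl; move=> [].
by apply: compact_setX; exact: segment_compact.
Qed.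

(** As [g] is continuous in the whole plane at points of [K], the second point need not lie in
    [K]. *)
Lemma uniform_continuity (K : set (CD R 1)) (g : CD R 1 -> CD R 0) : compact K ->
  (forall z, K z -> {for z, continuous g}) -> forall e, 0 < e ->
  exists2 d, 0 < d & forall z z', K z -> `|z - z'| < d -> `|g z - g z'| < e.
Proof.
rewrite compact_near_coveringP => cK gc e e0.
pose P (d : R) z := forall z', `|z - z'| < d -> `|g z - g z'| < e.
have [|d [d0 Pd]] := @filter_ex _ (0^'+) _ (fun d => 0 < d /\ K `<=` P d).
  apply: filterI; first exact: nbhs_right_gt.
  apply: (cK R (0^'+) P _) => x Kx.
  have /cvgrPdist_lt/(_ _ (divr_gt0 e0 (ltr0Sn _ 1))) := gc x Kx.
  rewrite near_nbhs => /nbhs_normP[r /= r0 Hr].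
  have r2 : 0 < r / 2 by rewrite divr_gt0.
  exists (ball x (r / 2), [set d | d <= r / 2]).
    by split=> /=; [exact: nbhsx_ballx|exact: nbhs_right_le].
  move=> [x' d] /= [xx' dr] z' zd; rewrite -ball_normE /= in xx'.
  have h1 : `|g x - g x'| < e / 2 by apply: Hr => /=; apply: lt_le_trans xx' _; lra.
  have h2 : `|g x - g z'| < e / 2.
    apply: Hr => /=; have -> : x - z' = (x - x') + (x' - z') by rewrite addrA subrK.
    by apply: (le_lt_trans (ler_normD _ _)); lra.
  have -> : g x' - g z' = (g x' - g x) + (g x - g z') by rewrite addrA subrK.
  apply: (le_lt_trans (ler_normD _ _)).
  by rewrite distrC; lra.
by exists d => // z z' Kz; exact: Pd.
Qed.

Lemma compact_bound (K : set (CD R 1)) (g : CD R 1 -> CD R 0) : compact K ->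
  (forall z, K z -> {for z, continuous g}) ->
  exists2 B, 0 <= B & forall z, K z -> `|g z| <= B.
Proof.
move=> cK gc.
have : bounded_set (g @` K).
  apply: compact_bounded; apply: continuous_compact cK.
  by apply: continuous_in_subspaceT => x; rewrite inE => /gc.
move=> /ex_strict_bound_gt0[B B0 H]; exists B; first exact: ltW.
by move=> z Kz; apply/ltW/H; exists z.
Qed.

End Partials.

Section HolomorphicAnalytic.
Context {R : realType}.
Notation C := R[i].
Notation N := (@Normc.normc R).
Notation Re := (@complex.Re R).
Notation Im := (@complex.Im R).

Lemma normc_le_sum (z : C) : N z <= `|Re z| + `|Im z|.
Proof.
have -> : z = (Re z)%:C%C + 'i%C * (Im z)%:C%C.
  case: z => x y; apply/eqP; rewrite eq_complex /=
    !(mul0r, mul1r, subr0, addr0, add0r, sub0r, oppr0).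
  by rewrite !eqxx.
apply: (le_trans (le_normcD _ _)); rewrite Normc.normcM !normc_real.
by rewrite /= !(mul0r, mul1r, subr0, addr0, add0r, sub0r, oppr0, expr0n, expr1n) sqrtr1 mul1r.
Qed.

Lemma complex_ReB (z w : C) : Re (z - w) = Re z - Re w. Proof. by case: z w => [x y] []. Qed.
Lemma complex_ImB (z w : C) : Im (z - w) = Im z - Im w. Proof. by case: z w => [x y] []. Qed.
Lemma complex_ImM (z w : C) : Im (z * w) = Re z * Im w + Im z * Re w.
Proof. by case: z w => [x y] []. Qed.

Section Local.
Variables (u : CD R 1 -> CD R 0) (z0 : CD R 1) (r : R).
Hypotheses (r0 : 0 < r) (uC : C1 (box z0 r) u).

Lemma C1_increment z z' : box z0 r z -> box z0 r z' -> exists p q : CD R 1,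
  [/\ box z0 r p, box z0 r q, `|p - z| <= `|z' - z|, `|q - z| <= `|z' - z| &
    (u z' : R) - u z = (dalpha u p : R) * ((z'.1 : R) - z.1) + (dbeta u q : R) * ((z'.2 : R) - z.2)].
Proof.
case: z z' => [x y] [x' y'] [/= x1 y1] [/= x2 y2].
have [c [c1 c2 c3]] := @mvt_center R (fun t => u (t, y') : R) (fun t => dalpha u (t, y') : R) _ _ _ _
  (fun t ht => is_derive_dalpha (let: And4 a _ _ _ := uC (conj ht y2 : box z0 r (t, y')) in a)) x1 x2.
have [d [d1 d2 d3]] := @mvt_center R (fun t => u (x, t) : R) (fun t => dbeta u (x, t) : R) _ _ _ _
  (fun t ht => is_derive_dbeta (let: And4 _ a _ _ := uC (conj x1 ht : box z0 r (x, t)) in a)) y1 y2.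
exists (c, y'), (x, d); split=> //.
- rewrite (@cd_norm_pair R 0 ((c, y') - (x, y))) (@cd_norm_pair R 0 ((x', y') - (x, y))) /=.
  by rewrite ge_max !le_max c2 lexx orbT.
- rewrite (@cd_norm_pair R 0 ((x, d) - (x, y))) (@cd_norm_pair R 0 ((x', y') - (x, y))) /=.
  by rewrite ge_max !le_max d2 subrr normr0 normr_ge0 orbT.
by rewrite -c3 -d3 addrA subrK.
Qed.

Lemma C1_uniform_increment e : 0 < e -> exists2 d, 0 < d & forall z z',
  box z0 r z -> box z0 r z' -> `|z' - z| < d ->
  `|(u z' : R) - u z - ((dalpha u z : R) * ((z'.1 : R) - z.1) + (dbeta u z : R) * ((z'.2 : R) - z.2))|
    <= e * (`|(z'.1 : R) - z.1| + `|(z'.2 : R) - z.2|).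
Proof.
move=> e0; have cK := @box_compact R z0 r.
have [z /uC[]//|d1 d10 H1] := uniform_continuity (g := dalpha u) cK _ e0.
have [z /uC[]//|d2 d20 H2] := uniform_continuity (g := dbeta u) cK _ e0.
exists (Num.min d1 d2); first by rewrite (lt_min _ d1 d2) d10.
move=> z z' Kz Kz'; rewrite (lt_min _ d1 d2) => /andP[zd1 zd2].
have [p [q [Kp Kq pz qz ->]]] := C1_increment Kz Kz'.
set A := dalpha u p : R; set A' := dalpha u z : R; set B := dbeta u q : R; set B' := dbeta u z : R.
have hA : `|A - A'| <= e by apply/ltW/H1 => //; exact: le_lt_trans zd1.
have hB : `|B - B'| <= e by apply/ltW/H2 => //; exact: le_lt_trans zd2.
set dx := (z'.1 : R) - _; set dy := (z'.2 : R) - _.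
have -> : A * dx + B * dy - (A' * dx + B' * dy) = (A - A') * dx + (B - B') * dy by ring.
apply: (le_trans (ler_normD _ _)); rewrite !normrM mulrDr.
clearbody A A' B B' dx dy.
by apply: lerD; rewrite ler_wpM2r// normr_ge0.
Qed.

Lemma C1_bounded : exists2 B, 0 <= B &
  forall z, box z0 r z -> [/\ `|u z : R| <= B, `|dalpha u z : R| <= B & `|dbeta u z : R| <= B].
Proof.
have cK := @box_compact R z0 r.
have [z /uC[]//|B1 B10 H1] := compact_bound (g := dalpha u) cK _.
have [z /uC[]//|B2 B20 H2] := compact_bound (g := dbeta u) cK _.
have U0 := normr_ge0 (u z0 : R).
exists (`|u z0 : R| + B1 * r + B2 * r + B1 + B2); first by rewrite !addr_ge0// mulr_ge0// ltW.
have B1r : 0 <= B1 * r by rewrite mulr_ge0// ltW.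
have B2r : 0 <= B2 * r by rewrite mulr_ge0// ltW.
move=> z Kz; have h1 : `|dalpha u z : R| <= B1 by exact: H1.
have h2 : `|dbeta u z : R| <= B2 by exact: H2.
split; [|apply: (le_trans h1)|apply: (le_trans h2)].
  2,3: move: U0 B1r B2r B10 B20; move: (B1 * r) (B2 * r) `|u z0 : R|.
  2,3: by clear=> *; lra.
have Kz0 : box z0 r z0 by split; rewrite subrr normr0 ltW.
have [p [q [Kp Kq _ _ E]]] := C1_increment Kz0 Kz.
have {E} -> : (u z : R) = (u z0 : R) + (dalpha u p : R) * ((z.1 : R) - z0.1) +
   (dbeta u q : R) * ((z.2 : R) - z0.2) by rewrite -addrA -E addrC subrK.
apply: (le_trans (ler_normD _ _)); rewrite normrM.
have := ler_normD (u z0 : R) ((dalpha u p : R) * ((z.1 : R) - z0.1)); rewrite normrM.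
case: Kz => k1 k2.
have : `|dalpha u p : R| * `|(z.1 : R) - z0.1| <= B1 * r by apply: ler_pM => //; exact: H1.
have : `|dbeta u q : R| * `|(z.2 : R) - z0.2| <= B2 * r by apply: ler_pM => //; exact: H2.
move: U0 B1r B2r B10 B20; move: (B1 * r) (B2 * r) (dalpha u p : R) (dbeta u q : R)
  (u z0 : R) => b1 b2 a b c.
move: (_ * _) (`|a| * _) (`|b| * _) => x y z1.
by clear=> *; lra.
Qed.

End Local.

(** Multiplying by [h.1 + i h.2] replaces [c] by [c] and [i c], which have the same size; hence the
    factor 2 per degree. *)
Lemma hpoly_complex_power k (c : C) :
  hpoly k ((`|Re c| + `|Im c|) * 2 ^+ k)
    (fun h : CD R 1 => Re (c * ((h.1 : R) +i* (h.2 : R))%C ^+ k) : CD R 0).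
Proof.
elim: k c => [|k IH] c.
  exists (Re c : CD R 0); first by rewrite expr0 mulr1 lerDl.
  by move=> h; rewrite expr0 mulr1.
have i0 : (0 < 2 ^ 1)%N by []. have i1 : (1 < 2 ^ 1)%N by [].
have H1 := hpoly_co (Ordinal i0) (IH c).
have H2 := hpoly_co (Ordinal i1) (IH ('i%C * c)).
have := hpolyD H1 H2; have -> : (`|Re c| + `|Im c|) * 2 ^+ k +
    (`|Re ('i%C * c)| + `|Im ('i%C * c)|) * 2 ^+ k = (`|Re c| + `|Im c|) * 2 ^+ k.+1.
  have -> : Re ('i%C * c) = - Im c by case: (c) => x y /=; rewrite mul0r mul1r sub0r.
  have -> : Im ('i%C * c) = Re c by case: (c) => x y /=; rewrite mul0r mul1r add0r.
  by rewrite normrN exprS; ring.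
apply: hpoly_ext => h; rewrite exprS.
have -> : c * (((h.1 : R) +i* (h.2 : R))%C * ((h.1 : R) +i* (h.2 : R))%C ^+ k) =
  (h.1 : R)%:C%C * (c * ((h.1 : R) +i* (h.2 : R))%C ^+ k) +
  (h.2 : R)%:C%C * ('i%C * c * ((h.1 : R) +i* (h.2 : R))%C ^+ k).
  have -> : ((h.1 : R) +i* (h.2 : R))%C = (h.1 : R)%:C%C + 'i%C * (h.2 : R)%:C%C.
    by apply/eqP; rewrite eq_complex /= !(mul0r, mul1r, subr0, addr0, add0r, sub0r, oppr0) !eqxx.
  by set w := _ ^+ k; ring.
have Rr (a : R) (z : C) : Re (a%:C%C * z) = a * Re z by case: z => x y /=; rewrite mul0r subr0.
have RD (z w : C) : Re (z + w) = Re z + Re w by case: z w => [x y] [].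
by rewrite RD !Rr.
Qed.

Lemma holomorphic_an (u v : CD R 1 -> CD R 0) (D : set (CD R 1)) z0 : open D -> D z0 ->
  C1 D u -> C1 D v -> (forall z, D z -> dalpha u z = dbeta v z /\ dbeta u z = - dalpha v z) ->
  an u z0.
Proof.
move=> oD Dz0 uC vC CR.
have [r r0 rD] : exists2 r, 0 < r & box z0 r `<=` D.
  have /nbhs_normP[r /= r0 H] := open_nbhs_nbhs (conj oD Dz0).
  exists (r / 2); first by rewrite divr_gt0.
  move=> z [z1 z2]; apply: H => /=; rewrite (@cd_norm_pair R 0 (z0 - z)) gt_max /=.
  have r2 : r / 2 < r by lra.
  rewrite -(distrC (z.1 : R)) -(distrC (z.2 : R)).
  by rewrite (le_lt_trans z1 r2) (le_lt_trans z2 r2).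
have {}uC : C1 (box z0 r) u by move=> z /rD; exact: uC.
have {}vC : C1 (box z0 r) v by move=> z /rD; exact: vC.
have {D oD Dz0 rD}CR z : box z0 r z -> dalpha u z = dbeta v z /\ dbeta u z = - dalpha v z.
  by move=> /rD; exact: CR.
pose pt (z : C) : CD R 1 := (Re z, Im z).
pose F z : C := ((u (pt z) : R) +i* (v (pt z) : R))%C.
pose F' z : C := ((dalpha u (pt z) : R) +i* (dalpha v (pt z) : R))%C.
pose a : C := ((z0.1 : R) +i* (z0.2 : R))%C.
have disc z : N (z - a) <= r -> box z0 r (pt z).
  move=> h; split; apply: le_trans h.
    by apply: le_trans (Re_normc _); rewrite complex_ReB.
  by apply: le_trans (Im_normc _); rewrite complex_ImB.
have [Bu Bu0 uB] := C1_bounded r0 uC; have [Bv Bv0 vB] := C1_bounded r0 vC.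
have F'B z : N (z - a) <= r -> N (F' z) <= Bu + Bv.
  move=> /disc h; apply: (le_trans (normc_le_sum _)).
  by have [_ b1 _] := uB _ h; have [_ b2 _] := vB _ h; exact: (lerD b1 b2).
have FB z : N (z - a) <= r -> N (F z) <= Bu + Bv.
  move=> /disc h; apply: (le_trans (normc_le_sum _)).
  by have [b1 _ _] := uB _ h; have [b2 _ _] := vB _ h; exact: (lerD b1 b2).
have diff e : 0 < e -> exists2 d, 0 < d & uniform_diff F F' a r e d.
  (* Two components, each with an error over two coordinate increments: four contributions of
     [e / 4]. *)
  move=> e0; have e4 : 0 < e / 4 by rewrite divr_gt0.
  have [d1 d10 H1] := C1_uniform_increment uC e4; have [d2 d20 H2] := C1_uniform_increment vC e4.
  exists (Num.min d1 d2); first by rewrite (lt_min _ d1 d2) d10.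
  move=> z z' za za'; rewrite (lt_min _ d1 d2) => /andP[zd1 zd2].
  have Kz := disc _ za; have Kz' := disc _ za'.
  have ptB : `|pt z' - pt z| <= N (z' - z).
    rewrite (@cd_norm_pair R 0 (pt z' - pt z)) ge_max.
    by have := Re_normc (z' - z); have := Im_normc (z' - z); rewrite complex_ReB complex_ImB => -> ->.
  have h1 := Re_normc (z' - z); have h2 := Im_normc (z' - z).
  have := H2 _ _ Kz Kz' (le_lt_trans ptB zd2); have := H1 _ _ Kz Kz' (le_lt_trans ptB zd1).
  have [<- ->] := CR _ Kz; rewrite /= -complex_ReB -complex_ImB => k1 k2.
  apply: (le_trans (normc_le_sum _)).
  have -> : Re (F z' - F z - F' z * (z' - z)) = (u (pt z') : R) - u (pt z) -
     ((dalpha u (pt z) : R) * Re (z' - z) + (- dalpha v (pt z) : R) * Im (z' - z)).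
    by rewrite (complex_ReB (F z' - F z)) (complex_ReB (F z')) complex_ReM /= mulNr.
  have -> : Im (F z' - F z - F' z * (z' - z)) = (v (pt z') : R) - v (pt z) -
     ((dalpha v (pt z) : R) * Re (z' - z) + (dalpha u (pt z) : R) * Im (z' - z)).
    by rewrite (complex_ImB (F z' - F z)) (complex_ImB (F z')) complex_ImM /=;
      congr (_ - _); rewrite addrC; congr (_ + _); exact: mulrC.
  apply: (le_trans (lerD k1 k2)).
  move: h1 h2; move: (`|Re _|) (`|Im _|) (N _) => x y n h1 h2.
  clear -e0 h1 h2; have : e * x <= e * n by rewrite ler_wpM2l// ltW.
  have : e * y <= e * n by rewrite ler_wpM2l// ltW.
  by lra.
have [c [cB cE]] := cauchy_expansion r0 F'B FB diff.
have B0 : 0 <= Bu + Bv by exact: addr_ge0.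
exists (fun k (h : CD R 1) => Re (c k * ((h.1 : R) +i* (h.2 : R))%C ^+ k) : CD R 0).
(* The rate joins the Cauchy bound [r^-1] with the factor 2 of [hpoly_complex_power], and the
   leading 2 counts real and imaginary parts. For [|h| < r / 4] the complex point has modulus at
   most [r / 2], so the remainder decays like [2^-K]. *)
exists (2 * (Bu + Bv)), (2 / r), (r / 4); split.
- by split; rewrite ?mulr_ge0 ?divr_gt0.
- move=> k; apply: hpoly_le (hpoly_complex_power k (c k)).
  have [c1 c2] := cB k.
  have -> : 2 * (Bu + Bv) * (2 / r) ^+ k = ((Bu + Bv) * r^-1 ^+ k + (Bu + Bv) * r^-1 ^+ k) * 2 ^+ k.
    by rewrite exprMn; ring.
  by rewrite ler_wpM2r// ?exprn_ge0// lerD.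
move=> h hr; set w : C := ((h.1 : R) +i* (h.2 : R))%C.
have wr : N w <= r / 2.
  apply: (le_trans (normc_le_sum _)) => /=.
  have : `|h.1 : R| <= `|h| by rewrite (@cd_norm_pair R 0 h) le_max lexx.
  have : `|h.2 : R| <= `|h| by rewrite (@cd_norm_pair R 0 h) le_max lexx orbT.
  by lra.
have uE : u (z0 + h) = Re (F (a + w)) by [].
have half : 0 <= 2^-1 :> R by [].
apply: (@cvg_geo_close _ _ (fun=> u (z0 + h)) _ _ (r * (Bu + Bv) + `|u (z0 + h)|) 2^-1
  half (lexx _)); last exact: cvg_cst.
have rB : 0 <= r * (Bu + Bv) by rewrite mulr_ge0// ltW.
case=> [|K].
  by rewrite expr0 mulr1 /series /= big_geq// sub0r normrN lerDr.
have wr' : N w <= r by lra.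
have := cE w wr' K.+1 isT; rewrite -uE => h1.
apply: (le_trans h1); apply: (@le_trans _ _ (r * (Bu + Bv) * 2^-1 ^+ K.+1)); last first.
  by rewrite ler_wpM2r ?exprn_ge0// lerDl.
rewrite mulrA ler_wpM2l// lerXn2r ?nnegrE ?normc_ge0//.
rewrite Normc.normcM Normc.normcV normc_real gtr0_norm// ler_pdivrMr//.
by apply: (le_trans wr); rewrite mulrC.
Qed.

End HolomorphicAnalytic.

Section RegularAnalytic.
Context {R : realType}.

Lemma derive_bounded_linear n p (L : CD R n -> CD R p) K (F : CD R 1 -> CD R n) z v :
  bounded_linear L K -> derivable F z v ->
  derivable (fun x => L (F x)) z v /\ 'D_v (fun x => L (F x)) z = L ('D_v F z).
Proof.
move=> bL dF; have [LD LZ _] := bL.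
have cv : (fun h : R => h^-1 *: (((fun x => L (F x)) \o shift z) (h *: v) - L (F z))) @ 0^' -->
    L ('D_v F z).
  rewrite (_ : (fun h : R => _) = fun h : R => L (h^-1 *: ((F \o shift z) (h *: v) - F z))).
    exact: (cvg_bounded_linear bL dF).
  by apply/funext => h; rewrite LZ (bounded_linearB _ _ bL).
split; first by apply/cvg_ex; exists (L ('D_v F z)).
exact: cvg_lim cv.
Qed.

Lemma C1_bounded_linear n p (L : CD R n -> CD R p) K (D : set (CD R 1)) (F : CD R 1 -> CD R n) :
  open D -> bounded_linear L K -> C1 D F -> C1 D (fun x => L (F x)).
Proof.
move=> oD bL H z Dz; have [d1 d2 c1 c2] := H z Dz.
have [e1 _] := derive_bounded_linear bL d1; have [e2 _] := derive_bounded_linear bL d2.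
have nD : \forall x \near z, D x by exact: open_nbhs_nbhs.
split; [exact: e1|exact: e2| | ].
  have E : \forall x \near z, dalpha (fun x => L (F x)) x = L (dalpha F x).
    by apply: filterS nD => x /H[d _ _ _]; have [_ e] := derive_bounded_linear bL d.
  have C : dalpha (fun x => L (F x)) @ z --> (L (dalpha F z) : CD R p).
    by refine (cvg_near_eq E _); apply: cvg_bounded_linear bL c1.
  by move: C; rewrite -(nbhs_singleton E).
have E : \forall x \near z, dbeta (fun x => L (F x)) x = L (dbeta F x).
  by apply: filterS nD => x /H[_ d _ _]; have [_ e] := derive_bounded_linear bL d.
have C : dbeta (fun x => L (F x)) @ z --> (L (dbeta F z) : CD R p).
  by refine (cvg_near_eq E _); apply: cvg_bounded_linear bL c2.
by move: C; rewrite -(nbhs_singleton E).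
Qed.

Lemma an_sum m n (I : Type) (r : seq I) (f : I -> CD R m -> CD R n) a :
  (forall i, an (f i) a) -> an (fun x => \sum_(i <- r) f i x) a.
Proof.
move=> H; elim: r => [|i r IH].
  rewrite (_ : (fun x => _) = fun=> 0); first exact: an_cst.
  by apply/funext => x; rewrite big_nil.
rewrite (_ : (fun x => _) = fun x => f i x + \sum_(i <- r) f i x); first exact: anD.
by apply/funext => x; rewrite big_cons.
Qed.

Lemma an_co m n (f : CD R m -> CD R n) a :
  (forall i, an (fun x => co (f x) i : CD R 0) a) -> an f a.
Proof.
move=> H; have [b bE] := cd_basis (R := R) n.
rewrite (_ : f = fun x => \sum_(i < 2 ^ n) cdscale (co (f x) i) (b i)).
  by apply: an_sum => i; apply: an_cdscale (an_cst _ _); exact: H.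
by apply/funext => x; rewrite {1}(bE (f x)).
Qed.

Lemma holomorphic_analytic n (F1 F2 : CD R 1 -> CD R n) (D : set (CD R 1)) : open D ->
  C1 D F1 -> C1 D F2 ->
  (forall z, D z -> dalpha F1 z = dbeta F2 z /\ dbeta F1 z = - dalpha F2 z) ->
  forall z, D z -> an F1 z /\ an F2 z.
Proof.
move=> oD C1F C2F CR z Dz.
have dco (F : CD R 1 -> CD R n) i : C1 D F -> forall x, D x ->
    dalpha (fun x => co (F x) i : CD R 0) x = co (dalpha F x) i /\
    dbeta (fun x => co (F x) i : CD R 0) x = co (dbeta F x) i.
  move=> H x /H[d1 d2 _ _].
  have [_ e1] := derive_bounded_linear (co_linear i) d1.
  by have [_ e2] := derive_bounded_linear (co_linear i) d2.
have coN (x : CD R n) i : co (- x) i = - co x i by rewrite -scaleN1r coZ mulN1r.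
split; apply: an_co => i.
  apply: (holomorphic_an (v := fun x => co (F2 x) i) oD Dz).
  - exact: C1_bounded_linear (co_linear i) _.
  - exact: C1_bounded_linear (co_linear i) _.
  move=> x Dx; have [-> ->] := dco _ i C1F x Dx; have [-> ->] := dco _ i C2F x Dx.
  by have [-> ->] := CR x Dx.
(* The second component is the real part of -i (F1 + i F2) = F2 - i F1, so its conjugate partner is
   - F1. *)
have C1N : C1 D (fun x => (-1) *: F1 x).
  exact: C1_bounded_linear (bounded_linear_id n (-1)) _.
apply: (holomorphic_an (v := fun x => co ((-1) *: F1 x) i) oD Dz).
- exact: C1_bounded_linear (co_linear i) _.
- exact: C1_bounded_linear (co_linear i) _.
move=> x Dx; have [-> ->] := dco _ i C1N x Dx; have [-> ->] := dco _ i C2F x Dx.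
have [d1 d2 _ _] := C1F x Dx.
have [_ h1] := derive_bounded_linear (bounded_linear_id n (-1)) d1.
have [_ h2] := derive_bounded_linear (bounded_linear_id n (-1)) d2.
have [e1 e2] := CR x Dx.
have -> : dalpha (fun x => (-1) *: F1 x) x = - dbeta F2 x by rewrite /dalpha h1 scaleN1r -e1.
have -> : dbeta (fun x => (-1) *: F1 x) x = dalpha F2 x by rewrite /dbeta h2 scaleN1r -[RHS]opprK -e2.
by rewrite coN opprK.
Qed.

Lemma slice_regular_analytic n (Om : set (CD R n)) h : slice_regular Om h -> slice_analytic Om h.
Proof.
move=> [cO oP [F [sF c1 c2 CR]]]; split=> //; exists F.
have H := holomorphic_analytic oP c1 c2 CR.
by split=> //; split=> // z /H[] *; exact: an_real_analytic_at.
Qed.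

End RegularAnalytic.

(** * The maps T *)

Section NonrealDomain.
Context {R : realType} {n : nat}.
Notation A := (CD R n).
Notation stemT := ((CD R 1 -> A) * (CD R 1 -> A))%type.
Implicit Types (z : CD R 1) (J x : A) (f g : A -> A) (F : stemT).
Hypothesis n3 : (n <= 3)%N.
Hypothesis n0 : (0 < n)%N.

Section SphericalDomain.
Variables (Om0 Om1 : set A) (f : A -> A) (F : stemT).
Hypotheses (cO0 : circular Om0) (cO1 : circular Om1) (sub : Om1 `<=` Om0).
Hypothesis sF : is_stem Om0 f F.

Let U := Om1 `\` (cdreal `|` zeros_sd Om0 f).

Lemma plane_sub z : plane Om1 z -> plane Om0 z.
Proof. by move=> [J JS /sub ?]; exists J. Qed.

Lemma spherical_domainP z J : imunits J ->
  U (slice_point z J) <-> [/\ plane Om1 z, z.2 != 0 :> R & F.2 z != 0].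
Proof.
move=> JS; rewrite /U /zeros_sd /zeros /=; split.
  move=> [Ox1 /not_orP[nr ns]]; have p1 : plane Om1 z by exists J.
  have z2 : z.2 != 0 :> R by apply/eqP => /(cdreal_slice z JS).
  split=> //; apply/eqP => F0; apply: ns; split; first by split=> //; exact: sub.
  by rewrite (spherical_derivativeE n3 cO0 sF (plane_sub p1) JS z2) F0 scaler0.
move=> [p1 z2 F0]; split; first exact/(circularP _ cO1 JS).
case=> [/(cdreal_slice z JS) z20|[_ /eqP]]; first by rewrite z20 eqxx in z2.
rewrite (spherical_derivativeE n3 cO0 sF (plane_sub p1) JS z2) scaler_eq0 invr_eq0.
by rewrite (negbTE z2) (negbTE F0).
Qed.

Lemma spherical_domain_twistable : (forall z, plane Om1 z -> normsq (stemval F z) != 0) ->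
  twistable Om0 f F (spherical_derivative f) U.
Proof.
move=> u0; split=> // z J JS /(spherical_domainP z JS)[p1 z2 F0].
rewrite (spherical_derivativeE n3 cO0 sF (plane_sub p1) JS z2) scalerA mulfV// scale1r.
split; [exact: plane_sub|exact: u0| |by []|].
  by rewrite scaler_eq0 invr_eq0 (negbTE z2).
by move=> I IS; apply/(spherical_domainP z IS).
Qed.

Lemma spherical_domain_continuous :
  slice_continuous U f -> {within plane U, continuous F.1} /\ {within plane U, continuous F.2}.
Proof.
move=> [cU [G [sG c1 c2]]].
have sFU : is_stem U f F by apply: is_stem_sub sF => x [/sub].
have E : {in plane U, F.1 =1 G.1} /\ {in plane U, F.2 =1 G.2}.
  by split=> z; rewrite inE => Uz; have [] := stem_unique n3 sFU sG Uz.
split.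
  by apply: subspace_eq_continuous c1 => z zU; exact/esym/E.1.
by apply: subspace_eq_continuous c2 => z zU; exact/esym/E.2.
Qed.

Lemma spherical_domain_polar : (forall x, U x -> ~ cdreal x) /\ (forall x, U x -> plane U (polar x)).
Proof.
have H x : U x -> ~ cdreal x by move=> [_ /not_orP[]].
split=> // x Ux; have [JS xE] := cddirP n0 (H x Ux).
by exists (cddir x); rewrite -?xE.
Qed.

End SphericalDomain.

Section ReciprocalDomain.
Variables (Om : set A) (f : A -> A) (F : stemT).
Hypotheses (cO : circular Om) (sF : is_stem Om f F).
Let Om' := Om `\` zeros Om (slice_normal Om f).
Hypothesis ne : Om' !=set0.
Let g := reciprocal Om' f.

Lemma sub_domain : Om' `<=` Om. Proof. by move=> x []. Qed.

Lemma domain_circular : circular Om'. Proof. exact: (normal_domain_circular n3 n0 cO sF). Qed.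

Lemma domain_normsq z : plane Om' z -> normsq (stemval F z) != 0.
Proof. by move=> [J JS /(normal_domain n3 z cO sF JS)[]]. Qed.

Lemma domain_stem : is_stem Om' f F. Proof. exact: is_stem_sub sub_domain sF. Qed.

Lemma reciprocal_stem : is_stem Om' g (sinv F).
Proof. exact: (is_stem_reciprocal n3 domain_circular domain_stem domain_normsq). Qed.

Lemma sinv_normsq z : plane Om' z -> normsq (stemval (sinv F) z) != 0.
Proof. by move=> /domain_normsq u0; rewrite stemval_sinv normsq_inv// invr_eq0. Qed.

(** The complex norm of the reciprocal is the inverse of that of [f], so it has no zeros and no
    further points are removed. *)
Lemma reciprocal_domain : Om' `\` zeros Om' (slice_normal Om' g) = Om'.
Proof.
apply/seteqP; split=> [x []//|x Ox].
have [J JS xE] := cd_polar x n0; rewrite xE in Ox *.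
have p : plane Om' (polar x) by exists J.
by apply/(normal_domain n3 _ domain_circular reciprocal_stem JS); split=> //; exact: sinv_normsq.
Qed.

Lemma sinv2_eq0 z : plane Om' z -> ((sinv F).2 z == 0) = (F.2 z == 0).
Proof.
move=> /domain_normsq u0; have := cddot_cxinv2 u0.
rewrite -[(cxinv _).2]/((sinv F).2 z) -[(stemval F z).2]/(F.2 z) => E.
by rewrite -cddot_eq0 E mulf_eq0 invr_eq0 (negbTE u0) orbF cddot_eq0.
Qed.

Lemma reciprocal_spherical_domain :
  Om' `\` (cdreal `|` zeros_sd Om f) = Om' `\` (cdreal `|` zeros_sd Om' g).
Proof.
apply/seteqP; split=> x; have [J JS ->] := cd_polar x n0.
  move=> /(spherical_domainP cO domain_circular sub_domain sF _ JS)[p z2 F2].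
  apply/(spherical_domainP domain_circular domain_circular _ reciprocal_stem _ JS) => //.
  by rewrite sinv2_eq0.
move=> /(spherical_domainP domain_circular domain_circular (@subset_refl _ _)
    reciprocal_stem _ JS)[p z2 F2].
apply/(spherical_domainP cO domain_circular sub_domain sF _ JS).
by rewrite sinv2_eq0 in F2.
Qed.

Lemma domain_value x : Om' x -> f x != 0 /\ slice_conj Om f x != 0.
Proof.
move=> Ox; have [J JS xE] := cd_polar x n0; rewrite xE in Ox *.
have p : plane Om' (polar x) by exists J.
have pO : plane Om (polar x) by exact: plane_sub sub_domain _ p.
have u0 := domain_normsq p.
rewrite (slice_conj_val n3 cO sF pO JS) (is_stem_val sF pO JS); split.
  by apply/eqP => /(cxval_eq0 n3 JS) /eqP; rewrite (negbTE u0).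
by apply/eqP => /(cxval_eq0 n3 JS) /eqP; rewrite normsq_conj (negbTE u0).
Qed.

Lemma reciprocal_degenerate x : (Om' `&` (cdreal `|` zeros_sd Om f)) x ->
  g x = cdinv (f x) /\ forall y, sphere x y -> cdinv (f x) = cdinv (f y).
Proof.
move=> [Ox deg]; have [J JS xE] := cd_polar x n0; rewrite xE in Ox deg *.
have p : plane Om' (polar x) by exists J.
have pO : plane Om (polar x) by exact: plane_sub sub_domain _ p.
(* Degenerate points are those where the odd component vanishes: by parity on the axis, by the
   vanishing spherical derivative off it. So [f] is constant on the sphere. *)
have F2 : F.2 (polar x) = 0.
  have [z2|z2] := eqVneq ((polar x).2 : R) 0; first exact: stem_real (is_stem_sym sF) pO z2.
  apply/eqP/negPn/negP => F0.
  have [_ []//] : (Om' `\` (cdreal `|` zeros_sd Om f)) (slice_point (polar x) J).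
  by apply/(spherical_domainP cO domain_circular sub_domain sF _ JS).
have fE I : imunits I -> f (slice_point (polar x) I) = F.1 (polar x).
  move=> IS; rewrite (is_stem_val sF pO IS) /cxval /= F2.
  by rewrite cdmul0r addr0.
split.
  rewrite fE// (is_stem_val reciprocal_stem p JS) stemval_sinv /cxval /cxinv /=
    /normsq /normre /normim /= F2.
  set a := F.1 (polar x).
  rewrite cddot0l cddot0r mulr0 subr0 expr0n addr0 !scale0r cdconj0 scaler0 subr0 scaler0
    cdmul0r !addr0.
  have a0 : a != 0 by have [] := domain_value Ox; rewrite fE.
  by rewrite scalerA /cdinv expr2 invfM -mulrA mulVf ?mulr1// cddot_eq0.
by move=> y /(sphereP _ _ JS)[I IS ->]; rewrite !fE.
Qed.

Let Om'' := Om' `\` (cdreal `|` zeros_sd Om f).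

Lemma twistable_domain : twistable Om f F (spherical_derivative f) Om''.
Proof.
exact: (spherical_domain_twistable cO domain_circular sub_domain sF domain_normsq).
Qed.

Lemma twistable_reciprocal : twistable Om' g (sinv F) (spherical_derivative g) Om''.
Proof.
rewrite /Om'' reciprocal_spherical_domain.
exact: (spherical_domain_twistable domain_circular domain_circular (@subset_refl _ _)
  reciprocal_stem sinv_normsq).
Qed.

Lemma homeomorphism_Tmap : slice_continuous Om'' f ->
  homeomorphism Om'' Om'' (Tmap Om f (spherical_derivative f)).
Proof.
move=> cf; have [c1 c2] := spherical_domain_continuous sub_domain sF cf.
have [nr pp] := @spherical_domain_polar Om Om' f.
have F0 z : plane Om'' z -> [/\ normsq (stemval F z) != 0, F.2 z != 0 &
    normsq (stemval (sinv F) z) != 0 /\ (sinv F).2 z != 0].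
  move=> [J JS /(spherical_domainP cO domain_circular sub_domain sF _ JS)[p z2 F2]].
  by split; [exact: domain_normsq| |split; [exact: sinv_normsq|rewrite sinv2_eq0]].
have [d1 d2] := sinv_continuous (fun z Uz => let: And3 a _ _ := F0 z Uz in a) c1 c2.
exists (Tmap Om' g (spherical_derivative g)); split.
- have [] // := twistable_inverse n3 n0 twistable_domain twistable_reciprocal.
- apply: (Tmap_continuous n3 n0 cO sF) => //; first by move=> x [] /sub_domain.
  by move=> z /F0[].
- apply: (Tmap_continuous n3 n0 domain_circular reciprocal_stem) => //; first by move=> x [].
  by move=> z /F0[].
Qed.

Section Analytic.
Hypothesis oO : open Om'.
Hypothesis aF : stem_analytic Om' F.

Lemma analytic_extension_exists : exists E, analytic_extension Om' f E.
Proof.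
exists (stem_quot F); split; last first.
  by move=> x; exact: (stem_quot_spherical n3 n0 domain_circular domain_stem).
split=> // x Ox; apply: an_real_analytic_at.
exact: (stem_quot_analytic n0 domain_circular oO (is_stem_sym domain_stem) aF).
Qed.

Lemma analytic_extension_reciprocal : exists E, analytic_extension Om' g E.
Proof.
have aG := sinv_analytic aF domain_normsq.
exists (stem_quot (sinv F)); split; last first.
  by move=> x; exact: (stem_quot_spherical n3 n0 domain_circular reciprocal_stem).
split=> // x Ox; apply: an_real_analytic_at.
exact: (stem_quot_analytic n0 domain_circular oO (is_stem_sym reciprocal_stem) aG).
Qed.

Variables Ef Eg : A -> A.
Hypotheses (eF : analytic_extension Om' f Ef) (eG : analytic_extension Om' g Eg).

Lemma hat_reciprocal : hat Om' Eg = hat Om' Ef.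
Proof.
have E x : Om' x -> (Eg x == 0) = (Ef x == 0).
  move=> Ox; have := extension_norm n3 n0 domain_circular oO domain_stem reciprocal_stem aF
    domain_normsq eF eG Ox.
  have u0 := domain_normsq (plane_polar n0 domain_circular Ox).
  by move=> E; rewrite -(cddot_eq0 (Ef x)) -E mulf_eq0 (negbTE u0) orbF cddot_eq0.
by apply/seteqP; split=> x /hatP[Ox e]; apply/hatP; split=> //; move: e; rewrite E.
Qed.

Lemma hat_diffeomorphism : let T := Tmap Om f Ef in let Tg := Tmap Om' g Eg in
  [/\ analytic_diffeomorphism (hat Om' Ef) (hat Om' Ef) T,
      (forall x, hat Om' Ef x -> g x = cdinv (f (T x))) &
      inverse_on (hat Om' Ef) (hat Om' Ef) T Tg].
Proof.
have aG := sinv_analytic aF domain_normsq.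
have tF := hat_twistable n3 domain_circular domain_stem eF cO sub_domain sF domain_normsq.
have tG := hat_twistable n3 domain_circular reciprocal_stem eG domain_circular (@subset_refl _ _)
  reciprocal_stem sinv_normsq.
have rF := hat_analytic n3 n0 domain_circular domain_stem eF cO oO sub_domain sF aF domain_normsq.
have rG := hat_analytic n3 n0 domain_circular reciprocal_stem eG domain_circular oO (@subset_refl _ _)
  reciprocal_stem aG sinv_normsq.
rewrite hat_reciprocal in tG rG.
have [vE iE] := twistable_inverse n3 n0 tF tG (fun z _ _ _ => stemval_sinv F z).
by split=> //; exists (Tmap Om' g Eg).
Qed.

End Analytic.

End ReciprocalDomain.

End NonrealDomain.

(** Analyticity is assumed for some stem; it passes to [F] because stems agree on the plane set,
    which is open. *)
Lemma slice_analytic_stem (R : realType) (n : nat) (Om : set (CD R n)) f F : (n <= 3)%N ->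
  is_stem Om f F -> slice_analytic Om f -> stem_analytic Om F.
Proof.
move=> n3 sF [_ [G [sG [oP aG1] [_ aG2]]]] z pz.
have E : \forall w \near z, G.1 w = F.1 w /\ G.2 w = F.2 w.
  by apply: filterS (open_nbhs_nbhs (conj oP pz)) => w pw; have [] := stem_unique n3 sG sF pw.
split; [apply: an_near (real_analytic_at_an (aG1 z pz))
  |apply: an_near (real_analytic_at_an (aG2 z pz))].
  by apply: filterS E => w [].
by apply: filterS E => w [].
Qed.

(** The first clause rules out the convention [cdinv 0 = 0] for the values of [f] and of its slice
    conjugate. The equalities of sets in the last clauses say that the domain built from [g] is the
    one built from [f], so that [Tg] is the map attached to the reciprocal. *)
Theorem theorem4p5 (R : realType) (n : nat) (n_range : (1 <= n <= 3)%N)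
    (Om : set (CD R n)) (circOm : circular Om)
    (f : CD R n -> CD R n) (slice_f : slice Om f) :
  let Om' := Om `\` zeros Om (slice_normal Om f) in
  let Om'' := Om' `\` (cdreal `|` zeros_sd Om f) in
  let g := reciprocal Om' f in
  Om' !=set0 ->
  [/\ (forall x, Om' x -> f x != 0 /\ slice_conj Om f x != 0),
      (forall x, (Om' `&` (cdreal `|` zeros_sd Om f)) x ->
         g x = cdinv (f x) /\
         forall y, sphere x y -> cdinv (f x) = cdinv (f y)),
      (Om'' !=set0 ->
       let T := Tmap Om f (spherical_derivative f) in
       let Tg := Tmap Om' g (spherical_derivative g) in
       [/\ (forall x, Om'' x -> g x = cdinv (f (T x))),
           set_bij Om'' Om'' T,
           (forall y, Om'' y -> conformal (sphere y) T),
           (slice_continuous Om'' f -> homeomorphism Om'' Om'' T) &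
           Om'' = (Om' `\` zeros Om' (slice_normal Om' g))
                    `\` (cdreal `|` zeros_sd Om' g) /\
           inverse_on Om'' Om'' T Tg]) &
      (open Om' ->
       (forall h, slice_regular Om' h -> slice_analytic Om' h) /\
       (slice_analytic Om' f ->
        [/\ (exists E, analytic_extension Om' f E),
            (exists E, analytic_extension Om' g E) &
            (forall Ef Eg, analytic_extension Om' f Ef ->
               analytic_extension Om' g Eg ->
               let hatOm := Om' `\` zeros Om' Ef in
               let T := Tmap Om f Ef in
               let Tg := Tmap Om' g Eg in
               [/\ analytic_diffeomorphism hatOm hatOm T,
                   (forall x, hatOm x -> g x = cdinv (f (T x))) &
                   hatOm = (Om' `\` zeros Om' (slice_normal Om' g))
                             `\` zeros Om' Eg /\
                   inverse_on hatOm hatOm T Tg])]))].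
Proof.
move=> Om' Om'' g ne; have /andP[n0 n3] := n_range; have [F sF] := slice_f.2.
have cO' := domain_circular n3 n0 circOm sF ne.
split.
- exact: (domain_value n3 n0 circOm sF).
- exact: (reciprocal_degenerate n3 n0 circOm sF ne).
- move=> _ T Tg.
  have tF := twistable_domain n3 n0 circOm sF ne; have tG := twistable_reciprocal n3 n0 circOm sF ne.
  have [vE iE] := twistable_inverse n3 n0 tF tG (fun z _ _ _ => stemval_sinv F z).
  split=> //.
  + exact: inverse_on_bij iE.
  + move=> y Uy; have [J JS yE] := cd_polar y n0; rewrite yE in Uy *.
    apply: (conformal_Tmap n3 n0 tF tG (fun z _ _ _ => stemval_sinv F z) JS Uy).
    by have [_ z2 _] := (spherical_domainP n3 circOm cO' (@sub_domain _ _ Om f) sF _ JS).1 Uy.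
  + exact: (homeomorphism_Tmap n3 n0 circOm sF ne).
  + split=> //; rewrite (reciprocal_domain n3 n0 circOm sF ne).
    exact: (reciprocal_spherical_domain n3 n0 circOm sF ne).
move=> oO; split; first exact: slice_regular_analytic.
move=> /(slice_analytic_stem n3 (domain_stem sF)) aF; split.
- exact: (analytic_extension_exists n3 n0 circOm sF ne oO aF).
- exact: (analytic_extension_reciprocal n3 n0 circOm sF ne oO aF).
move=> Ef Eg eF eG hatOm T Tg.
have [d v i] := hat_diffeomorphism n3 n0 circOm sF ne oO aF eF eG.
split=> //; split=> //; rewrite (reciprocal_domain n3 n0 circOm sF ne).
exact: (esym (hat_reciprocal n3 n0 circOm sF ne oO aF eF eG)).
Qed.
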